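(* Let $f:\mathbb{S}^k\to\mathbb{D}(\mathbb{S})$ be a random function. Then $f$ is $\Sigma^b_1$-representable in $R\Sigma^b_1\text{-NIA}$ if and only if $f\in\mathbf{RFP}$.
   Context: Let $\mathbb{B}=\{0,1\}$, $\mathbb{S}=\mathbb{B}^*$, $\mathbb{O}=\mathbb{B}^{\mathbb{S}}$. $\mathbb{O}$ carries the $\sigma$-algebra generated by cylinders $\{\omega\mid\omega(\sigma)=b\}$ and the unique probability measure $\mu$ giving each cylinder measure $1/2$. $\mathbb{D}(\mathbb{S})$ is the set of functions $\lambda:\mathbb{S}\to[0,1]$ with $\sum_\sigma\lambda(\sigma)=1$; a random function is a map $\mathbb{S}^k\to\mathbb{D}(\mathbb{S})$. A probabilistic Turing machine (PTM) is a TM with two transition functions, at each step one of them chosen with probability $1/2$ independently; a PTM $\mathscr M$ computes the random function $f_{\mathscr M}$ with $f_{\mathscr M}(\sigma_1,\dots,\sigma_k)(\tau)$ the probability that $\mathscr M$ on input $\sigma_1\sharp\cdots\sharp\sigma_k$ outputs $\tau$. $\mathbf{RFP}$ is the class of random functions $f_{\mathscr M}$ for PTMs $\mathscr M$ running in polynomial time. The language $\mathcal{RL}$ has terms $t,s::= x\mid \epsilon\mid \mathtt{0}\mid\mathtt{1}\mid t\frown s\mid t\times s$ and formulas built from atoms $\mathtt{Flip}(t)$, $t=s$, $t\subseteq s$ with $\neg,\wedge,\vee,\exists,\forall$; over $\mathbb{S}$, $\frown$ is concatenation (written $ts$), $t\times s$ is $t$ concatenated with itself $|s|$ times, $\subseteq$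 is the prefix relation. $\mathtt{1}^t:=\mathtt{1}\times t$, $t\preceq s:=\mathtt{1}^t\subseteq\mathtt{1}^s$; $\exists x\preceq t.F:=\exists x.(\mathtt{1}^x\subseteq\mathtt{1}^t\wedge F)$; subword quantifiers $\exists x\subseteq^* t.F:=\exists x.\exists w.(w\subseteq t\wedge wx\subseteq t\wedge F)$, $\forall x\subseteq^* t.F:=\forall x.(\exists w.(w\subseteq t\wedge wx\subseteq t)\to F)$. A $\Sigma^b_1$-formula has the form $\exists x_1\preceq t_1\cdots\exists x_n\preceq t_n.G$ with all quantifiers in $G$ subword quantifiers. $\overline\sigma$ is the closed term denoting $\sigma\in\mathbb S$. For a closed formula $F$, $[\![F]\!]\subseteq\mathbb{O}$ is the (measurable) set of $\omega$ such that $F$ holds in the standard structure on $\mathbb{S}$ with $\mathtt{Flip}(t)$ interpreted as $\omega(t)=1$. $R\Sigma^b_1\text{-NIA}$ has axioms (for $\mathtt b\in\{\mathtt0,\mathtt1\}$): $x\epsilon=x$; $x(y\mathtt b)=(xy)\mathtt b$; $x\times\epsilon=\epsilon$; $x\times y\mathtt b=(x\times y)x$; $x\subseteq\epsilon\leftrightarrow x=\epsilon$; $x\subseteq y\mathtt b\leftrightarrow x\subseteq y\vee x=y\mathtt b$; $x\mathtt b=y\mathtt b\to x=y$; $x\mathtt0\neq y\mathtt1$; $x\mathtt b\neq\epsilon$; and induction on notation $B(\epsilon)\wedge\forall x.(B(x)\to B(x\mathtt0)\wedge B(x\mathtt1))\to\forall x.B(x)$ for every $\Sigma^b_1$-formula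 $B$ of $\mathcal{RL}$. A random function $f:\mathbb{S}^k\to\mathbb{D}(\mathbb{S})$ is $\Sigma^b_1$-representable in $R\Sigma^b_1\text{-NIA}$ if there is a $\Sigma^b_1$-formula $G(\vec x,y)$ with $R\Sigma^b_1\text{-NIA}\vdash\forall\vec x.\exists!y.G(\vec x,y)$ and $f(\sigma_1,\dots,\sigma_k)(\tau)=\mu([\![G(\overline{\sigma_1},\dots,\overline{\sigma_k},\overline\tau)]\!])$ for all $\sigma_1,\dots,\sigma_k,\tau\in\mathbb S$. *)

(* Defs.v *)
From HB Require Import structures.
From mathcomp Require Import all_boot all_order all_algebra.
From mathcomp Require Import all_classical all_reals all_analysis.
From mathcomp Require Import measurable_realfun.
From mathcomp Require Import zify ring lra.
Set Implicit Arguments. Unset Strict Implicit. Unset Printing Implicit Defensive.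
Import Order.TTheory GRing.Theory Num.Theory.
Local Open Scope classical_set_scope.
Local Open Scope ring_scope.

Definition cylinders (I : Type) : set (set (I -> bool)) :=
  [set C | exists i b, C = [set w | w i = b]].

Notation coin_space I := (g_sigma_algebraType (@cylinders I)).

(* Values on single cylinders alone do not determine a measure; the independence
   of distinct coordinates has to be included. *)
Definition fair (R : realType) (I : eqType) (P : probability (coin_space I) R) :=
  forall (s : seq I) (b : I -> bool), uniq s ->
    P [set w | forall i, i \in s -> w i = b i] = (2^-1 ^+ size s)%:E.

Lemma measurable_coin (I : Type) (i : I) (b : bool) :
  measurable ([set w | w i = b] : set (coin_space I)).
Proof. by apply: sub_gen_smallest; exists i, b. Qed.

Lemma measurable_coins (I : eqType) (s : seq I) (b : I -> bool) :
  measurable ([set w | forall i, i \in s -> w i = b i] : set (coin_space I)).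
Proof.
elim: s => [|j s IH].
  by rewrite (_ : mkset _ = setT) //; apply/seteqP; split.
rewrite (_ : mkset _ = [set w | w j = b j] `&`
    [set w | forall i, i \in s -> w i = b i]).
  by apply: measurableI => //; exact: measurable_coin.
apply/seteqP; split => w /=.
  move=> h; split; first by apply: h; rewrite mem_head.
  by move=> i si; apply: h; rewrite in_cons si orbT.
by move=> [h1 h2] i; rewrite in_cons => /orP[/eqP->|/h2].
Qed.

(* Existence: the binary digits of a uniform point of [0, 1[, indexed by pickle *)
Section fair_exists.
Variables (R : realType) (I : countType).

Let U := `[0%R, 1%R[%classic : set R.
Let mU : measurable (U : set (measurableTypeR R)).
Proof. exact: measurable_itv. Qed.

Definition digit (n : nat) (x : R) : bool := odd (Num.truncn (2 ^+ n.+1 * x)).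

Lemma measurable_truncn_eq (c : R) (m : nat) :
  measurable ([set x | Num.truncn (c * x) = m] : set (measurableTypeR R)).
Proof.
have mlt k : measurable ([set x | (Num.truncn (c * x) <= k)%N] : set (measurableTypeR R)).
  rewrite (_ : mkset _ = ( *%R c) @^-1` `]-oo, k.+1%:R[%classic).
    rewrite -[X in measurable X]setTI.
    by apply: mulrl_measurable => //; exact: measurable_itv.
  by apply/seteqP; split => x /=; rewrite truncn_le_nat in_itv.
case: m => [|m].
  rewrite (_ : mkset _ = [set x | (Num.truncn (c * x) <= 0)%N]) //.
  by apply/seteqP; split => x /=; rewrite leqn0 => /eqP.
rewrite (_ : mkset _ = [set x | (Num.truncn (c * x) <= m.+1)%N] `\`
  [set x | (Num.truncn (c * x) <= m)%N]); first exact: measurableD.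
apply/seteqP; split => x /=; first by move->; rewrite leqnn ltnn.
by move=> [h /negP]; lia.
Qed.

Lemma measurable_digit n b :
  measurable ([set x | digit n x = b] : set (measurableTypeR R)).
Proof.
rewrite (_ : mkset _ = \bigcup_(m in [set m | odd m = b])
   [set x | Num.truncn (2 ^+ n.+1 * x) = m]).
  by apply: bigcup_measurable => m _; exact: measurable_truncn_eq.
apply/seteqP; split => x /=; rewrite /digit.
  by move=> h; exists (Num.truncn (2 ^+ n.+1 * x)).
by move=> [m /= <- ->].
Qed.

Definition digits (x : measurableTypeR R) : coin_space I :=
  fun i => digit (pickle i) x.

Lemma measurable_digits : measurable_fun setT digits.
Proof.
apply: (@measurability _ _ (measurableTypeR R) (coin_space I) setT digits (@cylinders I)) => //.
move=> _ [_ [i [b ->]] <-]; rewrite setTI.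
exact: measurable_digit.
Qed.

Definition coin_flips (A : set (coin_space I)) : \bar R :=
  pushforward (mrestr (@lebesgue_measure R) mU) digits A.

Let flips0 : coin_flips set0 = 0%E.
Proof. by rewrite /coin_flips /pushforward preimage_set0 measure0. Qed.
Let flips_ge0 A : (0 <= coin_flips A)%E.
Proof. by rewrite /coin_flips /pushforward /mrestr measure_ge0. Qed.
Let flips_add : semi_sigma_additive coin_flips.
Proof.
move=> F mF tF mUF; rewrite /coin_flips /pushforward preimage_bigcup.
apply: measure_semi_sigma_additive.
- by move=> n; rewrite -[X in measurable X]setTI; exact: measurable_digits.
- apply/trivIsetP => /= i j _ _ ij; rewrite -preimage_setI.
  by move/trivIsetP : tF => /(_ _ _ _ _ ij) ->//; rewrite preimage_set0.
- by rewrite -preimage_bigcup -[X in measurable X]setTI; exact: measurable_digits.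
Qed.
HB.instance Definition _ := isMeasure.Build _ _ _ coin_flips flips0 flips_ge0 flips_add.
Let flipsT : coin_flips setT = 1%E.
Proof.
rewrite /coin_flips /pushforward preimage_setT /mrestr setTI.
by rewrite lebesgue_measure_itv /= lte_fin ltr01 sube0.
Qed.
HB.instance Definition _ := @Measure_isProbability.Build _ _ R coin_flips flipsT.

Let prefix_val (b : nat -> bool) n := (\sum_(i < n) b i * 2 ^ (n - i.+1))%N.

Lemma prefix_valS b n : prefix_val b n.+1 = (2 * prefix_val b n + b n)%N.
Proof.
rewrite /prefix_val big_ord_recr /= subnn expn0 muln1; congr addn.
rewrite big_distrr /=; apply: eq_bigr => i _.
by rewrite mulnCA -expnS subSn // subSS subnSK.
Qed.

Lemma prefix_val_lt b n : (prefix_val b n < 2 ^ n)%N.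
Proof.
elim: n => [|n IH]; first by rewrite /prefix_val big_ord0.
by rewrite prefix_valS expnS; case: (b n); lia.
Qed.

Lemma digits_prefix b n (x : R) : 0 <= x -> x < 1 ->
  (forall i, (i < n)%N -> digit i x = b i) <->
  Num.truncn (2 ^+ n * x) = prefix_val b n.
Proof.
move=> x0 x1.
have p2 k : 0 <= 2 ^+ k * x by rewrite mulr_ge0 // exprn_ge0.
have half k : (Num.truncn (2 ^+ k.+1 * x))./2 = Num.truncn (2 ^+ k * x).
  have /andP[h1 h2] := truncn_itv (p2 k.+1).
  apply/esym/eqP; rewrite truncn_eq //.
  move: h1 h2; set m := Num.truncn _ => h1 h2; rewrite exprS -mulrA in h1 h2.
  have e := odd_double_half m; move: e; set q := m./2; set r := odd m => e.
  have h3 : (q%:R *+ 2 : R) <= m%:R by rewrite -mulrnA ler_nat; lia.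
  have h4 : (m.+1%:R : R) <= q.+1%:R *+ 2 by rewrite -mulrnA ler_nat; case: (r) e; lia.
  rewrite !mulr2n in h3 h4.
  move: (2 ^+ k * x) h1 h2 => z h1 h2.
  by apply/andP; split; lra.
elim: n => [|n IH].
  split => // _; rewrite expr0 mul1r /prefix_val big_ord0.
  by apply/eqP; rewrite truncn_eq //= x0.
rewrite prefix_valS; split.
  move=> h; have {}IH := (IH.1 (fun i hi => h i (ltnW hi))).
  have := h n (leqnn _); rewrite /digit => hn.
  rewrite -[LHS]odd_double_half half IH hn; lia.
move=> h i; rewrite ltnS leq_eqVlt => /orP[/eqP->|].
  by rewrite /digit h oddD oddM /=; case: (b n).
apply: IH.2; rewrite -half h; case: (b n); lia.
Qed.

Lemma lebesgue_prefix b n :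
  mrestr (@lebesgue_measure R) mU [set x | forall i, (i < n)%N -> digit i x = b i]
  = (2^-1 ^+ n)%:E.
Proof.
rewrite /mrestr.
set v := prefix_val b n.
have p2 : 0 < 2 ^+ n :> R by rewrite exprn_gt0.
have v1 : v%:R + 1 <= 2 ^+ n :> R.
  by rewrite natr1 -natrX ler_nat; exact: prefix_val_lt.
rewrite (_ : _ `&` _ = `[v%:R / 2 ^+ n, (v%:R + 1) / 2 ^+ n[%classic).
  rewrite lebesgue_measure_itv /= lte_fin ltr_pM2r ?invr_gt0 //.
  rewrite ltrDl ltr01 -EFinB -mulrBl addrC addKr mul1r exprVn //.
apply/seteqP; split => x /=; rewrite /U /= !in_itv /=.
  move=> [h /andP[x0 x1]]; move/(digits_prefix _ _ x0 x1) : h => h.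
  have /truncn_itv : 0 <= 2 ^+ n * x by rewrite mulr_ge0 // ltW.
  rewrite h -/v ler_pdivrMr // ltr_pdivlMr //.
  by rewrite mulrC natr1.
rewrite ler_pdivrMr // ltr_pdivlMr // => /andP[h1 h2].
have x0 : 0 <= x.
  by rewrite -(pmulr_lge0 _ p2); apply: le_trans h1.
have x1 : x < 1.
  by rewrite -(ltr_pM2r p2) mul1r; apply: lt_le_trans h2 v1.
split; last by rewrite x0 x1.
apply/(digits_prefix _ _ x0 x1); apply/eqP.
by rewrite truncn_eq ?mulr_ge0 // ?(ltW p2) // [2 ^+ n * x]mulrC -(natr1 v) h1 h2.
Qed.

Lemma lebesgue_digits (s : seq nat) (b : nat -> bool) : uniq s ->
  mrestr (@lebesgue_measure R) mU [set x | forall i, i \in s -> digit i x = b i]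
  = (2^-1 ^+ size s)%:E.
Proof.
pose N := (\max_(i <- s) i).+1.
have sN : {subset s <= iota 0 N}.
  by move=> i si; rewrite mem_iota /= add0n ltnS; apply: leq_bigmax_seq.
move: N sN => N; move: {2}(N - size s)%N (leqnn (N - size s)%N) => d.
elim: d s b => [|d IH] s b hd sN us.
  have szs : size s = N.
    have := uniq_leq_size us sN; rewrite size_iota => h.
    by apply/eqP; rewrite eqn_leq h -subn_eq0 -leqn0 hd.
  have szi : (size (iota 0 N) <= size s)%N by rewrite size_iota szs.
  have [_ e] := uniq_min_size us sN szi.
  rewrite szs -(lebesgue_prefix b); congr mrestr; apply/seteqP; split => x /= h i.
    by move=> iN; apply: h; rewrite e mem_iota.
  by move=> /sN; rewrite mem_iota => iN; exact: h.
case: (pselect (exists2 j, (j < N)%N & j \notin s)) => [[j jN js]|no]; last first.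
  apply: IH => //; have : (size (iota 0 N) <= size s)%N.
    apply: uniq_leq_size; first exact: iota_uniq.
    move=> j; rewrite mem_iota => jN; apply: contrapT => /negP js.
    by apply: no; exists j.
  by rewrite size_iota; lia.
pose bb c i := if i == j then c else b i.
have step c : mrestr (@lebesgue_measure R) mU
    ([set x | forall i, i \in s -> digit i x = b i] `&` [set x | digit j x = c])
    = (2^-1 ^+ (size s).+1)%:E.
  rewrite -(IH (j :: s) (bb c)) /=; last 3 first.
  - lia.
  - move=> i; rewrite in_cons => /orP[/eqP->|/sN //]; rewrite mem_iota; exact: jN.
  - by rewrite js us.
  congr mrestr; apply/seteqP; split => x /=.
    move=> [h1 h2] i; rewrite in_cons /bb; case: eqP => [->|_] //= /h1 //.
  move=> h; split.
    move=> i si; rewrite h ?in_cons ?si ?orbT // /bb; case: eqP => // ij.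
    by move: js; rewrite -ij si.
  by rewrite h ?mem_head // /bb eqxx.
have ms : measurable ([set x | forall i, i \in s -> digit i x = b i] : set (measurableTypeR R)).
  rewrite (_ : mkset _ = \bigcap_(i in [set i | i \in s]) [set x | digit i x = b i]) //.
  by apply: bigcap_measurableType => i _; exact: measurable_digit.
rewrite (_ : [set x | _] = ([set x | forall i, i \in s -> digit i x = b i] `&` [set x | digit j x = true])
  `|` ([set x | forall i, i \in s -> digit i x = b i] `&` [set x | digit j x = false])); last first.
  apply/seteqP; split => x /=; last by case=> -[].
  by move=> h; case: (digit j x); [left|right].
rewrite measureU; last 3 first.
- by apply: measurableI => //; exact: measurable_digit.
- by apply: measurableI => //; exact: measurable_digit.
- by apply/seteqP; split => x //= [[_ ->] []].
transitivity ((2^-1 ^+ (size s).+1)%:E + (2^-1 ^+ (size s).+1)%:E : \bar R)%E.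
  by congr (_ + _)%E; [exact: (step true)|exact: (step false)].
by rewrite -EFinD exprS; congr EFin; field.
Qed.

Lemma coin_flips_fair : fair coin_flips.
Proof.
move=> s b us.
pose b' n := if @pickle_inv I n is Some i then b i else false.
rewrite -[in RHS](size_map pickle) -(lebesgue_digits b'); last first.
  by rewrite map_inj_uniq //; exact: (pcan_inj pickleK).
rewrite /coin_flips /pushforward; congr mrestr.
apply/seteqP; split => x /=; rewrite /digits.
  by move=> h _ /mapP[i si ->]; rewrite h // /b' pickleK_inv.
by move=> h i si; rewrite h ?map_f // /b' pickleK_inv.
Qed.

End fair_exists.

Lemma fair_exists (R : realType) (I : countType) :
  exists P : probability (coin_space I) R, fair P.
Proof. by exists (@coin_flips R I); exact: coin_flips_fair. Qed.

Lemma fair_unique (R : realType) (I : eqType) (P Q : probability (coin_space I) R) :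
  fair P -> fair Q -> forall A, measurable A -> P A = Q A.
Proof.
move=> fP fQ.
pose cyl (s : seq I) (b : I -> bool) : set (coin_space I) :=
  [set w | forall i, i \in s -> w i = b i].
pose G : set (set (coin_space I)) := [set A | A = set0 \/ exists s b, uniq s /\ A = cyl s b].
have GT : G setT by right; exists [::], (fun=> true); split => //; apply/seteqP; split.
have mG A : G A -> measurable A.
  by move=> [->//|[s [b [_ ->]]]]; exact: measurable_coins.
have GI : setI_closed G.
  move=> A B [->|[s [b [us ->]]]]; first by move=> _; left; rewrite set0I.
  move=> [->|[s' [b' [us' ->]]]]; first by left; rewrite setI0.
  have [h|/existsNP[i /not_implyP[si /not_implyP[si' ne]]]] :=
    pselect (forall i, i \in s -> i \in s' -> b i = b' i).
    right; exists (undup (s ++ s')), (fun i => if i \in s then b i else b' i).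
    split; first exact: undup_uniq.
    apply/seteqP; split => w /=.
      move=> [h1 h2] i; rewrite mem_undup mem_cat; case: ifP => [/h1 //|_ /=]; exact: h2.
    move=> h1; split => i si; rewrite h1 ?mem_undup ?mem_cat ?si ?orbT //.
    by case: ifP => // /h ->.
  left; apply/seteqP; split => w //= [h1 h2]; apply: ne.
  by rewrite -h1 // -h2.
have Gs : @measurable _ (coin_space I) `<=` <<s G >>.
  apply: smallest_sub; first exact: smallest_sigma_algebra.
  move=> _ [i [b ->]]; apply: sub_gen_smallest; right.
  exists [:: i], (fun=> b); split => //; apply/seteqP; split => w /=.
    by move=> <- j; rewrite inE => /eqP->.
  by apply; rewrite mem_head.
move=> A /Gs; apply: (@g_sigma_algebra_measure_unique _ _ _ G _ (fun=> setT)) => //.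
- by rewrite bigcup_const //; exists 0%N.
- move=> B [->|[s [b [us ->]]]]; first by rewrite !measure0.
  by have := fP s b us; have := fQ s b us => /= -> ->.
- move=> k; exact: (le_lt_trans (probability_le1 P measurableT) (ltry _)).
Qed.

Definition coin_measure (R : realType) (I : countType) : probability (coin_space I) R :=
  projT1 (cid (fair_exists R I)).

Lemma coin_measure_fair (R : realType) (I : countType) : fair (coin_measure R I).
Proof. exact: projT2 (cid (fair_exists R I)). Qed.

Notation word := (seq bool).

Record dist (R : realType) : Type := Dist {
  mass :> word -> R;
  mass_in01 : forall s, 0 <= mass s <= 1;
  mass_sum1 : \esum_(s in [set: word]) (mass s)%:E = 1%E }.

Definition random_function (R : realType) (k : nat) : Type :=
  k.-tuple word -> dist R.

(** ** The language RL, with de Bruijn indices *)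

Inductive term : Type :=
| TVar of nat
| TEps
| TBit of bool
| TCat of term & term
| TTimes of term & term.

Inductive formula : Type :=
| FFlip of term
| FEq of term & term
| FPre of term & term
| FNot of formula
| FAnd of formula & formula
| FOr of formula & formula
| FEx of formula
| FAll of formula.

Definition FImp A B := FOr (FNot A) B.
Definition FIff A B := FAnd (FImp A B) (FImp B A).

Fixpoint tsubst (f : nat -> term) (t : term) : term :=
  match t with
  | TVar n => f n
  | TEps => TEps
  | TBit b => TBit b
  | TCat t1 t2 => TCat (tsubst f t1) (tsubst f t2)
  | TTimes t1 t2 => TTimes (tsubst f t1) (tsubst f t2)
  end.

Definition tlift : term -> term := tsubst (fun n => TVar n.+1).

Definition up (f : nat -> term) (n : nat) : term :=
  if n is m.+1 then tlift (f m) else TVar 0.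

Fixpoint fsubst (f : nat -> term) (F : formula) : formula :=
  match F with
  | FFlip t => FFlip (tsubst f t)
  | FEq t s => FEq (tsubst f t) (tsubst f s)
  | FPre t s => FPre (tsubst f t) (tsubst f s)
  | FNot A => FNot (fsubst f A)
  | FAnd A B => FAnd (fsubst f A) (fsubst f B)
  | FOr A B => FOr (fsubst f A) (fsubst f B)
  | FEx A => FEx (fsubst (up f) A)
  | FAll A => FAll (fsubst (up f) A)
  end.

Definition flift : formula -> formula := fsubst (fun n => TVar n.+1).

(* [inst t] eliminates index 0; [repl t] replaces index 0 by a term that may
   itself mention index 0. *)
Definition inst (t : term) (F : formula) : formula :=
  fsubst (fun n => if n is m.+1 then TVar m else t) F.
Definition repl (t : term) (F : formula) : formula :=
  fsubst (fun n => if n is m.+1 then TVar m.+1 else t) F.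

Fixpoint tscoped (n : nat) (t : term) : bool :=
  match t with
  | TVar m => (m < n)%N
  | TEps | TBit _ => true
  | TCat t1 t2 | TTimes t1 t2 => tscoped n t1 && tscoped n t2
  end.

(* All free variables of F have index < n. *)
Fixpoint fscoped (n : nat) (F : formula) : bool :=
  match F with
  | FFlip t => tscoped n t
  | FEq t s | FPre t s => tscoped n t && tscoped n s
  | FNot A => fscoped n A
  | FAnd A B | FOr A B => fscoped n A && fscoped n B
  | FEx A | FAll A => fscoped n.+1 A
  end.

Definition ones (t : term) : term := TTimes (TBit true) t.

(* In the quantifiers below, t is a term outside the scope of the bound x,
   and x is index 0 of F. *)
Definition ex_le (t : term) (F : formula) : formula :=
  FEx (FAnd (FPre (ones (TVar 0)) (ones (tlift t))) F).

(* w <= u /\ wx <= u for the prefix relation, with w = index 0, x = index 1 *)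
Definition subword_witness (u : term) : formula :=
  FAnd (FPre (TVar 0) u) (FPre (TCat (TVar 0) (TVar 1)) u).

Definition ex_subword (t : term) (F : formula) : formula :=
  FEx (FEx (FAnd (subword_witness (tlift (tlift t))) (flift F))).

Definition all_subword (t : term) (F : formula) : formula :=
  FAll (FImp (FEx (subword_witness (tlift (tlift t)))) F).

Inductive subword_bounded : formula -> Prop :=
| SB_Flip t : subword_bounded (FFlip t)
| SB_Eq t s : subword_bounded (FEq t s)
| SB_Pre t s : subword_bounded (FPre t s)
| SB_Not A : subword_bounded A -> subword_bounded (FNot A)
| SB_And A B : subword_bounded A -> subword_bounded B ->
    subword_bounded (FAnd A B)
| SB_Or A B : subword_bounded A -> subword_bounded B ->
    subword_bounded (FOr A B)
| SB_Ex t A : subword_bounded A -> subword_bounded (ex_subword t A)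
| SB_All t A : subword_bounded A -> subword_bounded (all_subword t A).

Inductive Sigma1b : formula -> Prop :=
| Sigma1b_base A : subword_bounded A -> Sigma1b A
| Sigma1b_ex t A : Sigma1b A -> Sigma1b (ex_le t A).

(** ** Classical natural deduction with equality

    The formulas in Th may be open; since the eigenvariable conditions bear on
    the context G only, they act as their universal closures. *)

Inductive proves (Th : formula -> Prop) : seq formula -> formula -> Prop :=
| P_Ax G A : Th A -> proves Th G A
| P_Hyp G A : List.In A G -> proves Th G A
| P_NotI G A B : proves Th (A :: G) B -> proves Th (A :: G) (FNot B) ->
    proves Th G (FNot A)
| P_NotE G A B : proves Th (FNot A :: G) B ->
    proves Th (FNot A :: G) (FNot B) -> proves Th G A
| P_AndI G A B : proves Th G A -> proves Th G B -> proves Th G (FAnd A B)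
| P_AndEl G A B : proves Th G (FAnd A B) -> proves Th G A
| P_AndEr G A B : proves Th G (FAnd A B) -> proves Th G B
| P_OrIl G A B : proves Th G A -> proves Th G (FOr A B)
| P_OrIr G A B : proves Th G B -> proves Th G (FOr A B)
| P_OrE G A B C : proves Th G (FOr A B) -> proves Th (A :: G) C ->
    proves Th (B :: G) C -> proves Th G C
| P_AllI G A : proves Th (map flift G) A -> proves Th G (FAll A)
| P_AllE G A t : proves Th G (FAll A) -> proves Th G (inst t A)
| P_ExI G A t : proves Th G (inst t A) -> proves Th G (FEx A)
| P_ExE G A C : proves Th G (FEx A) ->
    proves Th (A :: map flift G) (flift C) -> proves Th G C
| P_EqI G t : proves Th G (FEq t t)
| P_EqE G A t s : proves Th G (FEq t s) -> proves Th G (inst t A) ->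
    proves Th G (inst s A).

(** ** The theory *)

Definition snoc (t : term) (b : bool) : term := TCat t (TBit b).

Inductive NIA : formula -> Prop :=
| NIA_cat_eps (x := TVar 0) : NIA (FEq (TCat x TEps) x)
| NIA_cat_bit b (x := TVar 0) (y := TVar 1) :
    NIA (FEq (TCat x (snoc y b)) (snoc (TCat x y) b))
| NIA_times_eps (x := TVar 0) : NIA (FEq (TTimes x TEps) TEps)
| NIA_times_bit b (x := TVar 0) (y := TVar 1) :
    NIA (FEq (TTimes x (snoc y b)) (TCat (TTimes x y) x))
| NIA_pre_eps (x := TVar 0) : NIA (FIff (FPre x TEps) (FEq x TEps))
| NIA_pre_bit b (x := TVar 0) (y := TVar 1) :
    NIA (FIff (FPre x (snoc y b)) (FOr (FPre x y) (FEq x (snoc y b))))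
| NIA_bit_inj b (x := TVar 0) (y := TVar 1) :
    NIA (FImp (FEq (snoc x b) (snoc y b)) (FEq x y))
| NIA_bit_neq (x := TVar 0) (y := TVar 1) :
    NIA (FNot (FEq (snoc x false) (snoc y true)))
| NIA_bit_eps b (x := TVar 0) : NIA (FNot (FEq (snoc x b) TEps))
| NIA_induction B (x := TVar 0) : Sigma1b B ->
    NIA (FImp (FAnd (inst TEps B)
                    (FAll (FImp B (FAnd (repl (snoc x false) B)
                                        (repl (snoc x true) B)))))
              (FAll B)).

(** ** Standard interpretation *)

Fixpoint teval (rho : nat -> word) (t : term) : word :=
  match t with
  | TVar n => rho n
  | TEps => [::]
  | TBit b => [:: b]
  | TCat t1 t2 => teval rho t1 ++ teval rho t2
  | TTimes t1 t2 => flatten (nseq (size (teval rho t2)) (teval rho t1))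
  end.

Definition scons (s : word) (rho : nat -> word) (n : nat) : word :=
  if n is m.+1 then rho m else s.

Fixpoint holds (w : word -> bool) (rho : nat -> word) (F : formula) : Prop :=
  match F with
  | FFlip t => w (teval rho t) = true
  | FEq t s => teval rho t = teval rho s
  | FPre t s => prefix (teval rho t) (teval rho s)
  | FNot A => ~ holds w rho A
  | FAnd A B => holds w rho A /\ holds w rho B
  | FOr A B => holds w rho A \/ holds w rho B
  | FEx A => exists s, holds w (scons s rho) A
  | FAll A => forall s, holds w (scons s rho) A
  end.

(* The environment is irrelevant for closed formulas. *)
Definition interp (F : formula) : set (coin_space word) :=
  [set w | holds w (fun=> [::]) F].

Lemma measurable_bigcup_count (T : countType) (F : T -> set (coin_space word)) :
  (forall s, measurable (F s)) -> measurable (\bigcup_s F s).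
Proof.
move=> mF.
rewrite (_ : \bigcup_s F s = \bigcup_n (if unpickle n is Some s then F s else set0)).
  by apply: bigcup_measurable => n _; case: unpickle.
apply/seteqP; split => w [].
  by move=> s _ Fs; exists (pickle s) => //; rewrite pickleK.
by move=> n _; case: unpickle => // s Fs; exists s.
Qed.

Lemma measurable_interp F : measurable (interp F).
Proof.
rewrite /interp; move: (fun=> [::]) => rho.
elim: F rho => [t|t s|t s|A IA|A IA B IB|A IA B IB|A IA|A IA] rho /=.
- exact: measurable_coin.
- have [e|e] := pselect (teval rho t = teval rho s).
    by rewrite (_ : mkset _ = setT) //; apply/seteqP; split.
  by rewrite (_ : mkset _ = set0) //; apply/seteqP; split.
- have [e|e] := boolP (prefix (teval rho t) (teval rho s)).
    by rewrite (_ : mkset _ = setT) //; apply/seteqP; split.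
  by rewrite (_ : mkset _ = set0) //; apply/seteqP; split.
- by apply: measurableC; exact: IA.
- by apply: measurableI; [exact: IA|exact: IB].
- by apply: measurableU; [exact: IA|exact: IB].
- rewrite (_ : mkset _ = \bigcup_(s in [set: word])
    [set w : coin_space word | holds w (scons s rho) A]).
    by apply: measurable_bigcup_count => s; exact: IA.
  by apply/seteqP; split => w /= [s]; [exists s|move=> _ ?; exists s].
- rewrite (_ : mkset _ = \bigcap_(s in [set: word])
    [set w : coin_space word | holds w (scons s rho) A]).
    rewrite -[X in measurable X]setCK setC_bigcap; apply: measurableC.
    apply: measurable_bigcup_count => s.
    by apply: measurableC; exact: IA.
  by apply/seteqP; split => w /= h s; [move=> _; exact: h|exact: h].
Qed.

(** ** Representability: in G, index 0 is y and index i.+1 is the i-th x *)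

Definition numeral (s : word) : term := foldl snoc TEps s.

Definition ex_unique (G : formula) : formula :=
  FEx (FAnd G (FAll (FImp
    (fsubst (fun n => if n is m.+1 then TVar m.+2 else TVar 0) G)
    (FEq (TVar 0) (TVar 1))))).

Definition instance (G : formula) (xs : seq word) (y : word) : formula :=
  fsubst (fun n => if n is m.+1 then numeral (nth [::] xs m) else numeral y) G.

Definition representable (R : realType) (k : nat)
    (f : random_function R k) : Prop :=
  exists G : formula,
    [/\ Sigma1b G,
        fscoped k.+1 G,
        proves NIA [::] (iter k FAll (ex_unique G)) &
        forall (xs : k.-tuple word) (y : word),
          (f xs y)%:E = coin_measure R word (interp (instance G xs y))].

(** ** Probabilistic Turing machines, with one two-way infinite tape *)

Inductive symbol (W : Type) : Type :=
| Blank | Bit of bool | Sharp | Work of W.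
Arguments Blank {W}.
Arguments Bit {W} _.
Arguments Sharp {W}.
Arguments Work {W} _.

Inductive move : Type := MoveL | MoveN | MoveR.

Record ptm : Type := Ptm {
  state : finType;
  work : finType;
  start : state;
  final : pred state;
  delta : bool -> state -> symbol work -> state * symbol work * move }.

(* (q, l, r): r lists the tape from the scanned cell rightwards, l lists it from
   the cell left of the scanned one leftwards; both are padded with blanks. *)
Definition config (M : ptm) : Type :=
  (state M * seq (symbol (work M)) * seq (symbol (work M)))%type.

Definition step (M : ptm) (c : bool) (x : config M) : config M :=
  let: (q, l, r) := x in
  if final q then x else
  let: (q', a, m) := delta c q (head Blank r) in
  match m with
  | MoveL => (q', behead l, head Blank l :: a :: behead r)
  | MoveN => (q', l, a :: behead r)
  | MoveR => (q', a :: l, behead r)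
  end.

(* c i is the outcome of the coin tossed at step i. *)
Definition run (M : ptm) (c : nat -> bool) (n : nat) (x : config M) :
  config M := iteri n (fun i => @step M (c i)) x.

Definition halted (M : ptm) (x : config M) : bool := final x.1.1.

Fixpoint leading_bits (W : Type) (r : seq (symbol W)) : word :=
  if r is Bit b :: r' then b :: leading_bits r' else [::].

(* The output is the longest binary word starting at the scanned cell. *)
Definition output (M : ptm) (x : config M) : word := leading_bits x.2.

(* Every word over {0,1,#} is of the form encode xs. *)
Fixpoint encode (W : Type) (xs : seq word) : seq (symbol W) :=
  match xs with
  | [::] => [::]
  | [:: s] => map Bit s
  | s :: xs' => map Bit s ++ Sharp :: encode W xs'
  end.

Definition init (M : ptm) (xs : seq word) : config M :=
  (start M, [::], encode (work M) xs).

Definition polytime (M : ptm) : Prop :=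
  exists p : {poly nat}, forall (xs : seq word) (c : nat -> bool),
    halted (run c p.[size (encode (work M) xs)] (init M xs)).

Definition outputs (M : ptm) (xs : seq word) (y : word) :
    set (coin_space nat) :=
  [set c | exists n, halted (run c n (init M xs)) /\
                     output (run c n (init M xs)) = y].

Definition RFP (R : realType) (k : nat) (f : random_function R k) : Prop :=
  exists M : ptm, polytime M /\
    forall (xs : k.-tuple word) (y : word),
      (f xs y)%:E = coin_measure R nat (outputs M xs y).

(* Main.v *)
(** From machines to formulas, one works in an arbitrary model of the theory, which suffices by
    completeness: a computation is a word listing the configurations as blocks of equal length,
    the coin tossed at step [i] is [Flip(1^i)], and induction on notation for the bounded
    existential formula "there is a history of length [x]" makes histories exist and be unique.
    On the standard model this formula describes the machine, and the toss times become pairwise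
    distinct oracle queries, so both sides have the weight of the same decision tree.

    Conversely, a function proved total has a witness that is feasible relative to the oracle: a
    restricted ultrapower of the feasible functions, saturated for universal feasible constraints,
    is a model of the theory, and would otherwise contain an argument without value. The queries
    of such a function are removed by lazy sampling: polynomially many coins are tossed first and
    are then used one after the other to answer each query not yet in a table, which preserves the
    output distribution. What remains is a deterministic feasible function of the input and the
    coins, compiled to a Turing machine whose tape has one track for each register. *)

Require Import Defs.
From mathcomp Require Import all_boot all_order all_algebra.
From mathcomp Require Import all_classical all_reals all_analysis.
From mathcomp Require Import zify.

Set Implicit Arguments. Unset Strict Implicit. Unset Printing Implicit Defensive.

Import GRing.Theory Num.Theory.

(** * Substitution *)

(** The narrow formula class shapes both directions. Induction covers only bounded existential
    formulas over subword quantifiers, so each auxiliary witness inside a model (a remainder, a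
    preceding word, a block) has to be a subword of a word at hand. The tape is kept as a ring that
    starts at the head: a move rotates it by one cell, blocks keep their length, and successive
    configurations are compared by concatenation and length alone.

    Conversely, a word has only quadratically many subwords, so formulas with subword quantifiers
    are decided by feasible search, and the theorem of Los holds for them in a power made of
    feasible functions. Induction asks for more: one feasible function that turns a witness at [x]
    into one at [xb]. Saturation supplies it: either some element refutes the step, or by
    compactness finitely many candidates, hence a single feasible function, perform it. Points pair
    an oracle with a valuation, which makes the witness uniform in the oracle; provable uniqueness,
    read in the standard model, makes its value the output. *)

Lemma tsubst_ext f g t : f =1 g -> tsubst f t = tsubst g t.
Proof. by move=> e; elim: t => //= [t -> s ->|t -> s ->]. Qed.

Lemma up_ext f g : f =1 g -> up f =1 up g.
Proof. by move=> e [|n] //=; rewrite e. Qed.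

Lemma fsubst_ext f g F : f =1 g -> fsubst f F = fsubst g F.
Proof.
elim: F f g => [t|t s|t s|A IA|A IA B IB|A IA B IB|A IA|A IA] f g e /=.
- by rewrite (tsubst_ext _ e).
- by rewrite !(tsubst_ext _ e).
- by rewrite !(tsubst_ext _ e).
- by rewrite (IA _ _ e).
- by rewrite (IA _ _ e) (IB _ _ e).
- by rewrite (IA _ _ e) (IB _ _ e).
- by rewrite (IA _ _ (up_ext e)).
- by rewrite (IA _ _ (up_ext e)).
Qed.

Lemma tsubst_comp f g t :
  tsubst f (tsubst g t) = tsubst (fun n => tsubst f (g n)) t.
Proof. by elim: t => //= [t -> s ->|t -> s ->]. Qed.

Lemma up_comp f g n : tsubst (up f) (up g n) = up (fun n => tsubst f (g n)) n.
Proof. by case: n => //= n; rewrite /tlift !tsubst_comp. Qed.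

Lemma fsubst_comp f g F :
  fsubst f (fsubst g F) = fsubst (fun n => tsubst f (g n)) F.
Proof.
elim: F f g => [t|t s|t s|A IA|A IA B IB|A IA B IB|A IA|A IA] f g /=;
  rewrite ?tsubst_comp ?IA ?IB //; by rewrite (fsubst_ext _ (up_comp _ _)).
Qed.

Lemma tsubst_id t : tsubst TVar t = t.
Proof. by elim: t => //= [t -> s ->|t -> s ->]. Qed.

Lemma fsubst_id f F : f =1 TVar -> fsubst f F = F.
Proof.
elim: F f => [t|t s|t s|A IA|A IA B IB|A IA B IB|A IA|A IA] f e /=;
  rewrite ?(tsubst_ext _ e) ?tsubst_id ?IA ?IB //.
- by move=> [|n] //=; rewrite e.
- by move=> [|n] //=; rewrite e.
Qed.

Definition shift (n : nat) : term := TVar n.+1.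
Definition single (t : term) (n : nat) : term := if n is m.+1 then TVar m else t.

Lemma flift_subst f F : fsubst (up f) (flift F) = flift (fsubst f F).
Proof. by rewrite /flift !fsubst_comp; apply: fsubst_ext. Qed.

Lemma single_tlift t s : tsubst (single s) (tlift t) = t.
Proof. by rewrite /tlift tsubst_comp tsubst_id. Qed.

Lemma inst_subst f t A :
  inst (tsubst f t) (fsubst (up f) A) = fsubst f (inst t A).
Proof.
rewrite /inst !fsubst_comp; apply: fsubst_ext => -[|n] //=.
exact: single_tlift.
Qed.

Lemma inst_up t f A :
  inst t (fsubst (up f) A) = fsubst (fun n => if n is m.+1 then f m else t) A.
Proof.
by rewrite /inst fsubst_comp; apply: fsubst_ext => -[|n] //=; exact: single_tlift.
Qed.

Lemma tsubst_scoped n f g t : tscoped n t ->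
  (forall i, (i < n)%N -> f i = g i) -> tsubst f t = tsubst g t.
Proof.
by move=> + e; elim: t => //= [t IH s IH' /andP[/IH -> /IH' ->]
  |t IH s IH' /andP[/IH -> /IH' ->]].
Qed.

Lemma fsubst_scoped n f g F : fscoped n F ->
  (forall i, (i < n)%N -> f i = g i) -> fsubst f F = fsubst g F.
Proof.
have upn m (f' g' : nat -> term) : (forall i, (i < m)%N -> f' i = g' i) ->
    forall i, (i < m.+1)%N -> up f' i = up g' i.
  by move=> e [|i] //= im; rewrite e.
elim: F n f g => [t|t s|t s|A IA|A IA B IB|A IA B IB|A IA|A IA] n f g /=.
- by move=> h e; rewrite (tsubst_scoped h e).
- by move=> /andP[h h'] e; rewrite (tsubst_scoped h e) (tsubst_scoped h' e).
- by move=> /andP[h h'] e; rewrite (tsubst_scoped h e) (tsubst_scoped h' e).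
- by move=> h e; rewrite (IA _ _ _ h e).
- by move=> /andP[h h'] e; rewrite (IA _ _ _ h e) (IB _ _ _ h' e).
- by move=> /andP[h h'] e; rewrite (IA _ _ _ h e) (IB _ _ _ h' e).
- by move=> h e; rewrite (IA _ _ _ h (upn _ _ _ e)).
- by move=> h e; rewrite (IA _ _ _ h (upn _ _ _ e)).
Qed.

Fixpoint tbound (t : term) : nat :=
  match t with
  | TVar n => n.+1
  | TCat t1 t2 | TTimes t1 t2 => maxn (tbound t1) (tbound t2)
  | _ => 0
  end.

Fixpoint fbound (F : formula) : nat :=
  match F with
  | FFlip t => tbound t
  | FEq t s | FPre t s => maxn (tbound t) (tbound s)
  | FNot A => fbound A
  | FAnd A B | FOr A B => maxn (fbound A) (fbound B)
  | FEx A | FAll A => fbound A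
  end.

Lemma tbound_scoped n t : (tbound t <= n)%N -> tscoped n t.
Proof.
elim: t => //= t IH s IH'; rewrite geq_max => /andP[/IH -> /IH' ->] //.
Qed.

Lemma fbound_scoped n F : (fbound F <= n)%N -> fscoped n F.
Proof.
elim: F n => [t|t s|t s|A IA|A IA B IB|A IA B IB|A IA|A IA] n /=.
- exact: tbound_scoped.
- by rewrite geq_max => /andP[h h']; rewrite !tbound_scoped.
- by rewrite geq_max => /andP[h h']; rewrite !tbound_scoped.
- exact: IA.
- by rewrite geq_max => /andP[h h']; rewrite IA ?IB.
- by rewrite geq_max => /andP[h h']; rewrite IA ?IB.
- by move=> h; apply: IA; exact: leqW.
- by move=> h; apply: IA; exact: leqW.
Qed.

(** * Structures and soundness *)

(** Equality is a congruence, so that terms and, later, expressions can themselves be the elements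
    of a structure. [quotient] makes it strict where the arithmetic wants plain rewriting. *)
Record structure : Type := Structure {
  car :> Type;
  s_eps : car;
  s_bit : bool -> car;
  s_cat : car -> car -> car;
  s_times : car -> car -> car;
  s_pre : car -> car -> Prop;
  s_flip : car -> Prop;
  s_eq : car -> car -> Prop;
  s_refl : forall x, s_eq x x;
  s_sym : forall x y, s_eq x y -> s_eq y x;
  s_trans : forall x y z, s_eq x y -> s_eq y z -> s_eq x z;
  s_catP : forall x x' y y', s_eq x x' -> s_eq y y' -> s_eq (s_cat x y) (s_cat x' y');
  s_timesP : forall x x' y y', s_eq x x' -> s_eq y y' ->
    s_eq (s_times x y) (s_times x' y');
  s_preP : forall x x' y y', s_eq x x' -> s_eq y y' -> s_pre x y -> s_pre x' y';
  s_flipP : forall x x', s_eq x x' -> s_flip x -> s_flip x' }.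

Arguments s_eps {_}.
Arguments s_bit {_} _.

Definition econs (T : Type) (x : T) (r : nat -> T) (n : nat) : T :=
  if n is m.+1 then r m else x.

Section Sat.
Variable M : structure.
Implicit Types r : nat -> M.

Fixpoint tev r (t : term) : M :=
  match t with
  | TVar n => r n
  | TEps => s_eps
  | TBit b => s_bit b
  | TCat t1 t2 => s_cat (tev r t1) (tev r t2)
  | TTimes t1 t2 => s_times (tev r t1) (tev r t2)
  end.

Fixpoint sat r (F : formula) : Prop :=
  match F with
  | FFlip t => s_flip (tev r t)
  | FEq t s => s_eq (tev r t) (tev r s)
  | FPre t s => s_pre (tev r t) (tev r s)
  | FNot A => ~ sat r A
  | FAnd A B => sat r A /\ sat r B
  | FOr A B => sat r A \/ sat r B
  | FEx A => exists x, sat (econs x r) A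
  | FAll A => forall x, sat (econs x r) A
  end.

Lemma tev_eq r r' t : (forall n, s_eq (r n) (r' n)) -> s_eq (tev r t) (tev r' t).
Proof.
move=> e; elim: t => //= [|b|t IH s IH'|t IH s IH'].
- exact: s_refl.
- exact: s_refl.
- exact: s_catP.
- exact: s_timesP.
Qed.

Lemma sat_eq r r' F : (forall n, s_eq (r n) (r' n)) -> sat r F <-> sat r' F.
Proof.
have sym (q q' : nat -> M) : (forall n, s_eq (q n) (q' n)) -> forall n, s_eq (q' n) (q n).
  by move=> e n; apply: s_sym.
have consE (q q' : nat -> M) x : (forall n, s_eq (q n) (q' n)) ->
    forall n, s_eq (econs x q n) (econs x q' n).
  by move=> e [|n] /=; [exact: s_refl|exact: e].
elim: F r r' => [t|t s|t s|A IA|A IA B IB|A IA B IB|A IA|A IA] r r' e /=.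
- have := tev_eq t e; have := tev_eq t (sym _ _ e) => h h'.
  by split; exact: s_flipP.
- have := tev_eq t e; have := tev_eq s e => h h'; split => k.
    exact: s_trans (s_trans (s_sym h') k) h.
  exact: s_trans (s_trans h' k) (s_sym h).
- have := tev_eq t e; have := tev_eq s e => h h'.
  by split; apply: s_preP => //; exact: s_sym.
- by split=> h /(IA _ _ e).
- by rewrite (IA _ _ e) (IB _ _ e).
- by rewrite (IA _ _ e) (IB _ _ e).
- by split=> -[x h]; exists x; move: h; apply: (IA _ _ _).1; apply: consE => //; exact: sym.
- by split=> h x; move: (h x); apply: (IA _ _ _).1; apply: consE => //; exact: sym.
Qed.

Lemma sat_ext r r' F : r =1 r' -> sat r F <-> sat r' F.
Proof. by move=> e; apply: sat_eq => n; rewrite e; exact: s_refl. Qed.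

Lemma tev_subst r f t : tev r (tsubst f t) = tev (fun n => tev r (f n)) t.
Proof. by elim: t => //= [t -> s ->|t -> s ->]. Qed.

Lemma sat_subst r f F : sat r (fsubst f F) <-> sat (fun n => tev r (f n)) F.
Proof.
have upE (q : nat -> M) (g : nat -> term) x :
    (fun n => tev (econs x q) (up g n)) =1 econs x (fun n => tev q (g n)).
  by move=> [|n] //=; rewrite /tlift tev_subst.
elim: F r f => [t|t s|t s|A IA|A IA B IB|A IA B IB|A IA|A IA] r f /=;
  rewrite ?tev_subst ?IA ?IB //.
- by split=> -[x h]; exists x; move: h; rewrite IA (sat_ext _ (upE _ _ _)).
- by split=> h x; move: (h x); rewrite IA (sat_ext _ (upE _ _ _)).
Qed.

Lemma sat_flift r x F : sat (econs x r) (flift F) <-> sat r F.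
Proof. by rewrite sat_subst. Qed.

Lemma sat_inst r t F : sat r (inst t F) <-> sat (econs (tev r t) r) F.
Proof. by rewrite sat_subst; apply: sat_ext => -[]. Qed.

Lemma tev_tlift r x t : tev (econs x r) (tlift t) = tev r t.
Proof. by rewrite tev_subst. Qed.

Lemma soundness (Th : formula -> Prop) (G : seq formula) A :
  (forall B r, Th B -> sat r B) -> proves Th G A ->
  forall r, (forall B, List.In B G -> sat r B) -> sat r A.
Proof.
move=> hTh; elim=> {G A}
  [G A /hTh //|G A hA r hG|G A B _ h1 _ h2 r hG|G A B _ h1 _ h2 r hG
  |G A B _ h1 _ h2 r hG|G A B _ h r hG|G A B _ h r hG|G A B _ h r hG|G A B _ h r hG
  |G A B C _ h _ h1 _ h2 r hG|G A _ h r hG|G A t _ h r hG|G A t _ h r hG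
  |G A C _ h _ h1 r hG|G t r hG|G A t s _ h _ h1 r hG] /=.
- exact: hG.
- move=> hA; have hG' B' : List.In B' (A :: G) -> sat r B' by case=> [<-//|/hG].
  exact: (h2 r hG') (h1 r hG').
- apply: contrapT => nA.
  have hG' B' : List.In B' (FNot A :: G) -> sat r B' by case=> [<-//|/hG].
  exact: (h2 r hG') (h1 r hG').
- by split; [exact: h1|exact: h2].
- by case: (h r hG).
- by case: (h r hG).
- by left; exact: h.
- by right; exact: h.
- by case: (h r hG) => hA; [apply: h1|apply: h2] => B' [<-//|/hG].
- by move=> x; apply: h => B /List.in_map_iff[B' [<- /hG]]; rewrite sat_flift.
- by rewrite sat_inst; exact: h.
- by exists (tev r t); rewrite -sat_inst; exact: h.
- have [x hx] := h r hG; rewrite -(sat_flift r x); apply: h1 => B [<-//|].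
  by move=> /List.in_map_iff[B' [<- /hG]]; rewrite sat_flift.
- exact: s_refl.
- rewrite sat_inst; have := h1 r hG; rewrite sat_inst; apply: (sat_eq _ _).1 => -[|n] /=.
    exact: h.
  exact: s_refl.
Qed.

End Sat.

(** * Completeness *)

Section Derivations.
Variable Th : formula -> Prop.
Notation "G |- A" := (proves Th G A) (at level 70).

Lemma weakening G G' A : G |- A -> (forall B, List.In B G -> List.In B G') -> G' |- A.
Proof.
have cons_incl (B : formula) G1 G2 : (forall C, List.In C G1 -> List.In C G2) ->
    forall C, List.In C (B :: G1) -> List.In C (B :: G2).
  by move=> s C [->|/s]; [left|right].
have map_incl G1 G2 : (forall C, List.In C G1 -> List.In C G2) ->
    forall C, List.In C (map flift G1) -> List.In C (map flift G2).
  move=> s C /List.in_map_iff[C' [<- /s h]]; apply/List.in_map_iff; by exists C'.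
move=> d; elim: d G' => {G A}
  [G A hA|G A hA|G A B _ h1 _ h2|G A B _ h1 _ h2
  |G A B _ h1 _ h2|G A B _ h|G A B _ h|G A B _ h|G A B _ h
  |G A B C _ h _ h1 _ h2|G A _ h|G A t _ h|G A t _ h
  |G A C _ h _ h1|G t|G A t s _ h _ h1] G' s'.
- exact: P_Ax.
- by apply: P_Hyp; exact: s'.
- by apply: (@P_NotI _ _ _ B); [apply: h1|apply: h2]; exact: cons_incl.
- by apply: (@P_NotE _ _ _ B); [apply: h1|apply: h2]; exact: cons_incl.
- by apply: P_AndI; [apply: h1|apply: h2].
- by apply: P_AndEl; apply: h.
- by apply: P_AndEr; apply: h.
- by apply: P_OrIl; apply: h.
- by apply: P_OrIr; apply: h.
- by apply: P_OrE (h _ s') _ _; [apply: h1|apply: h2]; exact: cons_incl.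
- by apply: P_AllI; apply: h; exact: map_incl.
- by apply: P_AllE; apply: h.
- by apply: P_ExI (h _ s').
- apply: P_ExE (h _ s') _; apply: h1; apply: cons_incl; exact: map_incl.
- exact: P_EqI.
- by apply: P_EqE (h _ s') (h1 _ s').
Qed.

Fixpoint upn (n : nat) (f : nat -> term) : nat -> term :=
  if n is m.+1 then up (upn m f) else f.

Lemma fsubst_iterAll n f A : fsubst f (iter n FAll A) = iter n FAll (fsubst (upn n f) A).
Proof.
elim: n f A => [|n IH] f A //; rewrite iterS /= IH; congr FAll; congr iter.
by apply: fsubst_ext; elim: n {IH} => [|n IH] //=; exact: up_ext.
Qed.

Lemma upn_lt n f i : (i < n)%N -> upn n f i = TVar i.
Proof.
elim: n f i => // n IH f [|i] //= h; rewrite IH //.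
Qed.

Lemma upn_ge n f i : upn n f (n + i) = tsubst (fun j => TVar (j + n)) (f i).
Proof.
elim: n => [|n IH] /=.
  by rewrite add0n -[LHS]tsubst_id; apply: tsubst_ext => j; rewrite addn0.
by rewrite IH /tlift tsubst_comp; apply: tsubst_ext => j; rewrite /= addnS.
Qed.

(** The outermost quantifier binds the largest index, so the term put in for it passes under the
    remaining binders: [upn] shifts it there, and the later instantiations undo the shift. *)
Lemma proves_iterAll_elim n G A (s : nat -> term) : G |- iter n FAll A ->
  G |- fsubst (fun i => if (i < n)%N then s i else TVar (i - n)) A.
Proof.
elim: n A => [|n IH] A.
  by rewrite /= fsubst_id // => i; rewrite /= subn0.
rewrite iterS => /(P_AllE (s n)).
rewrite /inst fsubst_iterAll => /IH; rewrite fsubst_comp.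
rewrite (@fsubst_ext _ (fun i => if (i < n.+1)%N then s i else TVar (i - n.+1))) // => i.
case: (ltngtP i n) => [lt|gt|->].
- by rewrite upn_lt //= lt ltnS ltnW.
- have [j ->] : exists j, i = (n + j.+1)%N by exists (i - n.+1)%N; lia.
  rewrite upn_ge /= ltnNge leq_addl /= addnK ltnNge -addSnnS leq_addr /=.
  by congr TVar; lia.
- rewrite -[X in upn _ _ X]addn0 upn_ge /= ltnS leqnn tsubst_comp.
  by rewrite -[RHS]tsubst_id; apply: tsubst_ext => j /=; rewrite ltnNge leq_addl /= addnK.
Qed.

(** An axiom is available in every context, also in the shifted ones that [P_AllI] creates, so it
    can be generalised over all its free variables and then instantiated by [s]. *)
Lemma axiom_instance G A s : Th A -> G |- fsubst s A.
Proof.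
move=> hA; have all n G' : G' |- iter n FAll A.
  elim: n G' => [|n IH] G'; first exact: P_Ax.
  by rewrite iterS; apply: P_AllI; exact: IH.
have := proves_iterAll_elim s (all (fbound A) G).
rewrite (@fsubst_scoped (fbound A) _ s) //; first exact: fbound_scoped.
by move=> i ->.
Qed.

Lemma proves_subst G A s : G |- A -> map (fsubst s) G |- fsubst s A.
Proof.
have lift_map G' f : map (fsubst (up f)) (map flift G') = map flift (map (fsubst f) G').
  by rewrite -!map_comp; apply: eq_map => B /=; exact: flift_subst.
have in_map (f : formula -> formula) B G' : List.In B G' -> List.In (f B) (map f G').
  by elim: G' => //= C G' IH [->|/IH]; [left|right].
move=> d; elim: d s => {G A}
  [G A hA|G A hA|G A B _ h1 _ h2|G A B _ h1 _ h2
  |G A B _ h1 _ h2|G A B _ h|G A B _ h|G A B _ h|G A B _ h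
  |G A B C _ h _ h1 _ h2|G A _ h|G A t _ h|G A t _ h
  |G A C _ h _ h1|G t|G A t t' _ h _ h1] s.
- exact: axiom_instance.
- by apply: P_Hyp; exact: in_map.
- by apply: (@P_NotI _ _ _ (fsubst s B)); [apply: h1|apply: h2].
- by apply: (@P_NotE _ _ _ (fsubst s B)); [apply: h1|apply: h2].
- by apply: P_AndI; [apply: h1|apply: h2].
- by apply: P_AndEl; apply: h.
- by apply: P_AndEr; apply: h.
- by apply: P_OrIl; apply: h.
- by apply: P_OrIr; apply: h.
- by apply: P_OrE (h s) (h1 s) (h2 s).
- by apply: P_AllI; rewrite -lift_map; exact: h.
- by rewrite -inst_subst; apply: P_AllE; apply: h.
- by apply: (@P_ExI _ _ _ (tsubst s t)); rewrite inst_subst; exact: h.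
- apply: P_ExE (h s) _; rewrite -lift_map -flift_subst; exact: h1.
- exact: P_EqI.
- rewrite -inst_subst; apply: P_EqE (h s) _; rewrite inst_subst; exact: h1.
Qed.

Definition consistent G := ~ exists2 B, G |- B & G |- FNot B.

Definition fresh (G : seq formula) : nat := foldr (fun F => maxn (fbound F)) 0 G.

Lemma fresh_scoped G F : List.In F G -> fscoped (fresh G) F.
Proof.
elim: G => //= C G IH [->|/IH h]; first by apply: fbound_scoped; exact: leq_maxl.
move: (fresh G) h => n; move: (leq_maxr (fbound C) n); move: (maxn _ _) => m.
have tmono a b t : (a <= b)%N -> tscoped a t -> tscoped b t.
  by move=> ab; elim: t => //= [i /leq_trans->//|t IH1 s IH2|t IH1 s IH2]
    /andP[/IH1 -> /IH2 ->].
elim: F n m {IH} => [t|t s|t s|A IA|A IA B IB|A IA B IB|A IA|A IA] n m nm /=.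
- exact: tmono.
- by move=> /andP[/(tmono _ _ _ nm) -> /(tmono _ _ _ nm) ->].
- by move=> /andP[/(tmono _ _ _ nm) -> /(tmono _ _ _ nm) ->].
- exact: IA.
- by move=> /andP[/(IA _ _ nm) -> /(IB _ _ nm) ->].
- by move=> /andP[/(IA _ _ nm) -> /(IB _ _ nm) ->].
- exact: IA.
- exact: IA.
Qed.

Lemma consistent_witness G A (m := fresh (FEx A :: G)) :
  consistent (FEx A :: G) -> consistent (inst (TVar m) A :: FEx A :: G).
Proof.
move=> con [B h1 h2]; apply: con.
have hm F : List.In F (FEx A :: G) -> fscoped m F by exact: fresh_scoped.
(* [s] sends the fresh variable to the eigenvariable and shifts all others; it turns the two
   derivations into the premise of [P_ExE]. *)
pose s i := if i == m then TVar 0 else TVar i.+1.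
have sE F : List.In F (FEx A :: G) -> fsubst s F = flift F.
  move=> /hm h; apply: (fsubst_scoped h) => i im.
  by rewrite /s; case: eqP => // e; move: im; rewrite e ltnn.
have sG : map (fsubst s) (inst (TVar m) A :: FEx A :: G) =
    A :: map flift (FEx A :: G).
  apply: (f_equal2 cons); last apply: (f_equal2 cons).
  - rewrite /inst fsubst_comp; have := hm _ (or_introl (erefl _)) => /= hA.
    rewrite -[RHS](fsubst_id A (fun=> erefl)); apply: (fsubst_scoped hA).
    case=> [|i] /= im; first by rewrite /s eqxx.
    by rewrite /s; case: eqP => // e; move: im; rewrite e ltnn.
  - by apply: sE; left.
  have : forall F, List.In F G -> fsubst s F = flift F by move=> F h; apply: sE; right.
  by elim: (G) => //= C G' IH h; rewrite h; [rewrite IH // => F hF; apply: h; right|left].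
have abs C : FEx A :: G |- C.
  apply: P_ExE; first by apply: P_Hyp; left.
  rewrite -sG; apply: (@P_NotE _ _ _ (fsubst s B)).
    by apply: weakening (proves_subst s h1) _ => D; right.
  by apply: weakening (proves_subst s h2) _ => D; right.
by exists (FEq TEps TEps); exact: abs.
Qed.

End Derivations.

(** * Formulas are countable *)

Fixpoint term_tree (t : term) : GenTree.tree nat :=
  match t with
  | TVar n => GenTree.Leaf n
  | TEps => GenTree.Node 0 [::]
  | TBit b => GenTree.Node (1 + b) [::]
  | TCat t s => GenTree.Node 3 [:: term_tree t; term_tree s]
  | TTimes t s => GenTree.Node 4 [:: term_tree t; term_tree s]
  end.

Fixpoint tree_term (x : GenTree.tree nat) : term :=
  match x with
  | GenTree.Leaf n => TVar n
  | GenTree.Node 0 _ => TEps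
  | GenTree.Node 1 _ => TBit false
  | GenTree.Node 2 _ => TBit true
  | GenTree.Node 3 [:: t; s] => TCat (tree_term t) (tree_term s)
  | GenTree.Node _ [:: t; s] => TTimes (tree_term t) (tree_term s)
  | _ => TEps
  end.

Lemma term_treeK : cancel term_tree tree_term.
Proof. by elim=> //= [[]|t -> s ->|t -> s ->]. Qed.

Fixpoint formula_tree (F : formula) : GenTree.tree nat :=
  match F with
  | FFlip t => GenTree.Node 0 [:: term_tree t]
  | FEq t s => GenTree.Node 1 [:: term_tree t; term_tree s]
  | FPre t s => GenTree.Node 2 [:: term_tree t; term_tree s]
  | FNot A => GenTree.Node 3 [:: formula_tree A]
  | FAnd A B => GenTree.Node 4 [:: formula_tree A; formula_tree B]
  | FOr A B => GenTree.Node 5 [:: formula_tree A; formula_tree B]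
  | FEx A => GenTree.Node 6 [:: formula_tree A]
  | FAll A => GenTree.Node 7 [:: formula_tree A]
  end.

Fixpoint tree_formula (x : GenTree.tree nat) : formula :=
  match x with
  | GenTree.Node 0 [:: t] => FFlip (tree_term t)
  | GenTree.Node 1 [:: t; s] => FEq (tree_term t) (tree_term s)
  | GenTree.Node 2 [:: t; s] => FPre (tree_term t) (tree_term s)
  | GenTree.Node 3 [:: A] => FNot (tree_formula A)
  | GenTree.Node 4 [:: A; B] => FAnd (tree_formula A) (tree_formula B)
  | GenTree.Node 5 [:: A; B] => FOr (tree_formula A) (tree_formula B)
  | GenTree.Node 6 [:: A] => FEx (tree_formula A)
  | GenTree.Node 7 [:: A] => FAll (tree_formula A)
  | _ => FFlip TEps
  end.

Lemma formula_treeK : cancel formula_tree tree_formula.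
Proof.
by elim=> //= [t|t s|t s|A ->|A -> B ->|A -> B ->|A ->|A ->] //; rewrite !term_treeK.
Qed.

(** * The Henkin construction *)

Section Completeness.
Variables (Th : formula -> Prop) (A0 : formula).
Hypothesis unprovable : ~ proves Th [::] A0.
Notation "G |- A" := (proves Th G A) (at level 70).

(** Free variables take the place of Henkin constants: each stage is a finite context and so leaves
    fresh ones. *)
Definition henkin_step (F : formula) (G : seq formula) : seq formula :=
  if `[< consistent Th (F :: G) >] then
    if F is FEx B then inst (TVar (fresh (F :: G))) B :: F :: G else F :: G
  else G.

Definition formula_enum (n : nat) : formula :=
  odflt A0 (omap tree_formula (unpickle n)).

Lemma formula_enum_surj F : exists n, formula_enum n = F.
Proof.
by exists (pickle (formula_tree F)); rewrite /formula_enum pickleK /= formula_treeK.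
Qed.

Fixpoint henkin (n : nat) : seq formula :=
  if n is m.+1 then henkin_step (formula_enum m) (henkin m) else [:: FNot A0].

Lemma henkin_consistent n : consistent Th (henkin n).
Proof.
elim: n => [|n IH] /=.
  by move=> [B h1 h2]; apply: unprovable; apply: P_NotE h1 h2.
rewrite /henkin_step; case: asboolP => // con.
by case: (formula_enum n) con => // A; exact: consistent_witness.
Qed.

Lemma henkin_mono m n B : (m <= n)%N -> List.In B (henkin m) -> List.In B (henkin n).
Proof.
move=> /subnK <-; elim: (n - m)%N => //= k IH /IH h.
rewrite /henkin_step; case: asboolP => // _.
by case: (formula_enum _) => *; rewrite /=; tauto.
Qed.

Definition thm B := exists n, henkin n |- B.

Lemma thm_mono m n B : (m <= n)%N -> henkin m |- B -> henkin n |- B.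
Proof. by move=> mn h; apply: weakening h _ => C; exact: henkin_mono. Qed.

Lemma thm2 B C D : (forall G, G |- B -> G |- C -> G |- D) -> thm B -> thm C -> thm D.
Proof.
move=> h [m hm] [n hn]; exists (maxn m n); apply: h.
  by apply: thm_mono hm; exact: leq_maxl.
by apply: thm_mono hn; exact: leq_maxr.
Qed.

Lemma thm1 B D : (forall G, G |- B -> G |- D) -> thm B -> thm D.
Proof. by move=> h [n /h ?]; exists n. Qed.

Lemma thm0 D : (forall G, G |- D) -> thm D.
Proof. by move=> h; exists 0; exact: h. Qed.

(** At its index in the enumeration [B] is either added, or inconsistent with that stage, which then
    proves its negation. *)
Lemma thm_not B : thm (FNot B) <-> ~ thm B.
Proof.
split=> [[n hn] [m hm]|nB].
  apply: (@henkin_consistent (maxn m n)); exists B.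
    by apply: thm_mono hm; exact: leq_maxl.
  by apply: thm_mono hn; exact: leq_maxr.
have [n en] := formula_enum_surj B.
have [con|incon] := pselect (consistent Th (B :: henkin n)).
  case: nB; exists n.+1; apply: P_Hyp; rewrite /= /henkin_step en.
  by case: asboolP => // _; case: (B) => *; rewrite /=; tauto.
exists n; case: (contrapT incon) => C h1 h2; exact: P_NotI h1 h2.
Qed.

Lemma thm_ex B : thm (FEx B) -> exists t, thm (inst t B).
Proof.
move=> h; have [n en] := formula_enum_surj (FEx B).
have [con|incon] := pselect (consistent Th (FEx B :: henkin n)).
  exists (TVar (fresh (FEx B :: henkin n))); exists n.+1; apply: P_Hyp.
  by rewrite /= /henkin_step en; case: asboolP => // _; left.
have : thm (FNot (FEx B)).
  by exists n; case: (contrapT incon) => C h1 h2; exact: P_NotI h1 h2.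
by move=> /thm_not.
Qed.

Lemma thm_notall B : ~ thm (FAll B) -> thm (FEx (FNot B)).
Proof.
move=> /thm_not; apply: thm1 => G h.
apply: (@P_NotE _ _ _ (FAll B)); last by apply: weakening h _ => C; right.
apply: P_AllI; apply: (@P_NotE _ _ _ (flift (FEx (FNot B)))).
  have -> : flift (FEx (FNot B)) = FEx (fsubst (up shift) (FNot B)) by [].
  apply: (@P_ExI _ _ _ (TVar 0)); apply: P_Hyp; left.
  by rewrite inst_up fsubst_id // => -[|n].
by apply: P_Hyp; right; left.
Qed.

Definition t_eq t s := thm (FEq t s).

Lemma t_refl t : t_eq t t.
Proof. by apply: thm0 => G; exact: P_EqI. Qed.

Lemma t_congr B t s : t_eq t s -> thm (inst t B) -> thm (inst s B).
Proof. by apply: thm2 => G; exact: P_EqE. Qed.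

Lemma t_sym t s : t_eq t s -> t_eq s t.
Proof.
move=> h; have := @t_congr (FEq (TVar 0) (tlift t)) _ _ h.
by rewrite /inst /= -!/(single _) !single_tlift; apply; exact: t_refl.
Qed.

Lemma t_trans t s u : t_eq t s -> t_eq s u -> t_eq t u.
Proof.
move=> h h'; have := @t_congr (FEq (tlift t) (TVar 0)) _ _ h'.
by rewrite /inst /= -!/(single _) !single_tlift; apply.
Qed.

Lemma t_op (op : term -> term -> term) :
  (forall f t s, tsubst f (op t s) = op (tsubst f t) (tsubst f s)) ->
  forall x x' y y', t_eq x x' -> t_eq y y' -> t_eq (op x y) (op x' y').
Proof.
move=> opE x x' y y' h h'; apply: (@t_trans _ (op x' y)).
  have := @t_congr (FEq (tlift (op x y)) (op (TVar 0) (tlift y))) _ _ h.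
  by rewrite /inst /= !opE -!/(single _) !single_tlift; apply; exact: t_refl.
have := @t_congr (FEq (tlift (op x' y)) (op (tlift x') (TVar 0))) _ _ h'.
by rewrite /inst /= !opE -!/(single _) !single_tlift; apply; exact: t_refl.
Qed.

Lemma t_preP x x' y y' : t_eq x x' -> t_eq y y' -> thm (FPre x y) -> thm (FPre x' y').
Proof.
move=> h h' hxy; have := @t_congr (FPre (TVar 0) (tlift y)) _ _ h.
have := @t_congr (FPre (tlift x') (TVar 0)) _ _ h'.
by rewrite /inst /= -!/(single _) !single_tlift => h1 h2; apply: h1; exact: h2.
Qed.

Lemma t_flipP x x' : t_eq x x' -> thm (FFlip x) -> thm (FFlip x').
Proof. by move=> h; exact: (@t_congr (FFlip (TVar 0)) _ _ h). Qed.

Definition term_model : structure := Structure TEps TBit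
  t_refl t_sym t_trans (@t_op TCat (fun _ _ _ => erefl))
  (@t_op TTimes (fun _ _ _ => erefl)) t_preP t_flipP.

Lemma tev_term_model (s : nat -> term_model) t : tev s t = tsubst s t.
Proof. by elim: t => //= [t -> u ->|t -> u ->]. Qed.

Lemma truth (s : nat -> term_model) F : sat s F <-> thm (fsubst s F).
Proof.
have consE (s' : nat -> term_model) (t : term_model) A :
    fsubst (econs t s' : nat -> term) A = inst t (fsubst (up s') A).
  by rewrite inst_up; apply: fsubst_ext => -[].
elim: F s => [t|t u|t u|A IA|A IA B IB|A IA B IB|A IA|A IA] s /=;
  rewrite ?tev_term_model //.
- by rewrite IA thm_not.
- rewrite IA IB; split=> [[]|h]; first by apply: thm2 => G; exact: P_AndI.
  by split; move: h; apply: thm1 => G; [exact: P_AndEl|exact: P_AndEr].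
- rewrite IA IB; split=> [[]|h].
  + by apply: thm1 => G; exact: P_OrIl.
  + by apply: thm1 => G; exact: P_OrIr.
  apply: contrapT => /not_orP[/thm_not hA /thm_not hB].
  have : thm (FNot (FOr (fsubst s A) (fsubst s B))).
    apply: thm2 hA hB => G hA hB; apply: (@P_NotI _ _ _ (fsubst s B)); last first.
      by apply: weakening hB _ => C; right.
    apply: P_OrE; first by apply: P_Hyp; left.
      apply: (@P_NotE _ _ _ (fsubst s A)).
        by apply: P_Hyp; right; left.
      by apply: weakening hA _ => C; do 3 right.
    by apply: P_Hyp; left.
  by move=> /thm_not.
- split=> [[t /IA]|].
    by rewrite consE; apply: thm1 => G; exact: P_ExI.
  by move=> /thm_ex[t ht]; exists t; apply/IA; rewrite consE.
- split=> [h|h t]; last by apply/IA; rewrite consE; apply: thm1 h => G; exact: P_AllE.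
  apply: contrapT => /thm_notall /thm_ex[t].
  rewrite -[inst _ _]/(FNot (inst t (fsubst (up s) A))) => /thm_not.
  by apply; rewrite -consE; apply/IA; exact: h.
Qed.

Lemma term_model_axioms B (s : nat -> term_model) : Th B -> sat s B.
Proof. by move=> hB; apply/truth; apply: thm0 => G; exact: axiom_instance. Qed.

Lemma term_model_refutes : ~ sat (TVar : nat -> term_model) A0.
Proof.
move=> /truth; rewrite fsubst_id //; apply/thm_not.
by exists 0; apply: P_Hyp; left.
Qed.

End Completeness.

(** * From a congruence to strict equality *)

Section Quotient.
Variable M : structure.

Definition eqclass : Type := {c : set M | exists x, c = s_eq x}.
Definition cls (x : M) : eqclass := exist _ (s_eq x) (ex_intro _ x erefl).
Definition rep (c : eqclass) : M := projT1 (cid (projT2 c)).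

Lemma cls_eq x y : cls x = cls y <-> s_eq x y.
Proof.
split=> [[e]|h]; first by rewrite e; exact: s_refl.
apply: eq_exist; apply/funext => z; apply/propext; split=> k.
  exact: s_trans (s_sym h) k.
exact: s_trans h k.
Qed.

Lemma repK c : cls (rep c) = c.
Proof.
by case: c => c hc; apply: eq_exist; rewrite /rep /=; case: cid => x /= ->.
Qed.

Lemma rep_cls x : s_eq (rep (cls x)) x.
Proof. by rewrite -cls_eq repK. Qed.

Definition quotient : structure.
Proof.
refine (@Structure eqclass (cls s_eps) (fun b => cls (s_bit b))
  (fun x y => cls (s_cat (rep x) (rep y))) (fun x y => cls (s_times (rep x) (rep y)))
  (fun x y => s_pre (rep x) (rep y)) (fun x => s_flip (rep x)) eq _ _ _ _ _ _ _).
- by [].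
- by move=> x y ->.
- by move=> x y z -> ->.
- by move=> x x' y y' -> ->.
- by move=> x x' y y' -> ->.
- by move=> x x' y y' -> ->.
- by move=> x x' ->.
Defined.

Lemma tev_quotient r t : tev (M := quotient) (fun n => cls (r n)) t = cls (tev r t).
Proof.
elim: t => //= [t -> s ->|t -> s ->]; apply/cls_eq.
  by apply: s_catP; exact: rep_cls.
by apply: s_timesP; exact: rep_cls.
Qed.

Lemma sat_quotient r F : sat (M := quotient) (fun n => cls (r n)) F <-> sat r F.
Proof.
have consE (q : nat -> M) x :
    ((fun n => cls (econs x q n)) : nat -> quotient) =1 econs (cls x : quotient) (fun n => cls (q n)).
  by case.
elim: F r => [t|t s|t s|A IA|A IA B IB|A IA B IB|A IA|A IA] r /=;
  rewrite ?tev_quotient ?IA ?IB //.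
- split; apply: s_flipP; first exact: rep_cls.
  by apply: s_sym; exact: rep_cls.
- exact: cls_eq.
- split; apply: s_preP; try exact: rep_cls.
    by apply: s_sym; exact: rep_cls.
  by apply: s_sym; exact: rep_cls.
- split=> [[c]|[x]].
    by rewrite -(repK c) -(sat_ext _ (consE _ _)) IA => h; exists (rep c).
  by rewrite -IA (sat_ext _ (consE _ _)); exists (cls x).
- split=> h.
    by move=> x; rewrite -IA (sat_ext _ (consE _ _)).
  by move=> c; rewrite -(repK c) -(sat_ext _ (consE _ _)) IA.
Qed.

End Quotient.

Definition model (Th : formula -> Prop) (M : structure) : Prop :=
  (forall x y : M, s_eq x y -> x = y) /\ forall A (r : nat -> M), Th A -> sat r A.

Theorem completeness (Th : formula -> Prop) (A : formula) :
  (forall M : structure, model Th M -> forall r : nat -> M, sat r A) ->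
  proves Th [::] A.
Proof.
move=> h; apply: contrapT => nA.
pose M := term_model Th A; apply: (@term_model_refutes _ _ nA).
rewrite -sat_quotient; apply: h; split=> // B r hB.
have -> : r = (fun n => cls (rep (r n) : M)) by apply/funext => n; rewrite repK.
by rewrite sat_quotient; exact: term_model_axioms.
Qed.

(** * Definable predicates, uniformly over the models of the theory *)

Definition etl (T : Type) (r : nat -> T) (n : nat) : T := r n.+1.

Definition TD n (f : forall M : structure, (nat -> M) -> M) :=
  exists2 t, tscoped n t & forall M r, f M r = tev r t.

(** One formula must define the predicate in all models, since it is to be used in an axiom. With
    the closure lemmas below, induction applies to predicates stated semantically, and the formula
    is found from their shape. *)
Definition SW n (P : forall M : structure, (nat -> M) -> Prop) :=
  exists F, [/\ subword_bounded F, fscoped n F &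
    forall M, model NIA M -> forall r, sat r F <-> P M r].

Definition S1 n (P : forall M : structure, (nat -> M) -> Prop) :=
  exists F, [/\ Sigma1b F, fscoped n F &
    forall M, model NIA M -> forall r, sat r F <-> P M r].

Definition subw (M : structure) (x t : M) :=
  exists w, s_pre w t /\ s_pre (s_cat w x) t.

Lemma tscoped_tlift n t : tscoped n t -> tscoped n.+1 (tlift t).
Proof. by elim: t => //= t IH s IH' /andP[/IH -> /IH' ->]. Qed.

Lemma fscoped_subst F n m f : fscoped n F ->
  (forall i, (i < n)%N -> tscoped m (f i)) -> fscoped m (fsubst f F).
Proof.
have ts n' m' f' t : tscoped n' t -> (forall i, (i < n')%N -> tscoped m' (f' i)) ->
    tscoped m' (tsubst f' t).
  by move=> + h; elim: t => //= [t IH s IH' /andP[/IH -> /IH' ->] //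
    |t IH s IH' /andP[/IH -> /IH' ->] //].
have ups n' m' f' : (forall i, (i < n')%N -> tscoped m' (f' i)) ->
    forall i, (i < n'.+1)%N -> tscoped m'.+1 (up f' i).
  by move=> h [|i] //= /h; exact: tscoped_tlift.
elim: F n m f => [t|t s|t s|A IA|A IA B IB|A IA B IB|A IA|A IA] n m f /=.
- exact: ts.
- by move=> /andP[h h'] e; rewrite (ts _ _ _ _ h e) (ts _ _ _ _ h' e).
- by move=> /andP[h h'] e; rewrite (ts _ _ _ _ h e) (ts _ _ _ _ h' e).
- exact: IA.
- by move=> /andP[h h'] e; rewrite (IA _ _ _ h e) (IB _ _ _ h' e).
- by move=> /andP[h h'] e; rewrite (IA _ _ _ h e) (IB _ _ _ h' e).
- by move=> h e; apply: IA h _; exact: ups.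
- by move=> h e; apply: IA h _; exact: ups.
Qed.

Lemma td_var n i : (i < n)%N -> TD n (fun M r => r i).
Proof. by exists (TVar i). Qed.

Lemma td_eps n : TD n (fun M r => s_eps).
Proof. by exists TEps. Qed.

Lemma td_bit n b : TD n (fun M r => s_bit b).
Proof. by exists (TBit b). Qed.

Lemma td_cat n f g : TD n f -> TD n g -> TD n (fun M r => s_cat (f M r) (g M r)).
Proof.
move=> [t ht et] [s hs es]; exists (TCat t s); first by rewrite /= ht.
by move=> M r /=; rewrite et es.
Qed.

Lemma td_times n f g : TD n f -> TD n g -> TD n (fun M r => s_times (f M r) (g M r)).
Proof.
move=> [t ht et] [s hs es]; exists (TTimes t s); first by rewrite /= ht.
by move=> M r /=; rewrite et es.
Qed.

Lemma td_weak k n f : TD n f -> TD (k + n) (fun M r => f M (fun i => r (k + i))).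
Proof.
move=> [t ht et]; exists (tsubst (fun i => TVar (k + i)) t) => [|M r]; last first.
  by rewrite et tev_subst.
elim: t ht {et} => //= [i|t IH s IH' /andP[/IH -> /IH' ->]|t IH s IH' /andP[/IH -> /IH' ->]] //.
by rewrite ltn_add2l.
Qed.

Lemma sw_flip n f : TD n f -> SW n (fun M r => s_flip (f M r)).
Proof.
by move=> [t ht et]; exists (FFlip t); split=> // [|M _ r]; [constructor|rewrite et].
Qed.

Lemma sw_eq n f g : TD n f -> TD n g -> SW n (fun M r => f M r = g M r).
Proof.
move=> [t ht et] [s hs es]; exists (FEq t s); split; first by constructor.
  by rewrite /= ht.
move=> M [hM _] r; rewrite et es /=; split; first exact: hM.
by move=> ->; exact: s_refl.
Qed.

Lemma sw_pre n f g : TD n f -> TD n g -> SW n (fun M r => s_pre (f M r) (g M r)).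
Proof.
move=> [t ht et] [s hs es]; exists (FPre t s); split; first by constructor.
  by rewrite /= ht.
by move=> M _ r; rewrite et es.
Qed.

Lemma sw_not n P : SW n P -> SW n (fun M r => ~ P M r).
Proof.
move=> [F [h1 h2 h3]]; exists (FNot F); split=> // [|M hM r]; first by constructor.
by rewrite /= h3.
Qed.

Lemma sw_and n P Q : SW n P -> SW n Q -> SW n (fun M r => P M r /\ Q M r).
Proof.
move=> [F [h1 h2 h3]] [F' [h1' h2' h3']]; exists (FAnd F F'); split.
- by constructor.
- by rewrite /= h2.
- by move=> M hM r; rewrite /= h3 ?h3'.
Qed.

Lemma sw_or n P Q : SW n P -> SW n Q -> SW n (fun M r => P M r \/ Q M r).
Proof.
move=> [F [h1 h2 h3]] [F' [h1' h2' h3']]; exists (FOr F F'); split.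
- by constructor.
- by rewrite /= h2.
- by move=> M hM r; rewrite /= h3 ?h3'.
Qed.

Lemma sw_imp n P Q : SW n P -> SW n Q -> SW n (fun M r => P M r -> Q M r).
Proof.
move=> hP hQ; have [F [h1 h2 h3]] := sw_or (sw_not hP) hQ; exists F; split=> // M hM r.
rewrite h3 //; split=> [[]//|h].
by have [/h|] := pselect (P M r); [right|left].
Qed.

Lemma sw_ex n t (Q : forall M : structure, M -> (nat -> M) -> Prop) :
  TD n t -> SW n.+1 (fun M r => Q M (r 0) (etl r)) ->
  SW n (fun M r => exists x, subw x (t M r) /\ Q M x r).
Proof.
move=> [t' ht et] [F [h1 h2 h3]]; exists (ex_subword t' F); split.
- by constructor.
- rewrite /= !tscoped_tlift //=; apply: fscoped_subst h2 _ => i; exact.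
- move=> M hM r /=; rewrite et; split=> [[x [w]]|[x [[w [hw1 hw2]] hQ]]].
    rewrite !tev_tlift sat_flift h3 // => -[[hw1 hw2] hQ].
    by exists x; split=> //; exists w.
  by exists x, w; rewrite !tev_tlift sat_flift h3.
Qed.

Lemma sw_all n t (Q : forall M : structure, M -> (nat -> M) -> Prop) :
  TD n t -> SW n.+1 (fun M r => Q M (r 0) (etl r)) ->
  SW n (fun M r => forall x, subw x (t M r) -> Q M x r).
Proof.
move=> [t' ht et] [F [h1 h2 h3]]; exists (all_subword t' F); split.
- by constructor.
- by rewrite /= !tscoped_tlift.
- move=> M hM r /=; rewrite et; split=> h x.
    move=> [w [hw1 hw2]]; case: (h x) => [[]|]; last by rewrite h3.
    by exists w; rewrite !tev_tlift.
  have [hx|hx] := pselect (subw x (tev r t')); [right|left].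
    by rewrite h3 //; exact: h.
  by move=> [w]; rewrite !tev_tlift => -[hw1 hw2]; apply: hx; exists w.
Qed.

Lemma sw_false n : SW n (fun M r => False).
Proof.
have [F [h1 h2 h3]] := sw_not (sw_eq (td_eps n) (td_eps n)).
by exists F; split=> // M hM r; rewrite h3 //; split=> // h; exact: h.
Qed.

Lemma sw_in n (T : Type) (L : seq T) (P : T -> forall M : structure, (nat -> M) -> Prop) :
  (forall s, SW n (P s)) -> SW n (fun M r => exists2 s, List.In s L & P s M r).
Proof.
move=> hP; elim: L => [|s L [F [h1 h2 h3]]].
  have [F [h1 h2 h3]] := sw_false n; exists F; split=> // M hM r; rewrite h3 //.
  by split=> // -[].
have [F' [h1' h2' h3']] := hP s; exists (FOr F' F); split.
- by constructor.
- by rewrite /= h2'.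
move=> M hM r /=; rewrite h3 // h3' //; split=> [[h|[u hu h]]|[u [->|hu] h]].
- by exists s => //; left.
- by exists u => //; right.
- by left.
- by right; exists u.
Qed.

Lemma s1_base n P : SW n P -> S1 n P.
Proof. by move=> [F [h1 h2 h3]]; exists F; split=> //; constructor. Qed.

Lemma s1_ex n t (Q : forall M : structure, M -> (nat -> M) -> Prop) :
  TD n t -> S1 n.+1 (fun M r => Q M (r 0) (etl r)) ->
  S1 n (fun M r => exists x,
    s_pre (s_times (s_bit true) x) (s_times (s_bit true) (t M r)) /\ Q M x r).
Proof.
move=> [t' ht et] [F [h1 h2 h3]]; exists (ex_le t' F); split.
- exact: Sigma1b_ex.
- by rewrite /= tscoped_tlift.
- move=> M hM r /=; rewrite et.
  by split=> -[x hx]; exists x; move: hx; rewrite tev_tlift h3.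
Qed.

Ltac td := lazy beta delta [etl];
  first [ by apply: td_var | exact: td_eps | exact: td_bit
        | apply: td_cat; td | apply: td_times; td ].
Ltac sw := lazy beta;
  match goal with
  | |- SW _ (fun M r => s_flip _) => apply: sw_flip; td
  | |- SW _ (fun M r => s_pre _ _) => apply: sw_pre; td
  | |- SW _ (fun M r => _ = _) => apply: sw_eq; td
  | |- SW _ (fun M r => ~ _) => apply: sw_not; sw
  | |- SW _ (fun M r => _ /\ _) => apply: sw_and; sw
  | |- SW _ (fun M r => _ \/ _) => apply: sw_or; sw
  | |- SW _ (fun M r => exists x, subw x _ /\ _) => apply: sw_ex; [td|sw]
  | |- SW _ (fun M r => forall x, subw x _ -> _) => apply: sw_all; [td|sw]
  | |- SW _ (fun M r => _ -> _) => apply: sw_imp; sw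
  | |- SW _ (fun M r => exists2 s, List.In s _ & _) => apply: sw_in => ?; sw
  | _ => idtac
  end.

Lemma nia_ind n P : S1 n P -> forall M, model NIA M -> forall r : nat -> M,
  P M (econs s_eps r) ->
  (forall x b, P M (econs x r) -> P M (econs (s_cat x (s_bit b)) r)) ->
  forall x, P M (econs x r).
Proof.
move=> [F [h1 h2 h3]] M hM r h0 hS x.
have := hM.2 _ r (NIA_induction h1) => /= -[nh|/(_ x)]; last by rewrite h3.
case: nh; split; first by rewrite sat_inst h3.
move=> y; have [hy|] := pselect (sat (econs y r) F); last by left.
have rE b : sat (econs y r) (repl (snoc (TVar 0) b) F).
  rewrite /repl sat_subst (sat_ext _ (r' := econs (s_cat y (s_bit b)) r)).
    by rewrite h3 //; apply: hS; rewrite -h3.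
  by case.
by right; split; exact: rE.
Qed.

(** * Words inside a model *)

Declare Scope nia_scope.
Delimit Scope nia_scope with nia.
Notation "x ^^ y" := (s_cat x y) (at level 40, left associativity) : nia_scope.
Notation "x ** y" := (s_times x y) (at level 39, left associativity) : nia_scope.
Notation "x <=p y" := (s_pre x y) (at level 70) : nia_scope.
Notation eps := s_eps.
Notation bt := (s_bit true).
Notation len x := (s_times (s_bit true) x).
Local Open Scope nia_scope.

Section Arithmetic.
Variable M : structure.
Hypothesis hM : model NIA M.
Implicit Types (x y z u v w l : M) (b c : bool).

Notation env0 := (fun _ : nat => (eps : M)).
Notation env1 a := (econs a env0).
Notation env2 a a' := (econs a (env1 a')).

Let strict := hM.1.

Lemma cat_eps x : x ^^ eps = x.
Proof. exact: strict (hM.2 _ (env1 x) NIA_cat_eps). Qed.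

Lemma cat_snoc x y b : x ^^ (y ^^ s_bit b) = x ^^ y ^^ s_bit b.
Proof. exact: strict (hM.2 _ (env2 x y) (NIA_cat_bit b)). Qed.

Lemma times_eps x : x ** eps = eps.
Proof. exact: strict (hM.2 _ (env1 x) NIA_times_eps). Qed.

Lemma times_snoc x y b : x ** (y ^^ s_bit b) = x ** y ^^ x.
Proof. exact: strict (hM.2 _ (env2 x y) (NIA_times_bit b)). Qed.

Lemma pre_eps x : x <=p eps <-> x = eps.
Proof.
have [] := hM.2 _ (env1 x) NIA_pre_eps => /= h1 h2; split=> h.
  by case: h1 => // /strict.
by case: h2 => // k; case: k; rewrite h; exact: s_refl.
Qed.

Lemma pre_snoc x y b : x <=p y ^^ s_bit b <-> x <=p y \/ x = y ^^ s_bit b.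
Proof.
have [] := hM.2 _ (env2 x y) (NIA_pre_bit b) => /= h1 h2; split=> h.
  by case: h1 => // -[?|/strict]; [left|right].
case: h2 => // k; case: k; case: h => [|->]; first by left.
by right; exact: s_refl.
Qed.

Lemma snoc_inj x y b c : x ^^ s_bit b = y ^^ s_bit c -> x = y /\ b = c.
Proof.
have neq u v : u ^^ s_bit false = v ^^ s_bit true -> False.
  by move=> e; apply: (hM.2 _ (env2 u v) NIA_bit_neq) => /=; rewrite e; exact: s_refl.
have inj b' : x ^^ s_bit b' = y ^^ s_bit b' -> x = y.
  move=> e; case: (hM.2 _ (env2 x y) (NIA_bit_inj b')) => /= [h|/strict//].
  by case: h; rewrite e; exact: s_refl.
case: b; case: c => e.
- by split=> //; exact: inj e.
- by case: (neq _ _ (esym e)).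
- by case: (neq _ _ e).
- by split=> //; exact: inj e.
Qed.

Lemma snoc_eps x b : x ^^ s_bit b <> eps.
Proof.
by move=> e; apply: (hM.2 _ (env1 x) (NIA_bit_eps b)) => /=; rewrite e; exact: s_refl.
Qed.

Lemma eps_cat x : eps ^^ x = x.
Proof.
apply: (nia_ind (n := 1) (P := fun M r => eps ^^ r 0 = r 0) _ hM (r := env0)).
- by apply: s1_base; sw.
- exact: cat_eps.
- by move=> y b /= h; rewrite cat_snoc h.
Qed.

Lemma wcatA x y z : x ^^ (y ^^ z) = x ^^ y ^^ z.
Proof.
apply: (nia_ind (n := 3) (P := fun M r => r 1 ^^ (r 2 ^^ r 0) = r 1 ^^ r 2 ^^ r 0)
  _ hM (r := env2 x y)).
- by apply: s1_base; sw.
- by rewrite /= !cat_eps.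
- by move=> u b /= h; rewrite !cat_snoc h.
Qed.

Lemma pre_refl x : x <=p x.
Proof.
apply: (nia_ind (n := 1) (P := fun M r => r 0 <=p r 0) _ hM (r := env0)).
- by apply: s1_base; sw.
- by apply/pre_eps.
- by move=> y b /= h; apply/pre_snoc; right.
Qed.

Lemma eps_pre x : eps <=p x.
Proof.
apply: (nia_ind (n := 1) (P := fun M r => eps <=p r 0) _ hM (r := env0)).
- by apply: s1_base; sw.
- by apply/pre_eps.
- by move=> y b /= h; apply/pre_snoc; left.
Qed.

Lemma pre_cat x y : x <=p x ^^ y.
Proof.
apply: (nia_ind (n := 2) (P := fun M r => r 1 <=p r 1 ^^ r 0) _ hM (r := env1 x)).
- by apply: s1_base; sw.
- by rewrite /= cat_eps; exact: pre_refl.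
- by move=> u b /= h; rewrite cat_snoc; apply/pre_snoc; left.
Qed.

Lemma subw_cat x y z : subw y (x ^^ y ^^ z).
Proof. by exists x; split; last exact: pre_cat; rewrite -wcatA; exact: pre_cat. Qed.

(** Induction needs the existential quantifier to be bounded; the remainder is a subword of the
    whole word, so a subword quantifier will do. The same device serves in [word_case],
    [prefix_of_len] and [ones_prefix]. *)
Lemma pre_ex x y : x <=p y -> exists z, y = x ^^ z.
Proof.
suff h : x <=p y -> exists z, subw z y /\ y = x ^^ z by move=> /h[z [_ ?]]; exists z.
apply: (nia_ind (n := 2) (P := fun M r => r 1 <=p r 0 ->
  exists p, subw p (r 0) /\ r 0 = r 1 ^^ p) _ hM (r := env1 x) _ _ y).
- by apply: s1_base; sw.
- move=> /= /pre_eps ->; exists eps; rewrite cat_eps; split=> //.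
  by have := subw_cat eps eps eps; rewrite !cat_eps.
- move=> u b /= h /pre_snoc[/h[z [_ ->]]|->].
    exists (z ^^ s_bit b); rewrite cat_snoc; split=> //.
    by have := subw_cat x (z ^^ s_bit b) eps; rewrite cat_eps cat_snoc.
  exists eps; rewrite cat_eps; split=> //.
  by have := subw_cat eps eps (u ^^ s_bit b); rewrite !eps_cat.
Qed.

Lemma pre_trans x y z : x <=p y -> y <=p z -> x <=p z.
Proof.
by move=> /pre_ex[u ->] /pre_ex[v ->]; rewrite -wcatA; exact: pre_cat.
Qed.

Lemma pre_subw x y : x <=p y -> subw x y.
Proof. by move=> h; exists eps; rewrite eps_cat; split=> //; exact: eps_pre. Qed.

Lemma subw_pre x y z : x <=p y -> subw y z -> subw x z.
Proof.
move=> /pre_ex[u ->] [w [h1 h2]]; exists w; split=> //.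
by apply: pre_trans h2; rewrite wcatA; exact: pre_cat.
Qed.

Lemma subw_trans x y z : subw x y -> subw y z -> subw x z.
Proof.
move=> [w [h1 h2]] [w' [h1' h2']]; exists (w' ^^ w); split.
  by apply: pre_trans h2'; case/pre_ex: h1 => u ->; rewrite wcatA; exact: pre_cat.
apply: pre_trans h2'; case/pre_ex: h2 => u ->; rewrite !wcatA; exact: pre_cat.
Qed.

Lemma word_case x : x = eps \/ exists y b, x = y ^^ s_bit b.
Proof.
suff : x = eps \/ exists y, subw y x /\ (x = y ^^ s_bit false \/ x = y ^^ s_bit true).
  by case=> [|[y [_ []]]]; [left|right; exists y, false|right; exists y, true].
apply: (nia_ind (n := 1) (P := fun M r => r 0 = eps \/ exists p, subw p (r 0) /\
  (r 0 = p ^^ s_bit false \/ r 0 = p ^^ s_bit true)) _ hM (r := env0) _ _ x).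
- by apply: s1_base; sw.
- by left.
- move=> y b _; right; exists y => /=; split; last by case: b; [right|left].
  by apply: pre_subw; exact: pre_cat.
Qed.

Lemma len_eps : len eps = eps :> M.
Proof. exact: times_eps. Qed.

Lemma len_snoc x b : len (x ^^ s_bit b) = len x ^^ bt.
Proof. exact: times_snoc. Qed.

Lemma len_bit b : len (s_bit b) = bt :> M.
Proof. by rewrite -[s_bit b]eps_cat len_snoc len_eps eps_cat. Qed.

Lemma len_cat x y : len (x ^^ y) = len x ^^ len y.
Proof.
apply: (nia_ind (n := 2) (P := fun M r => len (r 1 ^^ r 0) = len (r 1) ^^ len (r 0))
  _ hM (r := env1 x)).
- by apply: s1_base; sw.
- by rewrite /= len_eps !cat_eps.
- by move=> u b /= h; rewrite cat_snoc !len_snoc h wcatA.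
Qed.

Lemma bt_len x : bt ^^ len x = len x ^^ bt.
Proof.
apply: (nia_ind (n := 1) (P := fun M r => bt ^^ len (r 0) = len (r 0) ^^ bt)
  _ hM (r := env0)).
- by apply: s1_base; sw.
- by rewrite /= len_eps cat_eps eps_cat.
- by move=> u b /= h; rewrite len_snoc wcatA h.
Qed.

Lemma len_comm x y : len x ^^ len y = len y ^^ len x.
Proof.
apply: (nia_ind (n := 2) (P := fun M r => len (r 1) ^^ len (r 0) = len (r 0) ^^ len (r 1))
  _ hM (r := env1 x)).
- by apply: s1_base; sw.
- by rewrite /= len_eps cat_eps eps_cat.
- by move=> u b /= h; rewrite len_snoc wcatA h -!wcatA bt_len.
Qed.

Lemma len_len x : len (len x) = len x.
Proof.
apply: (nia_ind (n := 1) (P := fun M r => len (len (r 0)) = len (r 0))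
  _ hM (r := env0)).
- by apply: s1_base; sw.
- by rewrite /= !len_eps.
- by move=> u b /= h; rewrite len_snoc len_snoc h.
Qed.

Lemma len_eq_eps x : len x = eps -> x = eps.
Proof. by case: (word_case x) => // -[y [b ->]]; rewrite len_snoc => /snoc_eps. Qed.

Lemma cat_injr x y z : x ^^ z = y ^^ z -> x = y.
Proof.
apply: (nia_ind (n := 3) (P := fun M r => r 1 ^^ r 0 = r 2 ^^ r 0 -> r 1 = r 2)
  _ hM (r := env2 x y)).
- by apply: s1_base; sw.
- by rewrite /= !cat_eps.
- by move=> u b /= h; rewrite !cat_snoc => /snoc_inj[/h].
Qed.

(** Proved on lengths: there the extra bit commutes with the last bit of the first word, which is
    what the induction step requires. *)
Lemma cat_len_neq x y b : x ^^ (y ^^ s_bit b) <> x.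
Proof.
suff h : len x ^^ (len y ^^ bt) <> len x.
  by move=> e; apply: h; rewrite -[in RHS]e len_cat len_snoc.
apply: (nia_ind (n := 2) (P := fun M r => len (r 0) ^^ (len (r 1) ^^ bt) <> len (r 0))
  _ hM (r := env1 y)).
- by apply: s1_base; sw.
- by rewrite /= len_eps eps_cat => /snoc_eps.
- move=> u c /= h; rewrite len_snoc wcatA => /snoc_inj[e _]; apply: h.
  by rewrite -bt_len wcatA.
Qed.

(** The axioms recurse on the right argument, so the induction is on [x], with the other word
    generalised over all subwords of [y] to stay within the formula class. *)
Lemma cat_injl z x y : z ^^ x = z ^^ y -> x = y.
Proof.
suff h : forall y', subw y' y -> z ^^ x = z ^^ y' -> x = y'.
  by apply: h; apply: pre_subw; exact: pre_refl.
apply: (nia_ind (n := 3) (P := fun M r => forall p, subw p (r 1) ->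
   r 2 ^^ r 0 = r 2 ^^ p -> r 0 = p) _ hM (r := env2 y z) _ _ x).
- by apply: s1_base; sw.
- move=> /= y' _; rewrite cat_eps; case: (word_case y') => // -[u [b ->]] e.
  by case: (@cat_len_neq z u b).
- move=> u b /= h y' hy'; case: (word_case y') => [->|[u' [b' e]]].
    by rewrite cat_eps => /cat_len_neq.
  rewrite e !cat_snoc => /snoc_inj[e1 ->]; rewrite (h u') //.
  by apply: subw_pre hy'; rewrite e; exact: pre_cat.
Qed.

Lemma cat_eps_l x y : x ^^ y = x -> y = eps.
Proof. by move=> e; apply: (@cat_injl x); rewrite cat_eps. Qed.

Lemma cat_eq_eps x y : x ^^ y = eps -> x = eps /\ y = eps.
Proof.
case: (word_case y) => [->|[u [b ->]]]; first by rewrite cat_eps.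
by rewrite cat_snoc => /snoc_eps.
Qed.

Lemma pre_anti x y : x <=p y -> y <=p x -> x = y.
Proof.
move=> /pre_ex[u ->] /pre_ex[v]; rewrite -wcatA => /esym/cat_eps_l/cat_eq_eps[-> _].
by rewrite cat_eps.
Qed.

Lemma pre_len x y : x <=p y -> len x <=p len y.
Proof. by move=> /pre_ex[u ->]; rewrite len_cat; exact: pre_cat. Qed.

Lemma pre_total x y z : x <=p z -> y <=p z -> x <=p y \/ y <=p x.
Proof.
apply: (nia_ind (n := 3) (P := fun M r => r 1 <=p r 0 -> r 2 <=p r 0 ->
   r 1 <=p r 2 \/ r 2 <=p r 1) _ hM (r := env2 x y)).
- by apply: s1_base; sw.
- by move=> /= /pre_eps -> _; left; exact: eps_pre.
- move=> u b /= h /pre_snoc[hx|hx] /pre_snoc[hy|hy]; first exact: h.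
  + by left; rewrite hy; apply/pre_snoc; left.
  + by right; rewrite hx; apply/pre_snoc; left.
  + by left; rewrite hx hy; exact: pre_refl.
Qed.

Lemma pre_of_len x y z : x <=p z -> y <=p z -> len x <=p len y -> x <=p y.
Proof.
move=> hx hy hl; case: (pre_total hx hy) => // yx.
have /pre_ex[u eu] := yx; have e := pre_anti hl (pre_len yx).
move: e; rewrite eu len_cat => /cat_eps_l/len_eq_eps ->.
by rewrite cat_eps; exact: pre_refl.
Qed.

Lemma pre_eq_len x y z : x <=p z -> y <=p z -> len x = len y -> x = y.
Proof.
by move=> hx hy e; apply: pre_anti; apply: (@pre_of_len _ _ z) => //; rewrite e;
  exact: pre_refl.
Qed.

Lemma split_uniq x y x' y' : x ^^ y = x' ^^ y' -> len x = len x' -> x = x' /\ y = y'.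
Proof.
move=> e el; have ex : x = x'.
  apply: (@pre_eq_len _ _ (x ^^ y)) => //; first exact: pre_cat.
  by rewrite e; exact: pre_cat.
by split=> //; move: e; rewrite ex => /cat_injl.
Qed.

Lemma prefix_of_len x u : u <=p len x -> exists2 v, v <=p x & len v = u.
Proof.
suff h : u <=p len x -> exists v, subw v x /\ (v <=p x /\ len v = u).
  by move=> /h[v [_ []]]; exists v.
apply: (nia_ind (n := 2) (P := fun M r => r 1 <=p len (r 0) ->
  exists p, subw p (r 0) /\ (p <=p r 0 /\ len p = r 1)) _ hM (r := env1 u) _ _ x).
- by apply: s1_base; sw.
- move=> /=; rewrite len_eps => /pre_eps ->; exists eps; rewrite len_eps.
  by split; [apply: pre_subw|split=> //]; exact: pre_refl.
- move=> y b /= h; rewrite len_snoc => /pre_snoc[/h[v [_ [hv <-]]]|->].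
    have hv' : v <=p y ^^ s_bit b by apply: pre_trans hv _; exact: pre_cat.
    by exists v; split=> //; exact: pre_subw.
  exists (y ^^ s_bit b); rewrite len_snoc.
  by split; [apply: pre_subw|split=> //]; exact: pre_refl.
Qed.

Lemma split_ex u x y : len u = len x ^^ len y ->
  exists v w, [/\ u = v ^^ w, len v = len x & len w = len y].
Proof.
move=> e; have : len x <=p len u by rewrite e; exact: pre_cat.
move=> /prefix_of_len[v /pre_ex[w ew] ev]; exists v, w; split=> //.
by move: e; rewrite ew len_cat ev => /cat_injl.
Qed.

Lemma pre_tally x u : u <=p len x -> len u = u.
Proof. by move=> /prefix_of_len[v _ <-]; exact: len_len. Qed.

Lemma times_cat l x y : l ** (x ^^ y) = l ** x ^^ l ** y.
Proof.
apply: (nia_ind (n := 3) (P := fun M r => r 1 ** (r 2 ^^ r 0) = r 1 ** r 2 ^^ r 1 ** r 0)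
  _ hM (r := env2 l x)).
- by apply: s1_base; sw.
- by rewrite /= times_eps !cat_eps.
- by move=> u b /= h; rewrite cat_snoc !times_snoc h wcatA.
Qed.

Lemma len_times l x : len (l ** x) = len l ** x.
Proof.
apply: (nia_ind (n := 2) (P := fun M r => len (r 1 ** r 0) = len (r 1) ** r 0)
  _ hM (r := env1 l)).
- by apply: s1_base; sw.
- by rewrite /= !times_eps.
- by move=> u b /= h; rewrite !times_snoc len_cat h.
Qed.

Lemma times_pre l x y : x <=p y -> l ** x <=p l ** y.
Proof. by move=> /pre_ex[u ->]; rewrite times_cat; exact: pre_cat. Qed.

Lemma times_bit l b : l ** s_bit b = l.
Proof. by rewrite -[s_bit b]eps_cat times_snoc times_eps eps_cat. Qed.

Definition num (s : word) : M := foldl (fun x b => x ^^ s_bit b) eps s.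

Lemma num_cat s s' : num (s ++ s') = num s ^^ num s'.
Proof.
rewrite /num foldl_cat; elim/last_ind: s' => [|s' b IH] /=; first by rewrite cat_eps.
by rewrite !foldl_rcons IH cat_snoc.
Qed.

Lemma num_bit b : num [:: b] = s_bit b.
Proof. exact: eps_cat. Qed.

Lemma len_num s : len (num s) = num (nseq (size s) true).
Proof.
elim: s => [|b s IH]; first exact: len_eps.
by rewrite -cat1s num_cat len_cat num_bit len_bit IH -num_bit -num_cat.
Qed.

Lemma num_of_len x s : len x = len (num s) -> exists2 s', size s' = size s & x = num s'.
Proof.
elim/last_ind: s x => [|s b IH] x.
  by rewrite len_eps => /len_eq_eps ->; exists [::].
rewrite -cats1 num_cat num_bit len_snoc.
case: (word_case x) => [->|[y [c ->]]]; first by rewrite len_eps => /esym/snoc_eps.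
rewrite len_snoc => /snoc_inj[/IH[s' e ->] _]; exists (s' ++ [:: c]).
  by rewrite !size_cat e.
by rewrite num_cat num_bit.
Qed.

(** On the plane that marks the binary cells, this prefix has the length of the output. *)
Lemma ones_prefix x : exists v, [/\ len v = v, v <=p x & ~ v ^^ bt <=p x].
Proof.
suff : exists v, subw v x /\ (v <=p x /\ (len v = v /\ ~ v ^^ bt <=p x)).
  by move=> [v [_ [h1 [h2 h3]]]]; exists v.
apply: (nia_ind (n := 1) (P := fun M r => exists p, subw p (r 0) /\
  (p <=p r 0 /\ (len p = p /\ ~ p ^^ bt <=p r 0))) _ hM (r := env0) _ _ x).
- by apply: s1_base; sw.
- exists eps => /=; rewrite len_eps; split; first by apply: pre_subw; exact: pre_refl.
  split; first exact: pre_refl.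
  by split=> // /pre_eps/snoc_eps.
- move=> y b /= [v [_ [h1 [h2 h3]]]].
  have hv : v <=p y ^^ s_bit b by apply: pre_trans h1 _; exact: pre_cat.
  have [/[dup] e|ne] := pselect (v ^^ bt = y ^^ s_bit b); last first.
    exists v; split; first exact: pre_subw.
    by split=> //; split=> // /pre_snoc[].
  move=> <-; exists (v ^^ bt); split; first by apply: pre_subw; exact: pre_refl.
  split; first exact: pre_refl; split; first by rewrite len_snoc h2.
  move=> /pre_ex[u] /esym; rewrite -!wcatA => /cat_injl.
  by move=> /cat_eps_l/cat_eq_eps[]; rewrite -[bt]eps_cat => /snoc_eps.
Qed.

End Arithmetic.

(** * The standard model *)

Definition std (w : word -> bool) : structure.
Proof.
refine (@Structure word [::] (fun b => [:: b]) (fun x y => x ++ y)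
  (fun x y => flatten (nseq (size y) x)) (fun x y => prefix x y) (fun x => w x = true)
  eq _ _ _ _ _ _ _).
- by [].
- by move=> x y ->.
- by move=> x y z -> ->.
- by move=> x x' y y' -> ->.
- by move=> x x' y y' -> ->.
- by move=> x x' y y' -> ->.
- by move=> x x' ->.
Defined.

Lemma teval_std w (r : nat -> word) t : teval r t = tev (M := std w) r t.
Proof. by elim: t => //= [t -> s ->|t -> s ->]. Qed.

Lemma holds_std w (r : nat -> word) F : holds w r F <-> sat (M := std w) r F.
Proof.
elim: F r => [t|t s|t s|A IA|A IA B IB|A IA B IB|A IA|A IA] r /=;
  rewrite -?teval_std ?IA ?IB //.
- split=> -[s hs]; exists s.
    by move/IA : hs; apply: (sat_ext _ _).1; case.
  by apply/IA; move: hs; apply: (sat_ext _ _).1; case.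
- split=> h s.
    by move/IA : (h s); apply: (sat_ext _ _).1; case.
  by apply/IA; move: (h s); apply: (sat_ext _ _).1; case.
Qed.

Lemma prefix_snoc (x y : word) b : prefix x (y ++ [:: b]) = prefix x y || (x == y ++ [:: b]).
Proof.
rewrite !prefixE take_cat; case: ltngtP => [lt|gt|eq].
- by rewrite orb_idr // => /eqP e; move: lt; rewrite e size_cat ltnNge leq_addr.
- rewrite [take _ y]take_oversize ?(ltnW gt) //.
  have -> : take (size x - size y) [:: b] = [:: b] by rewrite take_oversize //= subn_gt0.
  rewrite [y ++ _ == x]eq_sym orbC; case: eqP => //= _.
  by apply/esym/eqP => e; move: gt; rewrite e ltnn.
- rewrite eq subnn take0 cats0 take_size orb_idr // => /eqP e.
  by move: eq; rewrite e size_cat addn1 => /esym/n_Sn.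
Qed.

Lemma std_model w : model NIA (std w).
Proof.
split=> [x y|A r]; first exact.
case=> {A} /=.
- exact: cats0.
- by move=> b; rewrite catA.
- by [].
- by move=> b; rewrite size_cat nseqD flatten_cat /= cats0.
- by case: (r 0) => [|a x]; split; [right|right|left|left].
- move=> b; have e : prefix (r 0) (r 1 ++ [:: b]) <-> prefix (r 0) (r 1) \/ r 0 = r 1 ++ [:: b].
    by rewrite prefix_snoc; split=> [/orP[->|/eqP]|[->//|->]];
      [left|right|rewrite eqxx orbT].
  case: (pselect (prefix (r 0) (r 1 ++ [:: b]))) => h; split; [right|right|left|left]=> //.
  + exact/e.
  + by move=> /e.
- move=> b; case: (pselect (r 0 ++ [:: b] = r 1 ++ [:: b])) => e; [right|left] => //.
  by move: e; rewrite !cats1 => /rcons_inj[].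
- by rewrite !cats1 => /rcons_inj[].
- by move=> b; case: (r 0).
- move=> B _; case: (pselect (sat (M := std w) r (inst TEps B) /\ forall x : std w,
    ~ sat (econs x r) B \/ sat (econs x r) (repl (snoc (TVar 0) false) B) /\
                           sat (econs x r) (repl (snoc (TVar 0) true) B))); last by left.
  move=> [h0 hS]; right; elim/last_ind => [|x b IH]; first by rewrite sat_inst in h0.
  case: (hS x) => // -[h1 h2]; rewrite -cats1.
  case: b; [move: h2|move: h1]; rewrite /repl sat_subst; by apply: (sat_ext _ _).1; case.
Qed.

Lemma std_num w s : num (std w) s = s.
Proof. by elim/last_ind: s => // s b IH; rewrite /num foldl_rcons -/(num _ _) IH /= cats1. Qed.

Lemma numeral_std w (r : nat -> word) s : tev (M := std w) r (numeral s) = s.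
Proof.
by elim/last_ind: s => // s b IH; rewrite /numeral foldl_rcons /= -/(numeral s) IH cats1.
Qed.

(** * Histories of a block machine inside a model *)

Lemma td_num n s : TD n (fun M r => num M s).
Proof.
elim/last_ind: s => [|s b IH]; first exact: td_eps.
exists (TCat (numeral s) (TBit b)) => [|M r].
  by rewrite /= andbT; elim/last_ind: s {IH} => // s c IH;
    rewrite /numeral foldl_rcons /= IH.
rewrite /num foldl_rcons /=; congr (_ ^^ _).
by elim/last_ind: s {IH} => // s c IH; rewrite /numeral !foldl_rcons /= -/(numeral s) IH.
Qed.

(** A plane of the tape is a ring: the scanned cell comes first and its left neighbour last. With
    [a] and [b] these two cells, a move is a rotation by one cell that keeps the middle part [Y] and
    the length. *)
Definition rot (M : structure) (mv : move) (a Y b : M) : M :=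
  match mv with
  | MoveN => a ^^ Y ^^ b
  | MoveR => Y ^^ b ^^ a
  | MoveL => b ^^ a ^^ Y
  end.

Lemma td_rot n mv f g h : TD n f -> TD n g -> TD n h ->
  TD n (fun M r => rot mv (f M r) (g M r) (h M r)).
Proof. by move=> hf hg hh; case: mv; do 2 apply: td_cat => //. Qed.

Ltac td' := lazy beta delta [etl];
  first [ by apply: td_var | exact: td_eps | exact: td_bit | exact: td_num
        | apply: td_rot; td' | apply: td_cat; td' | apply: td_times; td' | assumption
        | match goal with H : TD _ ?f |- TD _ (fun M r => ?f M _) =>
            first [ exact (td_weak 1 H) | exact (td_weak 2 H) | exact (td_weak 3 H)
                  | exact (td_weak 4 H) | exact (td_weak 5 H) ]
          end ].
Ltac sw' := lazy beta;
  match goal with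
  | |- SW _ (fun M r => s_flip _) => apply: sw_flip; td'
  | |- SW _ (fun M r => s_pre _ _) => apply: sw_pre; td'
  | |- SW _ (fun M r => _ = _) => apply: sw_eq; td'
  | |- SW _ (fun M r => ~ _) => apply: sw_not; sw'
  | |- SW _ (fun M r => _ /\ _) => apply: sw_and; sw'
  | |- SW _ (fun M r => _ \/ _) => apply: sw_or; sw'
  | |- SW _ (fun M r => exists x, subw x _ /\ _) => apply: sw_ex; [td'|sw']
  | |- SW _ (fun M r => forall x, subw x _ -> _) => apply: sw_all; [td'|sw']
  | |- SW _ (fun M r => exists2 s, List.In s _ & _) => apply: sw_in => ?; sw'
  | |- SW _ (fun M r => _ -> _) => apply: sw_imp; sw'
  | _ => idtac
  end.

Lemma in_enum (T : finType) (x : T) : List.In x (enum T).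
Proof.
have : x \in enum T by rewrite mem_enum.
by elim: (enum T) => // y s IH; rewrite inE => /orP[/eqP->|/IH]; [left|right].
Qed.

Section BlockMachine.
Variables mq m : nat.
(* two bit planes (is a bit, its value) and an m-bit plane for the working symbols *)
Definition cell : Type := (1.-tuple bool * 1.-tuple bool * m.-tuple bool)%type.
Variable tr : bool -> mq.-tuple bool -> cell -> mq.-tuple bool * cell * move.

Definition datum : Type := (mq.-tuple bool * cell * cell)%type.

Definition lq (M : structure) := num M (nseq mq true).
Definition lm (M : structure) := num M (nseq m true).

(** [n1] and [n3] are the lengths of the planes without the first and the last cell, the two cells
    that a move displaces. *)
Definition ell (M : structure) (n1 n3 : M) : M :=
  lq M ^^ (bt ^^ n1 ^^ bt) ^^ (bt ^^ n1 ^^ bt) ^^ (lm M ^^ n3 ^^ lm M).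

Definition blk (M : structure) (u : mq.-tuple bool) (mv : move) (a b : cell)
    (Y1 Y2 Y3 : M) : M :=
  num M u ^^ rot mv (num M a.1.1) Y1 (num M b.1.1) ^^
             rot mv (num M a.1.2) Y2 (num M b.1.2) ^^
             rot mv (num M a.2) Y3 (num M b.2).

Definition nxt (M : structure) c (d : datum) (Y1 Y2 Y3 : M) : M :=
  blk (tr c d.1.1 d.1.2).1.1 (tr c d.1.1 d.1.2).2 (tr c d.1.1 d.1.2).1.2 d.2 Y1 Y2 Y3.

(** The transition table becomes a finite disjunction over all contents of the state and of the two
    displaced cells; the middle parts are subwords of the block, so the relation has subword
    quantifiers only. *)
Definition bstep (M : structure) (n1 n3 i B B' : M) : Prop :=
  exists2 d : datum, List.In d (enum {: datum}) &
  exists Y1, subw Y1 B /\ exists Y2, subw Y2 B /\ exists Y3, subw Y3 B /\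
   (len Y1 = n1 /\ (len Y2 = n1 /\ (len Y3 = n3 /\
    (B = blk d.1.1 MoveN d.1.2 d.2 Y1 Y2 Y3 /\
     ((s_flip i /\ B' = nxt true d Y1 Y2 Y3) \/
      (~ s_flip i /\ B' = nxt false d Y1 Y2 Y3)))))).

(** Blocks have equal length, so block [j] is addressed by the length [ell ** j] of the word before
    it. *)
Definition valid (M : structure) (n1 n3 B0 i z : M) : Prop :=
  len z = ell n1 n3 ** (i ^^ bt) /\ (B0 <=p z /\
  forall j, subw j i -> j ^^ bt <=p i -> forall w, subw w z ->
  forall B, subw B z -> forall B', subw B' z -> w ^^ B ^^ B' <=p z ->
  len w = ell n1 n3 ** j -> len B = ell n1 n3 -> len B' = ell n1 n3 ->
  bstep n1 n3 j B B').

(** The last conditions make [len y] the longest prefix of ones of the plane [P1], which marks the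
    bits; [y] itself is read off the plane [P2] of their values. *)
Definition out (M : structure) (n1 n3 z y : M) : Prop :=
  exists w, subw w z /\ exists U, subw U z /\ exists P1, subw P1 z /\
  exists P2, subw P2 z /\ exists P3, subw P3 z /\
   (z = w ^^ (U ^^ P1 ^^ P2 ^^ P3) /\ (len U = lq M /\ (len P1 = bt ^^ n1 ^^ bt /\
   (len P2 = bt ^^ n1 ^^ bt /\ (len P3 = lm M ^^ n3 ^^ lm M /\
   (y <=p P2 /\ (len y <=p P1 /\ ~ len y ^^ bt <=p P1))))))).

Lemma sw_bstep n f1 f3 fi fB fB' : TD n f1 -> TD n f3 -> TD n fi -> TD n fB -> TD n fB' ->
  SW n (fun M r => bstep (f1 M r) (f3 M r) (fi M r) (fB M r) (fB' M r)).
Proof. move=> *; rewrite /bstep /nxt /blk; sw'. Qed.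

Lemma td_ell n f1 f3 : TD n f1 -> TD n f3 -> TD n (fun M r => ell (f1 M r) (f3 M r)).
Proof. by move=> *; rewrite /ell /lq /lm; td'. Qed.

Lemma sw_valid n f1 f3 f0 fi fz : TD n f1 -> TD n f3 -> TD n f0 -> TD n fi -> TD n fz ->
  SW n (fun M r => valid (f1 M r) (f3 M r) (f0 M r) (fi M r) (fz M r)).
Proof.
move=> h1 h3 h0 hi hz; rewrite /valid /ell /lq /lm; sw'; apply: sw_bstep; td'.
Qed.

Lemma sw_out n f1 f3 fz fy : TD n f1 -> TD n f3 -> TD n fz -> TD n fy ->
  SW n (fun M r => out (f1 M r) (f3 M r) (fz M r) (fy M r)).
Proof. move=> *; rewrite /out /lq /lm; sw'. Qed.

Section InModel.
Variable M : structure.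
Hypothesis hM : model NIA M.
Variables n1 n3 : M.
Hypotheses (n1_tally : len n1 = n1) (n3_tally : len n3 = n3).
Notation L := (ell n1 n3).

Lemma num_inj s s' : num M s = num M s' -> s = s'.
Proof.
elim/last_ind: s s' => [|s b IH] s'; case/lastP: s' => [|s' b'] //;
  rewrite /num !foldl_rcons -!/(num _ _).
- by move=> /esym/(snoc_eps hM).
- by move=> /(snoc_eps hM).
- by move=> /(snoc_inj hM)[/IH -> ->].
Qed.

Lemma len_tuple k (t : k.-tuple bool) : len (num M t) = num M (nseq k true).
Proof. by rewrite (len_num hM) size_tuple. Qed.

Lemma len_nseq k b : len (num M (nseq k b)) = num M (nseq k true).
Proof. by rewrite (len_num hM) size_nseq. Qed.

Lemma len_bt : len bt = bt :> M. Proof. exact: len_bit. Qed.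

Lemma nseq1 : num M (nseq 1 true) = bt.
Proof. exact: num_bit. Qed.

Lemma split_tally (u x y : M) : len u = x ^^ y -> len x = x -> len y = y ->
  exists v w : M, [/\ u = v ^^ w, len v = x & len w = y].
Proof.
move=> e ex ey; move: e; rewrite -{1}ex -{1}ey => /(split_ex hM)[v [w [-> ev ew]]].
by exists v, w; rewrite ev ew.
Qed.

Lemma len_plane3 : len (lm M ^^ n3 ^^ lm M) = lm M ^^ n3 ^^ lm M.
Proof. by rewrite !(len_cat hM) !len_nseq n3_tally. Qed.

Lemma len_plane1 : len (bt ^^ n1 ^^ bt) = bt ^^ n1 ^^ bt.
Proof. by rewrite !(len_cat hM) !len_bt n1_tally. Qed.

Lemma len_lq : len (lq M) = lq M. Proof. exact: len_nseq. Qed.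

Lemma len_ell : len L = L.
Proof. by rewrite /ell !(len_cat hM) -/(len _) !len_nseq !len_bt n1_tally n3_tally. Qed.

Lemma plane_split k n P : len n = n ->
  len P = num M (nseq k true) ^^ n ^^ num M (nseq k true) ->
  exists (a b : k.-tuple bool) (Y : M), P = num M a ^^ Y ^^ num M b /\ len Y = n.
Proof.
move=> hn /split_tally[].
- by rewrite (len_cat hM) len_nseq hn.
- exact: len_nseq.
move=> v [w [-> /split_tally[]//]]; first exact: len_nseq.
have toT x : len x = num M (nseq k true) -> exists t : k.-tuple bool, x = num M t.
  rewrite -(len_nseq k true) => /(num_of_len hM)[s]; rewrite size_nseq => es ->.
  by exists (tcast es (in_tuple s)); congr num; rewrite val_tcast.
move=> a [Y [-> /toT[ta ->] hY]] /toT[tb ->].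
by exists ta, tb, Y.
Qed.

Lemma plane_uniq k (a b a' b' : k.-tuple bool) Y Y' :
  num M a ^^ Y ^^ num M b = num M a' ^^ Y' ^^ num M b' -> len Y = len Y' ->
  [/\ a = a', b = b' & Y = Y'].
Proof.
move=> e el; have [|e1 /num_inj/val_inj ->] := split_uniq hM e.
  by rewrite !(len_cat hM) el !len_tuple.
by have [|/num_inj/val_inj -> ->] := split_uniq hM e1; rewrite ?len_tuple.
Qed.

Lemma block_split B : len B = L -> exists U P1 P2 P3 : M, [/\ B = U ^^ P1 ^^ P2 ^^ P3,
  len U = lq M, len P1 = bt ^^ n1 ^^ bt, len P2 = bt ^^ n1 ^^ bt &
  len P3 = lm M ^^ n3 ^^ lm M].
Proof.
have lc (x y : M) : len x = x -> len y = y -> len (x ^^ y) = x ^^ y.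
  by move=> ex ey; rewrite (len_cat hM) ex ey.
move=> /split_tally[]; rewrite ?len_plane3 //.
  by apply (lc); [apply (lc)|]; rewrite ?len_lq ?len_plane1.
move=> x [P3 [-> /split_tally[]]]; rewrite ?len_plane1 //.
  by apply: lc; rewrite ?len_lq ?len_plane1.
move=> y [P2 [-> /split_tally[]]]; rewrite ?len_plane1 ?len_lq //.
by move=> U [P1 [-> *]]; exists U, P1, P2, P3.
Qed.

Lemma block_uniq (U P1 P2 P3 U' P1' P2' P3' : M) :
  U ^^ P1 ^^ P2 ^^ P3 = U' ^^ P1' ^^ P2' ^^ P3' ->
  len U = len U' -> len P1 = len P1' -> len P2 = len P2' ->
  [/\ U = U', P1 = P1', P2 = P2' & P3 = P3'].
Proof.
move=> e e0 e1 e2.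
have [|{}e ->] := split_uniq hM e; first by rewrite !(len_cat hM) e0 e1 e2.
have [|{}e ->] := split_uniq hM e; first by rewrite !(len_cat hM) e0 e1.
by have [|-> ->] := split_uniq hM e.
Qed.

Lemma bstepI i B B' c d Y1 Y2 Y3 : len Y1 = n1 -> len Y2 = n1 -> len Y3 = n3 ->
  B = blk d.1.1 MoveN d.1.2 d.2 Y1 Y2 Y3 -> (s_flip i <-> c = true) ->
  B' = nxt c d Y1 Y2 Y3 -> bstep n1 n3 i B B'.
Proof.
move=> l1 l2 l3 eB hf eB'; exists d; first exact: in_enum.
exists Y1; split.
  have := subw_cat hM (num M d.1.1 ^^ num M d.1.2.1.1) Y1 (num M d.2.1.1 ^^
    (num M d.1.2.1.2 ^^ Y2 ^^ num M d.2.1.2) ^^ (num M d.1.2.2 ^^ Y3 ^^ num M d.2.2)).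
  by rewrite eB /blk /= !(wcatA hM).
exists Y2; split.
  have := subw_cat hM (num M d.1.1 ^^ (num M d.1.2.1.1 ^^ Y1 ^^ num M d.2.1.1) ^^
    num M d.1.2.1.2) Y2 (num M d.2.1.2 ^^ (num M d.1.2.2 ^^ Y3 ^^ num M d.2.2)).
  by rewrite eB /blk /= !(wcatA hM).
exists Y3; split.
  have := subw_cat hM (num M d.1.1 ^^ (num M d.1.2.1.1 ^^ Y1 ^^ num M d.2.1.1) ^^
    (num M d.1.2.1.2 ^^ Y2 ^^ num M d.2.1.2) ^^ num M d.1.2.2) Y3 (num M d.2.2).
  by rewrite eB /blk /= !(wcatA hM).
do 4 split=> //; case: c hf eB' => hf ->; first by left; split=> //; apply/hf.
by right; split=> // /hf.
Qed.

Lemma bstep_total i B : len B = L -> exists B', bstep n1 n3 i B B'.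
Proof.
move=> /block_split[U [P1 [P2 [P3 [eB hU h1 h2 h3]]]]].
have : exists u : mq.-tuple bool, U = num M u.
  move: hU; rewrite -len_lq => /(num_of_len hM)[s]; rewrite size_nseq => es ->.
  by exists (tcast es (in_tuple s)); congr num; rewrite val_tcast.
move=> [u eU].
have {}h1 : len P1 = num M (nseq 1 true) ^^ n1 ^^ num M (nseq 1 true) by rewrite nseq1.
have {}h2 : len P2 = num M (nseq 1 true) ^^ n1 ^^ num M (nseq 1 true) by rewrite nseq1.
have [a1 [b1 [Y1 [e1 l1]]]] := plane_split n1_tally h1.
have [a2 [b2 [Y2 [e2 l2]]]] := plane_split n1_tally h2.
have [a3 [b3 [Y3 [e3 l3]]]] := plane_split n3_tally h3.
pose d : datum := (u, ((a1, a2), a3), ((b1, b2), b3)).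
have eB' : B = blk d.1.1 MoveN d.1.2 d.2 Y1 Y2 Y3 by rewrite eB eU e1 e2 e3.
have [f|nf] := pselect (s_flip i).
  exists (nxt true d Y1 Y2 Y3); exact: (bstepI (c := true) l1 l2 l3 eB').
by exists (nxt false d Y1 Y2 Y3); apply: (bstepI (c := false) l1 l2 l3 eB').
Qed.

Lemma bstep_uniq i B B1 B2 : bstep n1 n3 i B B1 -> bstep n1 n3 i B B2 -> B1 = B2.
Proof.
move=> [d _ [Y1 [_ [Y2 [_ [Y3 [_ [l1 [l2 [l3 [eB h]]]]]]]]]]].
move=> [d' _ [Y1' [_ [Y2' [_ [Y3' [_ [l1' [l2' [l3' [eB' h']]]]]]]]]]].
have [| | |eu e1 e2 e3] := block_uniq (etrans (esym eB) eB').
- by rewrite !len_tuple.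
- by rewrite /= !(len_cat hM) !len_tuple l1 l1'.
- by rewrite /= !(len_cat hM) !len_tuple l2 l2'.
have [] := plane_uniq e1 (etrans l1 (esym l1')).
have [] := plane_uniq e2 (etrans l2 (esym l2')).
have [] := plane_uniq e3 (etrans l3 (esym l3')).
move: eu => /num_inj/val_inj.
case: d {eB e1 e2 e3} h => [[u [[a1 a2] a3]] [[b1 b2] b3]].
case: d' {eB'} h' => [[u' [[a1' a2'] a3']] [[b1' b2'] b3']] /= h' h.
move=> eu ea3 eb3 eY3 ea2 eb2 eY2 ea1 eb1 eY1; subst.
by case: h => [[f ->]|[nf ->]]; case: h' => [[f' ->]|[nf' ->]].
Qed.

Lemma len_rot k mv (a b : k.-tuple bool) (Y : M) : 
  len (rot mv (num M a) Y (num M b)) =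
  num M (nseq k true) ^^ len Y ^^ num M (nseq k true).
Proof.
case: mv; rewrite /= !(len_cat hM) !len_tuple // -(len_nseq k true).
  by rewrite -!(wcatA hM) (len_comm hM _ Y).
by rewrite (len_comm hM Y).
Qed.

Lemma bstep_len i B B' : bstep n1 n3 i B B' -> len B' = L.
Proof.
move=> [d _ [Y1 [_ [Y2 [_ [Y3 [_ [l1 [l2 [l3 [_ h]]]]]]]]]]].
by case: h => -[_ ->]; rewrite /nxt /blk !(len_cat hM) len_tuple !len_rot l1 l2 l3 !nseq1.
Qed.

Variable B0 : M.
Hypothesis len_B0 : len B0 = L.

Lemma tally_snoc_pre (i j : M) : len i = i -> len j = j -> j <=p i -> j ^^ bt <=p i ^^ bt.
Proof.
move=> hi hj /(pre_ex hM)[u eu]; rewrite -hi -hj -!(bt_len hM) hi hj eu (wcatA hM).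
exact: pre_cat.
Qed.

Lemma valid_ex x : exists z, valid n1 n3 B0 (len x) z.
Proof.
suff : exists z, len z <=p len (L ** (len x ^^ bt)) /\ valid n1 n3 B0 (len x) z.
  by move=> [z [_ h]]; exists z.
have hS : S1 4 (fun M r => exists z,
    len z <=p len (ell (r 1) (r 2) ** (len (r 0) ^^ bt)) /\
    valid (r 1) (r 2) (r 3) (len (r 0)) z).
  apply: s1_ex.
    by apply: td_times; [apply: td_ell; td'|td'].
  by apply: s1_base; apply: sw_valid; td'.
have bound z i : valid n1 n3 B0 i z -> len z <=p len (L ** (i ^^ bt)).
  by move=> [-> _]; rewrite (len_times hM) len_ell; exact: pre_refl.
apply: (nia_ind hS hM (r := econs n1 (econs n3 (econs B0 (fun _ => eps)))) _ _ x).
  exists B0; rewrite /= (len_eps hM).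
  have hv : valid n1 n3 B0 eps B0.
    split; first by rewrite (eps_cat hM) (times_bit hM).
    split; first exact: pre_refl.
    by move=> j _ /(pre_eps hM)/(snoc_eps hM).
  by split=> //; exact: bound.
move=> y b /= [z [_ hz]]; rewrite (len_snoc hM).
set i := len y in hz *.
have hi : len i = i by exact: len_len.
have [lz [hB0 hS']] := hz.
have : len z = L ** i ^^ L by rewrite lz (times_snoc hM).
move=> /split_tally[]; rewrite ?(len_times hM) ?len_ell // => w [B [ez lw lB]].
have [B' hB'] := bstep_total i lB; have lB' := bstep_len hB'.
have hv : valid n1 n3 B0 (i ^^ bt) (z ^^ B').
  split; first by rewrite (len_cat hM) lz lB' (times_snoc hM _ (i ^^ bt)).
  split; first by apply: (pre_trans hM hB0); exact: pre_cat.
  move=> j hj hj1 w1 _ B1 _ B1' _ hpre lw1 lB1 lB1'.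
  have lp : len (w1 ^^ B1 ^^ B1') = L ** (j ^^ bt ^^ bt).
    by rewrite !(len_cat hM) lw1 lB1 lB1' !(times_snoc hM).
  (* Either the pair of blocks lies in [z] already, or it consists of the last block of [z] and of
     [B']. *)
  case/(pre_snoc hM) : hj1 => [hj1|/(snoc_inj hM)[ej _]].
    have hjj : len j = j.
      by apply: (pre_tally hM (x := y)); apply: (pre_trans hM _ hj1); exact: pre_cat.
    have hin : w1 ^^ B1 ^^ B1' <=p z.
      apply: (pre_of_len hM hpre); first exact: pre_cat.
      rewrite lp lz; apply: (times_pre hM); apply: tally_snoc_pre => //.
      by rewrite (len_snoc hM) hjj.
    apply: (hS' j _ hj1 w1 _ B1 _ B1' _ hin) => //.
    - by apply: (pre_subw hM); apply: (pre_trans hM _ hj1); exact: pre_cat.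
    - apply: (pre_subw hM); apply: (pre_trans hM _ hin).
      by rewrite -(wcatA hM); exact: pre_cat.
    - by apply: (subw_trans hM (subw_cat hM w1 B1 B1')); exact: pre_subw.
    - apply: (subw_trans hM _ (pre_subw hM hin)).
      by have := subw_cat hM (w1 ^^ B1) B1' eps; rewrite (cat_eps hM).
  have e : w1 ^^ B1 ^^ B1' = z ^^ B'.
    apply: (pre_eq_len hM hpre); first exact: pre_refl.
    by rewrite lp ej (times_snoc hM _ (i ^^ bt)) (len_cat hM) lz lB'.
  have [|e1 ->] := split_uniq hM e.
    by rewrite lz !(len_cat hM) lw1 lB1 (times_snoc hM) ej.
  rewrite ez in e1; have [|_ ->] := split_uniq hM e1; first by rewrite lw1 lw ej.
  by rewrite ej.
exists (z ^^ B'); split=> //.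
by have := bound _ _ hv; rewrite (len_times hM) len_ell.
Qed.

(** Induction on the number of blocks on which both histories agree. Agreement is expressed by
    prefixes: any prefix of [z] with that many blocks is a prefix of [z']. *)
Lemma valid_uniq x z z' : valid n1 n3 B0 (len x) z -> valid n1 n3 B0 (len x) z' -> z = z'.
Proof.
set i := len x => -[lz [h0 hS]] [lz' [h0' hS']].
have hi : len i = i by exact: len_len.
suff h : forall y, len y <=p i -> forall w, subw w z -> w <=p z ->
    len w = L ** (len y ^^ bt) -> w <=p z'.
  apply: (pre_eq_len hM (z := z')); [|exact: pre_refl|by rewrite lz lz'].
  apply: (h i); rewrite ?hi //; try exact: pre_refl.
  by apply: (pre_subw hM); exact: pre_refl.
have hSW : S1 6 (fun M r => len (r 0) <=p (r 1) -> forall w, subw w (r 2) -> w <=p (r 2) ->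
    len w = ell (r 4) (r 5) ** (len (r 0) ^^ bt) -> w <=p (r 3)).
  by apply: s1_base; rewrite /ell /lq /lm; sw'.
move=> y; apply: (nia_ind hSW hM (r := econs i (econs z (econs z' (econs n1
  (econs n3 (fun _ => eps)))))) _ _ y) => /= {y}.
  move=> _ w _ hw; rewrite (len_eps hM) (eps_cat hM) (times_bit hM) -len_B0 => lw.
  by rewrite (pre_eq_len hM hw h0 lw).
move=> y b IH; rewrite (len_snoc hM) => hy w _ hw lw.
have hy0 : len y <=p i by apply: (pre_trans hM _ hy); exact: pre_cat.
set j := len y in hy lw hy0 IH.
have hj : len j = j by exact: len_len.
have := lw; rewrite (times_snoc hM).
move=> /split_tally[]; rewrite ?(len_times hM) ?len_ell // => w1 [B' [ew lw1 lB']].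
have := lw1; rewrite (times_snoc hM).
move=> /split_tally[]; rewrite ?(len_times hM) ?len_ell // => w0 [B [ew1 lw0 lB]].
have hw1 : w1 <=p z by apply: (pre_trans hM _ hw); rewrite ew; exact: pre_cat.
have hw1' : w1 <=p z' by apply: IH => //; exact: pre_subw.
(* [v] is [z'] cut after as many blocks as [w]; its last block [B''] and the block [B'] of [z] both
   succeed [B]. *)
have [|v hv lv] := prefix_of_len hM (x := z') (u := L ** (j ^^ bt ^^ bt)).
  rewrite lz'; apply: (times_pre hM); apply: tally_snoc_pre => //.
  by rewrite (len_snoc hM) hj.
have : w1 <=p v.
  by apply: (pre_of_len hM hw1' hv); rewrite lw1 lv; apply: (times_pre hM); exact: pre_cat.
move=> /(pre_ex hM)[B'' ev].
have lB'' : len B'' = L.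
  apply: (cat_injl hM (z := len w1)); rewrite -(len_cat hM) -ev lv lw1.
  by rewrite (times_snoc hM _ (j ^^ bt)).
have sub (t u : M) : t ^^ u <=p z -> subw u z.
  by move=> h; apply: (subw_trans hM _ (pre_subw hM h));
    have := subw_cat hM t u eps; rewrite (cat_eps hM).
have sub' (t u : M) : t ^^ u <=p z' -> subw u z'.
  by move=> h; apply: (subw_trans hM _ (pre_subw hM h));
    have := subw_cat hM t u eps; rewrite (cat_eps hM).
have sj : subw j i by exact: pre_subw.
have pw0 : w0 <=p w1 by rewrite ew1; exact: pre_cat.
have s1 : bstep n1 n3 j B B'.
  apply: (hS j sj hy w0) => //.
  - by apply: (pre_subw hM); exact: (pre_trans hM pw0).
  - by apply: (sub w0); rewrite -ew1.
  - by apply: (sub w1); rewrite -ew.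
  - by rewrite -ew1 -ew.
have s2 : bstep n1 n3 j B B''.
  apply: (hS' j sj hy w0) => //.
  - by apply: (pre_subw hM); exact: (pre_trans hM pw0).
  - by apply: (sub' w0); rewrite -ew1.
  - by apply: (sub' w1); rewrite -ev.
  - by rewrite -ew1 -ev.
by rewrite ew (bstep_uniq s1 s2) -ev.
Qed.

Lemma outI z y w U P1 P2 P3 : z = w ^^ (U ^^ P1 ^^ P2 ^^ P3) -> len U = lq M ->
  len P1 = bt ^^ n1 ^^ bt -> len P2 = bt ^^ n1 ^^ bt -> len P3 = lm M ^^ n3 ^^ lm M ->
  y <=p P2 -> len y <=p P1 -> ~ len y ^^ bt <=p P1 -> out n1 n3 z y.
Proof.
move=> ez lU l1 l2 l3 hy hy1 hy2.
exists w; split; first by rewrite ez; apply: (pre_subw hM); exact: pre_cat.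
exists U; split.
  by have := subw_cat hM w U (P1 ^^ P2 ^^ P3); rewrite ez !(wcatA hM).
exists P1; split.
  by have := subw_cat hM (w ^^ U) P1 (P2 ^^ P3); rewrite ez !(wcatA hM).
exists P2; split.
  by have := subw_cat hM (w ^^ U ^^ P1) P2 P3; rewrite ez !(wcatA hM).
exists P3; split=> //.
by have := subw_cat hM (w ^^ U ^^ P1 ^^ P2) P3 eps; rewrite ez !(wcatA hM) (cat_eps hM).
Qed.

Lemma out_ex x z : len z = L ** (x ^^ bt) -> exists y, out n1 n3 z y.
Proof.
move=> lz; have : len z = L ** x ^^ L by rewrite lz (times_snoc hM).
move=> /split_tally[]; rewrite ?(len_times hM) ?len_ell // => w [B [ez _]].
move=> /block_split[U [P1 [P2 [P3 [eB lU l1 l2 l3]]]]].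
have [v [hv hv1 hv2]] := ones_prefix hM P1.
have [|y hy ly] := prefix_of_len hM (x := P2) (u := v).
  by rewrite l2 -l1 -hv; exact: (pre_len hM).
by exists y; apply: (outI (w := w) _ lU l1 l2 l3 hy); rewrite ?ly // -eB.
Qed.

Lemma out_uniq z y y' : out n1 n3 z y -> out n1 n3 z y' -> y = y'.
Proof.
move=> [w [_ [U [_ [P1 [_ [P2 [_ [P3 [_ [ez [lU [l1 [l2 [l3 [hy [hy1 hy2]]]]]]]]]]]]]]]]].
move=> [w' [_ [U' [_ [P1' [_ [P2' [_ [P3' [_ [ez' [lU' [l1' [l2' [l3' [hy' [hy1' hy2']]]]]]]]]]]]]]]]].
have eB : len (U ^^ P1 ^^ P2 ^^ P3) = len (U' ^^ P1' ^^ P2' ^^ P3').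
  by rewrite !(len_cat hM) lU l1 l2 l3 lU' l1' l2' l3'.
have ew : len w = len w'.
  apply: (cat_injr hM (z := len (U ^^ P1 ^^ P2 ^^ P3))).
  by rewrite {2}eB -!(len_cat hM w) -ez -(len_cat hM w') -ez'.
have [_ e] := split_uniq hM (etrans (esym ez) ez') ew.
have [| | |eU e1 e2 e3] := block_uniq e; rewrite ?lU ?l1 ?l2 ?lU' ?l1' ?l2' //.
subst P1' P2'; apply: (pre_eq_len hM hy hy').
have aux (u v : M) : len u <=p P1 -> len v <=p P1 -> ~ len u ^^ bt <=p P1 ->
    len u <=p len v -> len u = len v.
  move=> hu hv nu /(pre_ex hM)[t et]; case: (word_case hM t) => [te|[t' [b te]]].
    by rewrite et te (cat_eps hM).
  case: nu; apply: (pre_trans hM _ hv).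
  have lt : len t = t.
    by apply: (cat_injl hM (z := len u)); rewrite -{1}[len u](len_len hM) -(len_cat hM)
      -et (len_len hM).
  rewrite et -lt te (len_snoc hM) -(bt_len hM t') (wcatA hM); exact: pre_cat.
by case: (pre_total hM hy1 hy1') => h; [|apply: esym]; apply: aux h.
Qed.

End InModel.
End BlockMachine.

(** * Representing a probabilistic Turing machine *)

Section OneHot.
Variable T : finType.

Definition onehot (x : T) : #|T|.-tuple bool := map_tuple (fun y => y == x) (enum_tuple T).
Definition unhot (t : #|T|.-tuple bool) : option T := [pick x | onehot x == t].

Lemma onehot_inj : injective onehot.
Proof.
move=> x y /(congr1 val) /= /eq_in_map /(_ x); rewrite mem_enum eqxx => /(_ isT)/esym/eqP.
by [].
Qed.

Lemma onehotK x : unhot (onehot x) = Some x.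
Proof.
rewrite /unhot; case: pickP => [y /eqP/onehot_inj -> //|/(_ x)]; by rewrite eqxx.
Qed.

Lemma unhot0 : unhot (nseq_tuple #|T| false) = None.
Proof.
rewrite /unhot; case: pickP => // x /eqP/(congr1 val) /= e.
have : nth false (nseq #|T| false) (index x (enum T)) = true.
  by rewrite -e (nth_map x) ?index_mem ?mem_enum // nth_index ?mem_enum // eqxx.
by rewrite nth_nseq; case: ifP.
Qed.

End OneHot.

Section Representation.
Variables (M0 : ptm).
Notation Q := (state M0).
Notation W := (work M0).
Notation mq := #|Q|.
Notation m := #|W|.
Notation sym := (symbol W).

Definition zero : m.-tuple bool := nseq_tuple m false.

(** Blank is all zeros, so that the blank part of the initial tape is a power of the bit 0. Only
    bits have a 1 on the first plane, which is the plane that measures the output. *)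
Definition enc (a : sym) : cell m :=
  match a with
  | Blank => ([tuple false], [tuple false], zero)
  | Bit b => ([tuple true], [tuple b], zero)
  | Sharp => ([tuple false], [tuple true], zero)
  | Work w => ([tuple false], [tuple false], onehot w)
  end.

Definition dec (c : cell m) : sym :=
  if thead c.1.1 then Bit (thead c.1.2)
  else if unhot c.2 is Some w then Work w
  else if thead c.1.2 then Sharp else Blank.

Lemma encK a : dec (enc a) = a.
Proof. by case: a => [|[]| |w]; rewrite /dec /= ?unhot0 ?onehotK. Qed.

Definition btr (c : bool) (u : mq.-tuple bool) (a : cell m) :
    mq.-tuple bool * cell m * move :=
  let q := odflt (start M0) (unhot u) in
  if final q then (u, a, MoveN) else
  let: (q', a', mv) := delta c q (dec a) in (onehot q', enc a', mv).

(** * The two-way tape as a ring of [K] cells *)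

Section Tape.
Variable K : nat.

Definition syms (l r : seq sym) : seq sym :=
  r ++ nseq (K - (size r + size l)) Blank ++ rev l.

Definition mid (l r : seq sym) : seq sym :=
  behead r ++ nseq (K - 2 - (size (behead r) + size (behead l))) Blank ++ rev (behead l).

Definition rotc (T : Type) (mv : move) (a : T) (Y : seq T) (b : T) : seq T :=
  match mv with
  | MoveN => a :: rcons Y b
  | MoveR => rcons (rcons Y b) a
  | MoveL => b :: a :: Y
  end.

Lemma nseq_rcons (T : Type) n (x : T) : nseq n.+1 x = rcons (nseq n x) x.
Proof. by elim: n => //= n ->. Qed.

Lemma syms_split l r : (size r + size l + 2 <= K)%N ->
  syms l r = rotc MoveN (head Blank r) (mid l r) (head Blank l).
Proof.
rewrite /syms /mid; case: r => [|a r]; case: l => [|b l] /= h.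
- have -> : (K - 0 = (K - 2 - 0).+2)%N by lia.
  by rewrite !cats0 nseq_rcons.
- have -> : (K - (0 + (size l).+1) = (K - 2 - (0 + size l)).+1)%N by lia.
  by rewrite rev_cons rcons_cat.
- have -> : (K - ((size r).+1 + 0) = (K - 2 - (size r + 0)).+1)%N by lia.
  by rewrite !cats0 nseq_rcons rcons_cat.
- have -> : (K - ((size r).+1 + (size l).+1) = K - 2 - (size r + size l))%N by lia.
  by rewrite rev_cons !rcons_cat.
Qed.

(** A move leaves [mid] alone and affects only the first and the last cell of the ring. The written
    part can grow by two cells at once: a left move from two empty lists creates a blank and the
    written cell. *)
Lemma syms_step l r a mv : (size r + size l + 2 <= K)%N ->
  let: (l', r') := match mv with
    | MoveL => (behead l, head Blank l :: a :: behead r)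
    | MoveN => (l, a :: behead r)
    | MoveR => (a :: l, behead r)
    end in
  syms l' r' = rotc mv a (mid l r) (head Blank l) /\
  (size r' + size l' <= (size r + size l).+2)%N.
Proof.
move=> h; rewrite /syms /mid; case: mv => /=.
- split; last by rewrite !size_behead; lia.
  do 2 congr cons; congr (_ ++ (nseq _ _ ++ _)); rewrite !size_behead; lia.
- split; last by rewrite !size_behead; lia.
  congr cons; rewrite rcons_cat; congr cat; case: l h => [|b l] /= h.
    by rewrite !cats0 -nseq_rcons; congr nseq; rewrite !size_behead; lia.
  by rewrite rev_cons -rcons_cat; congr (rcons (cat (nseq _ _) _) _); rewrite !size_behead; lia.
- split; last by rewrite !size_behead; lia.
  rewrite !rcons_cat rev_cons; congr cat; case: l h => [|b l] /= h.
    rewrite (_ : (K - (size (behead r) + 1) = (K - 2 - (size (behead r) + 0)).+1)%N).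
      by rewrite nseq_rcons cat_rcons.
    rewrite !size_behead; lia.
  rewrite rev_cons; congr (cat (nseq _ _) _); rewrite !size_behead; lia.
Qed.

End Tape.

Definition plane (f : cell m -> word) (s : seq sym) : word := flatten (map (f \o enc) s).
Definition f1 (c : cell m) : word := c.1.1.
Definition f2 (c : cell m) : word := c.1.2.
Definition f3 (c : cell m) : word := c.2.

Definition block (q : Q) (s : seq sym) : word :=
  onehot q ++ plane f1 s ++ plane f2 s ++ plane f3 s.

Lemma size_plane f k s : (forall c, size (f c) = k) -> size (plane f s) = (size s * k)%N.
Proof.
by move=> h; elim: s => //= a s IH; rewrite /plane /= size_cat h -/(plane f s) IH mulSn.
Qed.

Lemma size_plane1 s : size (plane f1 s) = size s.
Proof. by rewrite (@size_plane _ 1) ?muln1 // => c; rewrite size_tuple. Qed.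

Lemma size_plane2 s : size (plane f2 s) = size s.
Proof. by rewrite (@size_plane _ 1) ?muln1 // => c; rewrite size_tuple. Qed.

Lemma size_plane3 s : size (plane f3 s) = (size s * m)%N.
Proof. by rewrite (@size_plane _ m) // => c; rewrite size_tuple. Qed.

Lemma plane_cat f s s' : plane f (s ++ s') = plane f s ++ plane f s'.
Proof. by rewrite /plane map_cat flatten_cat. Qed.

Lemma plane_rot w f mv a Y b :
  plane f (rotc mv a Y b) = rot (M := std w) mv (f (enc a)) (plane f Y) (f (enc b)).
Proof.
have pr s x : plane f (rcons s x) = plane f s ++ f (enc x).
  by rewrite -cats1 plane_cat /plane /= cats0.
case: mv => /=; rewrite ?pr //.
  by rewrite -catA.
by rewrite -[LHS]/(f (enc a) ++ plane f (rcons Y b)) pr catA.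
Qed.

Lemma block_rot w q mv a Y b : block q (rotc mv a Y b) =
  blk (M := std w) (onehot q) mv (enc a) (enc b) (plane f1 Y) (plane f2 Y) (plane f3 Y).
Proof. by rewrite /block !(plane_rot w) /blk !std_num /= !catA. Qed.

Definition cblock (K : nat) (x : config M0) : word := block x.1.1 (syms K x.1.2 x.2).

Definition csize (x : config M0) : nat := (size x.2 + size x.1.2)%N.

Lemma cblock_step (w : word -> bool) K c x : (csize x + 2 <= K)%N ->
  exists (d : datum mq m) (Y : seq sym),
  [/\ size Y = (K - 2)%N,
      cblock K x = blk (M := std w) d.1.1 MoveN d.1.2 d.2 (plane f1 Y) (plane f2 Y) (plane f3 Y),
      cblock K (step c x) = nxt btr (M := std w) c d (plane f1 Y) (plane f2 Y) (plane f3 Y) &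
      (csize (step c x) <= (csize x).+2)%N].
Proof.
case: x => [[q l] r]; rewrite /csize /= => h.
exists (onehot q, enc (head Blank r), enc (head Blank l)), (mid K l r); split.
- rewrite /mid !size_cat size_nseq size_rev !size_behead; lia.
- by rewrite /cblock /= syms_split // (block_rot w).
- rewrite /nxt /btr /= onehotK /= encK; case: ifP => fq /=.
    by rewrite /cblock /= syms_split // (block_rot w).
  case: (delta c q (head Blank r)) => [[q' a'] mv] /=.
  have := syms_step a' mv h; case: mv => -[e _];
    by rewrite /cblock [LHS]/= e; exact: (block_rot w).
- case: ifP => fq /=; first by lia.
  case: (delta c q (head Blank r)) => [[q' a'] mv] /=.
  by have := syms_step a' mv h; case: mv => -[_].
Qed.

(** [Dt] is the plane of values of the encoded input, with 1 at a separator; [Kt] is the plane that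
    marks the bits, with 0 at a separator. *)
Fixpoint Dt (M : structure) (xs : seq M) : M :=
  match xs with
  | [::] => eps
  | [:: x] => x
  | x :: xs' => x ^^ bt ^^ Dt xs'
  end.

Fixpoint Kt (M : structure) (xs : seq M) : M :=
  match xs with
  | [::] => eps
  | [:: x] => len x
  | x :: xs' => len x ^^ s_bit false ^^ Kt xs'
  end.

(** Horner's scheme in unary: [s] is the coefficient list of the polynomial that bounds the running
    time. *)
Fixpoint Tt (M : structure) (s : seq nat) (x : M) : M :=
  if s is a :: s' then Tt s' x ** x ^^ num M (nseq a true) else eps.

Definition n3t (M : structure) (n1 : M) : M := lm m M ** n1.

Definition B0t (M : structure) (xs : seq M) (T : M) : M :=
  num M (onehot (start M0)) ^^ (Kt xs ^^ s_bit false ** (T ^^ bt ^^ bt)) ^^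
  (Dt xs ^^ s_bit false ** (T ^^ bt ^^ bt)) ^^
  num M zero ** (len (Dt xs) ^^ T ^^ bt ^^ bt).

Section TermsInModel.
Variable M : structure.
Hypothesis hM : model NIA M.

Lemma len_Kt (xs : seq M) : len (Kt xs) = len (Dt xs).
Proof.
elim: xs => // x xs IH; case: xs IH => [|y xs] IH; first exact: (len_len hM).
rewrite [Kt _]/= [Dt _]/= -/(Kt (y :: xs)) -/(Dt (y :: xs)).
by rewrite !(len_cat hM) IH (len_len hM) !(len_bit hM).
Qed.

Lemma len_Tt s (x : M) : len x = x -> len (Tt s x) = Tt s x.
Proof.
move=> hx; elim: s => [|a s IH] /=; first exact: (len_eps hM).
by rewrite (len_cat hM) (len_times hM) IH (len_nseq hM).
Qed.

Lemma len_B0t (xs : seq M) (T : M) : len T = T ->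
  let n1 := len (Dt xs) ^^ T in len (B0t xs T) = ell mq m n1 (n3t n1).
Proof.
move=> hT n1.
have hn1 : len n1 = n1 by rewrite (len_cat hM) (len_len hM) hT.
have e : bt ^^ n1 ^^ bt = n1 ^^ bt ^^ bt by rewrite -hn1 (bt_len hM).
have hp b : len (s_bit b ** (T ^^ bt ^^ bt)) = T ^^ bt ^^ bt.
  rewrite (len_times hM) (len_bit hM) !(len_snoc hM) hT //.
rewrite /B0t !(len_cat hM) len_Kt !hp (len_tuple hM) (len_times hM) (len_nseq hM).
rewrite /ell e /n3t -/(lq mq M) -/(lm m M); congr (_ ^^ _ ^^ _ ^^ _).
- by rewrite !(wcatA hM).
- by rewrite !(wcatA hM).
- rewrite -[len (Dt xs) ^^ T]/n1 -e !(times_cat hM) !(times_bit hM) //.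
Qed.

End TermsInModel.

Lemma td_Dt n (js : seq nat) : all (fun j => j < n)%N js ->
  TD n (fun M r => Dt [seq r j | j <- js]).
Proof.
elim: js => [|j js IH] /= ; first by move=> _; exact: td_eps.
case: js IH => [|j' js] IH /andP[h /IH {}IH]; first exact: td_var.
by apply: td_cat IH; apply: td_cat; [exact: td_var|exact: td_bit].
Qed.

Lemma td_Kt n (js : seq nat) : all (fun j => j < n)%N js ->
  TD n (fun M r => Kt [seq r j | j <- js]).
Proof.
elim: js => [|j js IH] /= ; first by move=> _; exact: td_eps.
case: js IH => [|j' js] IH /andP[h /IH {}IH].
  by apply: td_times; [exact: td_bit|exact: td_var].
apply: td_cat IH; apply: td_cat; last exact: td_bit.
by apply: td_times; [exact: td_bit|exact: td_var].
Qed.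

Lemma td_Tt n s f : TD n f -> TD n (fun M r => Tt s (f M r)).
Proof.
move=> h; elim: s => [|a s IH] /=; first exact: td_eps.
by apply: td_cat; [exact: td_times|exact: td_num].
Qed.

Section Formula.
Variables (s : seq nat) (k : nat).

Definition args (M : structure) (r : nat -> M) : seq M := [seq r j | j <- iota 1 k].
Definition gT (M : structure) (r : nat -> M) : M := Tt s (len (Dt (args r))).
(** The written part starts with the input and grows by at most two cells in each of the [gT] steps.
    With the first and the last cell added, the ring always keeps the two spare cells that
    [cblock_step] asks for. *)
Definition gn1 (M : structure) (r : nat -> M) : M := len (Dt (args r)) ^^ (gT r ^^ gT r).
Definition gsem (M : structure) (r : nat -> M) : Prop :=
  exists z, len z <=p len (ell mq m (gn1 r) (n3t (gn1 r)) ** (gT r ^^ bt)) /\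
   (valid btr (gn1 r) (n3t (gn1 r)) (B0t (args r) (gT r ^^ gT r)) (gT r) z /\
    out mq m (gn1 r) (n3t (gn1 r)) z (r 0)).

Lemma s1_gsem : S1 k.+1 (fun M r => gsem r).
Proof.
have hj : all (fun j => j < k.+1)%N (iota 1 k) by apply/allP => j; rewrite mem_iota; lia.
have hD : TD k.+1 (fun M r => Dt (args r)) := td_Dt hj.
have hK : TD k.+1 (fun M r => Kt (args r)) := td_Kt hj.
have hT : TD k.+1 (@gT).
  by apply: td_Tt; apply: td_times => //; exact: td_bit.
have hn1 : TD k.+1 (@gn1).
  by apply: td_cat; [apply: td_times => //; exact: td_bit|exact: td_cat].
have hn3 : TD k.+1 (fun M r => n3t (gn1 r)) by apply: td_times => //; exact: td_num.
have hp : TD k.+1 (fun M r => gT r ^^ gT r ^^ bt ^^ bt).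
  by do 3 (apply: td_cat => //; try exact: td_bit).
have hB : TD k.+1 (fun M r => B0t (args r) (gT r ^^ gT r)).
  have hz b : TD k.+1 (fun M r => s_bit b ** (gT r ^^ gT r ^^ bt ^^ bt)).
    by apply: td_times => //; exact: td_bit.
  apply: td_cat; [apply: td_cat; [apply: td_cat; [exact: td_num|exact: td_cat]|exact: td_cat]|].
  apply: td_times; first exact: td_num.
  do 2 (apply: td_cat; last exact: td_bit); apply: td_cat; last exact: td_cat.
  by apply: td_times => //; exact: td_bit.
apply: s1_ex.
  apply: td_times; first exact: td_ell.
  by apply: td_cat => //; exact: td_bit.
have h0 : TD k.+2 (fun M r => r 0) by exact: td_var.
have h1 : TD k.+2 (fun M r => etl r 0) by exact: td_var.
apply: s1_base; apply: sw_and.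
  apply: sw_valid => //; [exact: (td_weak 1 hn1)|exact: (td_weak 1 hn3)
    |exact: (td_weak 1 hB)|exact: (td_weak 1 hT)].
by apply: sw_out => //; [exact: (td_weak 1 hn1)|exact: (td_weak 1 hn3)].
Qed.

Section Unique.
Variable M : structure.
Hypothesis hM : model NIA M.

Lemma len_gT (r : nat -> M) : len (gT r) = gT r.
Proof. by apply: (len_Tt hM); exact: (len_len hM). Qed.

Lemma len_gn1 (r : nat -> M) : len (gn1 r) = gn1 r.
Proof. by rewrite !(len_cat hM) (len_len hM) len_gT. Qed.

Lemma len_gn3 (r : nat -> M) : len (n3t (gn1 r)) = n3t (gn1 r).
Proof. by rewrite /n3t (len_times hM) (len_nseq hM). Qed.

Lemma len_gB (r : nat -> M) :
  len (B0t (args r) (gT r ^^ gT r)) = ell mq m (gn1 r) (n3t (gn1 r)).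
Proof. by apply: (len_B0t hM); rewrite (len_cat hM) len_gT. Qed.

Lemma gsem_ex (r : nat -> M) : exists y, gsem (econs y r).
Proof.
have [z hz] := valid_ex btr hM (len_gn1 (econs eps r)) (len_gn3 (econs eps r))
  (len_gB (econs eps r)) (gT (econs eps r)).
rewrite len_gT in hz.
have [y hy] := out_ex hM (len_gn1 _) (len_gn3 _) hz.1.
have aE x : args (econs x r) = args (econs eps r).
  by apply/eq_in_map => -[|j] //; rewrite mem_iota.
exists y; exists z; rewrite /gn1 /gT aE; split; last by split.
rewrite hz.1 (len_times hM) (len_ell mq m hM (len_gn1 _) (len_gn3 _)).
exact: pre_refl.
Qed.

Lemma gsem_uniq (r : nat -> M) y y' : gsem (econs y r) -> gsem (econs y' r) -> y = y'.
Proof.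
have aE x : args (econs x r) = args (econs eps r).
  by apply/eq_in_map => -[|j] //; rewrite mem_iota.
rewrite /gsem /gn1 /gT !aE => -[z [_ [hz hy]]] [z' [_ [hz' hy']]].
have e : z = z'.
  apply: (valid_uniq hM (len_gn1 _) (len_gn3 _) (len_gB (econs eps r))
    (x := gT (econs eps r)) (tr := @btr)); rewrite len_gT; [exact: hz|exact: hz'].
by rewrite e in hy; exact: (out_uniq hM hy hy').
Qed.

End Unique.

(** * The formula in the standard model *)

Section Standard.
Variables (w : word -> bool) (xs : k.-tuple word).
Notation MM := (std w).
Let hM : model NIA MM := std_model w.
Notation n := (size (encode W xs)).
Notation T := (horner_rec s n).
Notation K := (n + (T + T) + 2)%N.
Notation c := (fun i => w (nseq i true)).
Notation conf i := (run c i (init M0 xs)).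
Notation L := (mq + K + K + K * m)%N.

Definition senv (y : word) (i : nat) : MM := if i is j.+1 then nth [::] xs j else y.

Lemma flatten_nseq1 (b : bool) j : flatten (nseq j [:: b]) = nseq j b.
Proof. by elim: j => //= j ->. Qed.

Lemma flatten_nseq (T' : Type) (b : T') i j : flatten (nseq j (nseq i b)) = nseq (j * i) b.
Proof. by elim: j => //= j ->; rewrite mulSn nseqD. Qed.

Lemma std_len (x : MM) : len x = nseq (size (x : word)) true.
Proof. exact: flatten_nseq1. Qed.

Lemma args_senv y : args (senv y) = xs :> seq word.
Proof.
rewrite /args (iotaDl 1 0) -map_comp; apply: (@eq_from_nth _ [::]).
  by rewrite size_map size_iota size_tuple.
move=> i; rewrite size_map size_iota => ik.
by rewrite (nth_map 0) ?size_iota // nth_iota.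
Qed.

Lemma encode_cons2 x y zs : encode W [:: x, y & zs] = map Bit x ++ Sharp :: encode W (y :: zs).
Proof. by []. Qed.

Lemma plane2_encode zs : plane f2 (encode W zs) = Dt (M := MM) zs.
Proof.
have e x : plane f2 (map Bit x) = x.
  by elim: x => //= b x IH; rewrite -[LHS]/(b :: plane f2 (map Bit x)) IH.
elim: zs => // x [|y zs] IH; first exact: e.
by rewrite encode_cons2 plane_cat e -[LHS]/(x ++ true :: plane f2 (encode W (y :: zs))) IH
  -cat1s catA.
Qed.

Lemma plane1_encode zs : plane f1 (encode W zs) = Kt (M := MM) zs.
Proof.
have e x : plane f1 (map Bit x) = len (x : MM).
  rewrite std_len.
  by elim: x => //= b x IH; rewrite -[LHS]/(true :: plane f1 (map Bit x)) IH.
elim: zs => // x [|y zs] IH; first exact: e.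
by rewrite encode_cons2 plane_cat e
  -[LHS]/(len (x : MM) ++ false :: plane f1 (encode W (y :: zs))) IH -cat1s catA.
Qed.

Lemma plane3_encode zs : plane f3 (encode W zs) = nseq (size (encode W zs) * m) false.
Proof.
have e x : plane f3 (map Bit x) = nseq (size x * m) false.
  elim: x => //= b x IH; rewrite mulSn nseqD -IH //.
elim: zs => // x [|y zs] IH; first by rewrite e size_map.
rewrite encode_cons2 plane_cat e size_cat size_map /= mulnDl mulSn !nseqD -IH //.
Qed.

Lemma plane_blank j : [/\ plane f1 (nseq j Blank) = nseq j false,
  plane f2 (nseq j Blank) = nseq j false & plane f3 (nseq j Blank) = nseq (j * m) false].
Proof.
elim: j => // j [IH1 IH2 IH3]; split.
- by rewrite -[LHS]/(false :: plane f1 (nseq j Blank)) IH1.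
- by rewrite -[LHS]/(false :: plane f2 (nseq j Blank)) IH2.
- by rewrite mulSn nseqD -IH3.
Qed.

Lemma size_Dt : size (Dt (M := MM) xs : word) = n.
Proof. by rewrite -plane2_encode size_plane2. Qed.

Lemma size_Tt (x : MM) : size (Tt s x : word) = horner_rec s (size (x : word)).
Proof.
elim: (s) => //= a s' IH; rewrite size_cat std_num size_nseq -IH; congr addn.
by rewrite size_flatten /shape map_nseq sumn_nseq.
Qed.

Lemma gT_std y : gT (senv y) = nseq T true :> word.
Proof.
rewrite -(len_gT hM) std_len; congr nseq.
by rewrite /gT size_Tt args_senv std_len size_nseq size_Dt.
Qed.

Lemma gn1_std y : gn1 (senv y) = nseq (n + (T + T)) true :> word.
Proof.
by rewrite /gn1 gT_std args_senv std_len size_Dt /= -!nseqD.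
Qed.

Lemma n3t_std j : n3t (M := MM) (nseq j true) = nseq (j * m) true.
Proof. by rewrite /n3t /lm std_num /= size_nseq flatten_nseq. Qed.

Lemma ell_std : ell (M := MM) mq m (nseq (n + (T + T)) true) (n3t (M := MM) (nseq (n + (T + T)) true))
  = nseq L true.
Proof.
rewrite n3t_std /ell /lq /lm !std_num /= -!nseqD -[_ :: _]/(nseq 1 true ++ _).
rewrite -[[:: true]]/(nseq 1 true) -!nseqD; congr nseq; lia.
Qed.

Lemma csize_step K' c' x : (csize x + 2 <= K')%N -> (csize (step c' x) <= (csize x).+2)%N.
Proof. by move=> h; have [d [Y []]] := cblock_step w c' h. Qed.

Lemma csize_run i : (csize (conf i) <= n + (i + i))%N.
Proof.
elim: i => [|i IH]; first by rewrite /csize /= !addn0.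
have h := @csize_step _ (w (nseq i true)) (conf i) (leqnn _).
by apply: leq_trans h _; lia.
Qed.

Lemma size_syms l r : (size r + size l <= K)%N -> size (syms K l r) = K.
Proof. rewrite /syms !size_cat size_nseq size_rev; lia. Qed.

Lemma size_cblock i : (i <= T)%N -> size (cblock K (conf i)) = L.
Proof.
move=> iT; rewrite /cblock /block; have := csize_run i; rewrite /csize.
case: (conf i) => [[q l] r] /= h; have hs : size (syms K l r) = K by apply: size_syms; lia.
by rewrite !size_cat size_plane1 size_plane2 size_plane3 hs size_map -cardE !addnA.
Qed.

Definition hist i0 j : word := flatten [seq cblock K (conf i) | i <- iota i0 j].

Lemma size_hist i0 j : (i0 + j <= T.+1)%N -> size (hist i0 j) = (j * L)%N.
Proof.
elim: j i0 => // j IH i0 h; rewrite /hist /= size_cat -/(hist i0.+1 j) IH; last by lia.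
by rewrite size_cblock ?mulSn //; lia.
Qed.

Lemma hist_cat i0 j j' : hist i0 (j + j') = hist i0 j ++ hist (i0 + j) j'.
Proof. by rewrite /hist iotaD map_cat flatten_cat. Qed.

Lemma B0_std y : B0t (args (senv y)) (gT (senv y) ^^ gT (senv y)) = cblock K (conf 0) :> word.
Proof.
rewrite /B0t args_senv gT_std.
have e1 : (s_bit false : MM) ** ((nseq T true : MM) ^^ nseq T true ^^ bt ^^ bt) =
    nseq (T + T + 2) false :> word.
  rewrite /= flatten_nseq1; congr nseq; rewrite !size_cat !size_nseq /=; lia.
have e3 : num MM zero ** (len (Dt (M := MM) xs) ^^ ((nseq T true : MM) ^^ nseq T true) ^^ bt ^^ bt) =
    nseq ((n + (T + T + 2)) * m) false :> word.
  rewrite std_num std_len size_Dt /= flatten_nseq; congr (nseq (_ * _) _).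
  rewrite !size_cat !size_nseq /=; lia.
rewrite e1 e3 std_num /cblock /block /= /syms /= cats0 !plane_cat addn0.
have -> : (K - n = T + T + 2)%N by lia.
have [-> -> ->] := plane_blank (T + T + 2).
rewrite plane1_encode plane2_encode plane3_encode -nseqD -mulnDl.
by rewrite !catA.
Qed.

Lemma prefix_nseq (x : word) j : prefix x (nseq j true) -> x = nseq (size x) true /\ (size x <= j)%N.
Proof.
move=> /prefixP[t e]; split; last by rewrite -(size_nseq j true) e size_cat leq_addr.
have /all_pred1P : all (pred1 true) x.
  by have := all_pred1_nseq true j; rewrite e all_cat => /andP[].
by [].
Qed.

Lemma cat_inj (x y x' y' : word) : size x = size x' -> x ++ y = x' ++ y' -> x = x' /\ y = y'.
Proof. by move=> h /eqP; rewrite eqseq_cat // => /andP[/eqP -> /eqP ->]. Qed.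

Lemma valid_std : valid btr (M := MM) (nseq (n + (T + T)) true)
  (n3t (M := MM) (nseq (n + (T + T)) true)) (cblock K (conf 0)) (nseq T true) (hist 0 T.+1).
Proof.
rewrite /valid ell_std; split; [|split].
- rewrite std_len size_hist //= size_cat size_nseq addn1 flatten_nseq //.
- by apply/prefixP; exists (hist 1 T).
move=> j _ hj u _ B _ B' _ /prefixP[t ht] lu lB lB'.
have {}hj : prefix (j ++ [:: true]) (nseq T true) by exact: hj.
have [ej _] : j = nseq (size (j : word)) true /\ (size (j : word) <= T)%N.
  by apply: prefix_nseq; apply: prefix_trans hj; apply/prefixP; exists [:: true].
have [_ jT] := prefix_nseq hj; rewrite size_cat addn1 in jT.
set i := size (j : word) in ej jT.
have {}lu : size (u : word) = (i * L)%N.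
  have := congr1 (size : word -> nat) lu; rewrite std_len size_nseq => ->.
  by rewrite /= flatten_nseq size_nseq.
have {}lB : size (B : word) = L.
  by have := congr1 (size : word -> nat) lB; rewrite std_len !size_nseq.
have {}lB' : size (B' : word) = L.
  by have := congr1 (size : word -> nat) lB'; rewrite std_len !size_nseq.
have eT : T.+1 = (i + (1 + (1 + (T - i.+1))))%N by lia.
have hist1 i' : hist i' 1 = cblock K (conf i') by exact: cats0.
have ht' : (((u : word) ++ B) ++ B') ++ t = u ++ (B ++ (B' ++ t)) by rewrite -!catA.
move: ht; rewrite eT !hist_cat !hist1 add0n => ht; have {ht'}ht := etrans ht ht'.
have [|_ {}ht] := cat_inj _ ht; first by rewrite size_hist ?lu //; lia.
have [|eB {}ht] := cat_inj _ ht; first by rewrite size_cblock ?lB //; lia.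
have [|eB' _] := cat_inj _ ht; first by rewrite size_cblock ?lB' //; lia.
have [|d [Y [sY e1 e2 _]]] := cblock_step w (w (nseq i true)) (K := K) (x := conf i).
  by apply: leq_trans (leq_add (csize_run i) (leqnn 2)) _; lia.
have {}sY : size Y = (n + (T + T))%N by rewrite sY; lia.
apply: (bstepI hM (c := w (nseq i true)) (d := d) (Y1 := plane f1 Y) (Y2 := plane f2 Y)
  (Y3 := plane f3 Y)).
- by rewrite std_len size_plane1 sY.
- by rewrite std_len size_plane2 sY.
- by rewrite n3t_std std_len size_plane3 sY.
- by rewrite -eB.
- by rewrite ej.
- by rewrite -eB' addn1.
Qed.

Lemma leading_bits_split (r : seq sym) : exists2 r', r = map Bit (leading_bits r) ++ r' &
  if r' is Bit b :: _ then False else True.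
Proof.
elim: r => [|[|b| |a] r [r' e h]] /=.
- by exists [::].
- by exists (Blank :: r).
- by exists r' => //; congr cons.
- by exists (Sharp :: r).
- by exists (Work a :: r).
Qed.

Lemma out_std : out (M := MM) mq m (nseq (n + (T + T)) true)
  (n3t (M := MM) (nseq (n + (T + T)) true)) (hist 0 T.+1) (output (conf T)).
Proof.
rewrite -addn1 hist_cat add0n; have := csize_run T; rewrite /csize /output.
have -> : hist T 1 = cblock K (conf T) by exact: cats0.
rewrite /cblock; case: (conf T) => [[q l] r] /= hs.
have ss : size (syms K l r) = K by apply: size_syms; lia.
have [r' er hr'] := leading_bits_split r; set y := leading_bits r in er *.
(* What follows the output on the ring is never empty and never starts with a bit: at least two
   blanks separate [r] from [l]. *)
have [t et ht] : exists2 t, syms K l r = map Bit y ++ t &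
    exists a t', t = a :: t' /\ plane f1 [:: a] = [:: false].
  exists (r' ++ nseq (K - (size r + size l)) Blank ++ rev l).
    by rewrite /syms {1}er -!catA.
  case: r' hr' {er} => [_|[|b| |a] r' hr'] /=; try by eexists; eexists; split.
  have -> : (K - (size r + size l) = (K - (size r + size l)).-1.+1)%N by lia.
  by eexists; eexists; split.
have e1 : plane f1 (map Bit y) = nseq (size y) true.
  by elim: (y) => //= b y' IH; rewrite -[LHS]/(true :: plane f1 (map Bit y')) IH.
have e2 : plane f2 (map Bit y) = y.
  by elim: (y) => //= b y' IH; rewrite -[LHS]/(b :: plane f2 (map Bit y')) IH.
apply: (outI hM (w := hist 0 T) (U := onehot q) (P1 := plane f1 (syms K l r))
   (P2 := plane f2 (syms K l r)) (P3 := plane f3 (syms K l r))).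
- by rewrite /block /= !catA.
- by rewrite /lq std_num std_len size_tuple.
- rewrite std_len size_plane1 ss /= -[_ :: _]/(nseq 1 true ++ _) -[[:: true]]/(nseq 1 true).
  by rewrite -!nseqD; congr nseq; lia.
- rewrite std_len size_plane2 ss /= -[_ :: _]/(nseq 1 true ++ _) -[[:: true]]/(nseq 1 true).
  by rewrite -!nseqD; congr nseq; lia.
- rewrite /lm std_num std_len size_plane3 ss size_nseq flatten_nseq /= -!nseqD.
  by congr nseq; lia.
- by rewrite et plane_cat e2; apply/prefixP; exists (plane f2 t).
- by rewrite std_len et plane_cat e1; apply/prefixP; exists (plane f1 t).
rewrite std_len et plane_cat e1 => /prefixP[v]; rewrite -catA => /(cat_inj erefl)[_].
by case: ht => a [t' [-> ha]]; rewrite -cat1s plane_cat ha.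
Qed.

(** It is enough that the actual history satisfies the formula: uniqueness, known in every model,
    gives the other direction. *)
Lemma gsem_std y : gsem (senv y) <-> y = output (conf T).
Proof.
have h : gsem (senv (output (conf T))).
  exists (hist 0 T.+1); rewrite B0_std gT_std gn1_std; split; last first.
    by split; [exact: valid_std|exact: out_std].
  have [-> _] := valid_std; rewrite (len_times hM) ell_std std_len size_nseq.
  exact: (pre_refl hM).
split=> [hy|->//].
have e x : senv x = econs (x : MM) (fun i => nth [::] xs i) by apply/funext => -[].
by rewrite !e in h hy; exact: (gsem_uniq hM hy h).
Qed.

End Standard.

Lemma machine_formula : exists G, [/\ Sigma1b G, fscoped k.+1 G,
  proves NIA [::] (iter k FAll (ex_unique G)) &
  forall (w : word -> bool) (xs : k.-tuple word) (y : word),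
    holds w (fun=> [::]) (instance G xs y) <->
    output (run (fun i => w (nseq i true)) (horner_rec s (size (encode W xs)))
      (init M0 xs)) = y].
Proof.
have [G [h1 h2 h3]] := s1_gsem; exists G; split=> //.
  apply: completeness => M hM r; have : forall r : nat -> M, sat r (ex_unique G).
    move=> {}r; have [y hy] := gsem_ex hM r; exists y; split; first by rewrite h3.
    move=> y'; have [hy'|hy'] := pselect (gsem (econs y' r)); [right|left].
      by rewrite (gsem_uniq hM hy' hy); exact: s_refl.
    move=> hs; apply: hy'; rewrite -h3 //; move: hs; rewrite sat_subst.
    by apply: (sat_ext _ _).1; case.
  elim: k r => [|k' IH] r h /=; first exact: h.
  by move=> x; exact: IH.
move=> w xs y; rewrite holds_std /instance sat_subst.
rewrite (sat_ext _ (r' := senv w xs y)); last by case=> [|i]; exact: numeral_std.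
by rewrite h3; [rewrite gsem_std; split=> ->|exact: std_model].
Qed.

End Formula.

End Representation.

Local Close Scope nia_scope.

(** * Decision trees over independent fair coins *)

Inductive dtree (I T : Type) : Type :=
| DLeaf of T
| DNode of I & (bool -> dtree I T).
Arguments DLeaf {I T} _.
Arguments DNode {I T} _ _.

Fixpoint drun (I T : Type) (w : I -> bool) (t : dtree I T) : T :=
  match t with DLeaf x => x | DNode i k => drun w (k (w i)) end.

Fixpoint dfresh (I : eqType) (T : Type) (s : seq I) (t : dtree I T) : Prop :=
  if t is DNode i k then i \notin s /\ forall b, dfresh (i :: s) (k b) else True.

Section Weight.
Local Open Scope ring_scope.
Local Open Scope classical_set_scope.
Variable R : realType.

Fixpoint dweight (I : Type) (T : eqType) (y : T) (t : dtree I T) : R :=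
  match t with
  | DLeaf x => (x == y)%:R
  | DNode i k => 2^-1 * dweight y (k true) + 2^-1 * dweight y (k false)
  end.

(** Generalised to the event that the coins of [s] have been read with the values [b]: a node reads
    a coin outside [s] and splits this cylinder into two cylinders of half the measure. *)
Lemma fair_dtree_cond (I T : eqType) (P : probability (coin_space I) R) : fair P ->
  forall (t : dtree I T) (y : T) (s : seq I) (b : I -> bool), uniq s -> dfresh s t ->
  measurable ([set w | (forall i, i \in s -> w i = b i) /\ drun w t = y] : set (coin_space I)) /\
  P [set w | (forall i, i \in s -> w i = b i) /\ drun w t = y] =
    (2^-1 ^+ size s * dweight y t)%:E.
Proof.
move=> fP; elim=> [x|i k IH] y s b us /=.
  move=> _; case: eqP => [->|ne].
    rewrite mulr1 -(fP s b us) (_ : [set w | _ /\ _] = [set w | forall i, i \in s -> w i = b i]).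
      by split=> //; exact: measurable_coins.
    by apply/seteqP; split=> w /=; [case|].
  rewrite mulr0 (_ : [set w | _ /\ _] = set0); last by apply/seteqP; split=> w //= [].
  by split=> //; rewrite measure0.
move=> [nis hk]; pose bb c j := if j == i then c else b j.
have us' : uniq (i :: s) by rewrite /= nis us.
pose A c : set (coin_space I) :=
  [set w | (forall j, j \in i :: s -> w j = bb c j) /\ drun w (k c) = y].
have hA c : measurable (A c) /\ P (A c) = (2^-1 ^+ (size s).+1 * dweight y (k c))%:E.
  exact: (IH c y (i :: s) (bb c) us' (hk c)).
have -> : [set w : coin_space I | (forall i, i \in s -> w i = b i) /\ drun w (k (w i)) = y]
    = A true `|` A false.
  apply/seteqP; split=> w /=.
    move=> [h1 h2]; suff : A (w i) w by case: (w i); [left|right].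
    split=> // j; rewrite inE /bb; case: eqP => [->//|_] /=; exact: h1.
  have h c : A c w -> (forall i, i \in s -> w i = b i) /\ drun w (k (w i)) = y.
    move=> [h1 h2]; have wi : w i = c by rewrite h1 ?mem_head // /bb eqxx.
    rewrite wi; split=> // j js; rewrite h1 ?inE ?js ?orbT // /bb.
    by case: eqP => // e; move: nis; rewrite -e js.
  by case=> /h.
have [m1 e1] := hA true; have [m2 e2] := hA false; split; first exact: measurableU.
rewrite measureU //; last first.
  apply/seteqP; split=> w //= [[h1 _] [h2 _]].
  have := h1 i (mem_head _ _); have := h2 i (mem_head _ _).
  by rewrite /bb eqxx => ->.
transitivity (((2^-1 ^+ (size s).+1 * dweight y (k true))%:E +
   (2^-1 ^+ (size s).+1 * dweight y (k false))%:E) : \bar R)%E.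
  by rewrite -e1 -e2.
by rewrite -EFinD; congr EFin; rewrite exprSr mulrDr !mulrA.
Qed.

Lemma fair_dtree (I T : eqType) (P : probability (coin_space I) R) (t : dtree I T) (y : T) :
  fair P -> dfresh [::] t -> P [set w | drun w t = y] = (dweight y t)%:E.
Proof.
move=> fP ft.
have [_] := fair_dtree_cond fP y (fun=> true) (isT : uniq [::]) ft.
rewrite expr0 mul1r => <-; congr (P _).
by apply/seteqP; split=> w //= [].
Qed.

(* [F] is applied to the word of all the coins read on the way. *)
Fixpoint dfull (I T : Type) (n : nat) (p : word) (F : word -> T) (t : dtree I T) : Prop :=
  match n, t with
  | 0, DLeaf x => x = F p
  | n'.+1, DNode i k => forall b, dfull n' (rcons p b) F (k b)
  | _, _ => False
  end.

Fixpoint fweight (T : eqType) (y : T) (n : nat) (p : word) (F : word -> T) : R :=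
  if n is n'.+1 then 2^-1 * fweight y n' (rcons p true) F +
                     2^-1 * fweight y n' (rcons p false) F
  else (F p == y)%:R.

Lemma dfull_weight (I : Type) (T : eqType) n p F (t : dtree I T) (y : T) :
  dfull n p F t -> dweight y t = fweight y n p F.
Proof.
elim: n p t => [|n IH] p [x|i k] //=; first by move=> ->.
by move=> h; rewrite !(IH _ _ (h _)).
Qed.

End Weight.

Section CoinWord.
Variables (I : eqType) (T : eqType) (lab : nat -> I).

Fixpoint coin_tree (n i : nat) (p : word) (F : word -> T) : dtree I T :=
  if n is n'.+1 then DNode (lab i) (fun b => coin_tree n' i.+1 (rcons p b) F)
  else DLeaf (F p).

Lemma coin_tree_full n i p F : dfull n p F (coin_tree n i p F).
Proof. by elim: n i p => //= n IH i p b; exact: IH. Qed.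

Lemma coin_tree_run n i p F (w : I -> bool) :
  drun w (coin_tree n i p F) = F (p ++ [seq w (lab j) | j <- iota i n]).
Proof.
elim: n i p => [|n IH] i p /=; first by rewrite cats0.
by rewrite IH -cats1 -catA.
Qed.

Hypothesis lab_inj : injective lab.

Lemma coin_tree_fresh n i p F s : (forall j, lab j \in s -> (j < i)%N) ->
  dfresh s (coin_tree n i p F).
Proof.
elim: n i p s => //= n IH i p s hs; split.
  by apply/negP => /hs; rewrite ltnn.
move=> b; apply: IH => j; rewrite inE => /orP[/eqP/lab_inj ->//|/hs h].
exact: ltnW.
Qed.

End CoinWord.

(** * Machines are representable *)

Section FromMachine.
Variables (M0 : ptm).

Lemma run_ext c c' n (x : config M0) : (forall i, (i < n)%N -> c i = c' i) ->
  run c n x = run c' n x.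
Proof.
elim: n => //= n IH h; rewrite [LHS]/(step (c n) (run c n x)).
by rewrite IH ?h // => i /ltnW; exact: h.
Qed.

Lemma run_halted c m n (x : config M0) : halted (run c m x) -> (m <= n)%N ->
  run c n x = run c m x.
Proof.
move=> h /subnK <-; elim: (n - m)%N => //= j IH.
rewrite [LHS]/(step (c (j + m)) (run c (j + m) x)) IH.
by move: h; rewrite /halted; case: (run c m x) => [[q l] r] /= ->.
Qed.

End FromMachine.

Section MachineRepresentable.
Local Open Scope classical_set_scope.

Theorem RFP_representable (R : realType) (k : nat) (f : random_function R k) :
  RFP f -> representable f.
Proof.
move=> [M0 [[p hp] hf]].
have [G [h1 h2 h3 h4]] := machine_formula M0 p k; exists G; split=> // xs y.
pose T := p.[size (encode (work M0) xs)]%R.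
(* The first [T] coins determine the output; the default of [nth] concerns later coins only. *)
pose F (u : word) := output (run (fun i => nth false u i) T (init M0 xs)).
have FE I (lab : nat -> I) (w : I -> bool) :
    F [seq w (lab j) | j <- iota 0 T] = output (run (fun i => w (lab i)) T (init M0 xs)).
  congr output; apply: run_ext => i iT.
  by rewrite (nth_map 0) ?size_iota // nth_iota.
have lab_inj : injective (fun i => nseq i true).
  by move=> i j /(congr1 size); rewrite !size_nseq.
rewrite hf (_ : outputs M0 xs y = [set c | drun c (coin_tree id T 0 [::] F) = y]); last first.
  apply/seteqP; split=> c /=; rewrite coin_tree_run (FE _ id).
    move=> [n [hn <-]]; have hT := hp xs c; congr output.
    case: (leqP n T) => [nT|/ltnW Tn]; first exact: run_halted.
    by apply/esym; exact: run_halted.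
  by move=> <-; exists T; split=> //; exact: hp.
rewrite (_ : interp (instance G xs y) =
    [set w | drun w (coin_tree (fun i => nseq i true) T 0 [::] F) = y]); last first.
  by apply/seteqP; split=> w; rewrite /interp /= h4 coin_tree_run FE.
rewrite !fair_dtree; last 4 first.
- exact: coin_measure_fair.
- exact: coin_tree_fresh.
- exact: coin_measure_fair.
- exact: coin_tree_fresh.
by rewrite !(dfull_weight _ _ (coin_tree_full _ _ _ _ _)).
Qed.

End MachineRepresentable.

(** * Feasible functions with an oracle *)

(** Cobham's function algebra relative to an oracle: [ERec] is recursion on notation with all values
    cut to the length of the last argument. In the step functions index 0 is the prefix read so far
    and index 1 the value reached on it. *)
Inductive expr : Type :=
| EVar of nat
| EEps
| EBit of bool
| ECat of expr & expr
| ETimes of expr & expr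
| EFlip of expr
| ERec of expr & expr & expr & expr & expr.

Fixpoint nrec_pair (b : nat) (h : bool -> word -> word -> word) (a : word * word) (x : word) :
    word * word :=
  if x is c :: x' then nrec_pair b h (rcons a.1 c, take b (h c a.1 a.2)) x' else a.

Definition nrec (b : nat) (h : bool -> word -> word -> word) (z x : word) : word :=
  (nrec_pair b h ([::], take b z) x).2.

Fixpoint ev (w : word -> bool) (v : nat -> word) (e : expr) : word :=
  match e with
  | EVar i => v i
  | EEps => [::]
  | EBit b => [:: b]
  | ECat e1 e2 => ev w v e1 ++ ev w v e2
  | ETimes e1 e2 => flatten (nseq (size (ev w v e2)) (ev w v e1))
  | EFlip e1 => if w (ev w v e1) then [:: true] else [::]
  | ERec x z s0 s1 B =>
      nrec (size (ev w v B)) (fun c p a => if c then ev w (econs p (econs a v)) s1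
                                         else ev w (econs p (econs a v)) s0)
        (ev w v z) (ev w v x)
  end.

Lemma nrec_pair_rcons b h a x c : nrec_pair b h a (rcons x c) =
  (rcons (nrec_pair b h a x).1 c,
   take b (h c (nrec_pair b h a x).1 (nrec_pair b h a x).2)).
Proof. by elim: x a => //= d x IH a. Qed.

Lemma nrec_pair1 b h a x : (nrec_pair b h a x).1 = a.1 ++ x.
Proof.
elim/last_ind: x => [|x c IH]; first by rewrite cats0.
by rewrite nrec_pair_rcons /= IH rcons_cat.
Qed.

Lemma nrec_nil b h z : nrec b h z [::] = take b z.
Proof. by []. Qed.

Lemma nrec_rcons b h z x c : nrec b h z (rcons x c) = take b (h c x (nrec b h z x)).
Proof. by rewrite /nrec nrec_pair_rcons /= nrec_pair1. Qed.

Lemma nrec_ext b h h' z x : (forall c p a, h c p a = h' c p a) -> nrec b h z x = nrec b h' z x.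
Proof.
by move=> e; elim/last_ind: x => // x c IH; rewrite !nrec_rcons IH e.
Qed.

Lemma ev_ext w v v' e : v =1 v' -> ev w v e = ev w v' e.
Proof.
elim: e v v' => //= [e1 IH1 e2 IH2|e1 IH1 e2 IH2|e1 IH1|x IHx z IHz s0 IH0 s1 IH1 B IHB]
  v v' h.
- by rewrite (IH1 _ _ h) (IH2 _ _ h).
- by rewrite (IH1 _ _ h) (IH2 _ _ h).
- by rewrite (IH1 _ _ h).
- rewrite (IHx _ _ h) (IHz _ _ h) (IHB _ _ h); apply: nrec_ext => c p a.
  have h' : econs p (econs a v) =1 econs p (econs a v') by case=> [|[|i]] //=.
  by rewrite (IH0 _ _ h') (IH1 _ _ h').
Qed.

Definition rup (f : nat -> nat) (i : nat) : nat :=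
  match i with 0 => 0 | 1 => 1 | j.+2 => (f j).+2 end.

Fixpoint eren (f : nat -> nat) (e : expr) : expr :=
  match e with
  | EVar i => EVar (f i)
  | EEps => EEps
  | EBit b => EBit b
  | ECat e1 e2 => ECat (eren f e1) (eren f e2)
  | ETimes e1 e2 => ETimes (eren f e1) (eren f e2)
  | EFlip e1 => EFlip (eren f e1)
  | ERec x z s0 s1 B => ERec (eren f x) (eren f z) (eren (rup f) s0) (eren (rup f) s1)
      (eren f B)
  end.

Lemma ev_ren w v f e : ev w v (eren f e) = ev w (fun i => v (f i)) e.
Proof.
elim: e v f => //= [e1 IH1 e2 IH2|e1 IH1 e2 IH2|e1 IH1|x IHx z IHz s0 IH0 s1 IH1 B IHB] v f;
  rewrite ?IH1 ?IH2 // IHx IHz IHB; apply: nrec_ext => c p a.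
by case: c; rewrite ?IH0 ?IH1; apply: ev_ext => -[|[|i]].
Qed.

Definition eup (f : nat -> expr) (i : nat) : expr :=
  match i with 0 => EVar 0 | 1 => EVar 1 | j.+2 => eren (fun i => i.+2) (f j) end.

Fixpoint esubst (f : nat -> expr) (e : expr) : expr :=
  match e with
  | EVar i => f i
  | EEps => EEps
  | EBit b => EBit b
  | ECat e1 e2 => ECat (esubst f e1) (esubst f e2)
  | ETimes e1 e2 => ETimes (esubst f e1) (esubst f e2)
  | EFlip e1 => EFlip (esubst f e1)
  | ERec x z s0 s1 B => ERec (esubst f x) (esubst f z) (esubst (eup f) s0)
      (esubst (eup f) s1) (esubst f B)
  end.

Lemma ev_subst w v f e : ev w v (esubst f e) = ev w (fun i => ev w v (f i)) e.
Proof.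
elim: e v f => //= [e1 IH1 e2 IH2|e1 IH1 e2 IH2|e1 IH1|x IHx z IHz s0 IH0 s1 IH1 B IHB] v f;
  rewrite ?IH1 ?IH2 // IHx IHz IHB; apply: nrec_ext => c p a.
by case: c; rewrite ?IH0 ?IH1; apply: ev_ext => -[|[|i]] //=; rewrite ev_ren.
Qed.

Fixpoint ebound (e : expr) : nat :=
  match e with
  | EVar i => i.+1
  | EEps | EBit _ => 0
  | ECat e1 e2 | ETimes e1 e2 => maxn (ebound e1) (ebound e2)
  | EFlip e1 => ebound e1
  | ERec x z s0 s1 B => maxn (maxn (ebound x) (ebound z))
      (maxn (maxn (ebound s0) (ebound s1)) (ebound B))
  end.

Lemma ev_bound w v v' e n : (ebound e <= n)%N -> (forall i, (i < n)%N -> v i = v' i) ->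
  ev w v e = ev w v' e.
Proof.
elim: e v v' n => //= [i|e1 IH1 e2 IH2|e1 IH1 e2 IH2|e1 IH1
  |x IHx z IHz s0 IH0 s1 IH1 B IHB] v v' n; rewrite ?geq_max.
- by move=> h e; exact: e.
- by move=> /andP[h h'] e; rewrite (IH1 _ _ _ h e) (IH2 _ _ _ h' e).
- by move=> /andP[h h'] e; rewrite (IH1 _ _ _ h e) (IH2 _ _ _ h' e).
- by move=> h e; rewrite (IH1 _ _ _ h e).
- move=> /andP[/andP[hx hz] /andP[/andP[h0 h1] hB]] e.
  rewrite (IHx _ _ _ hx e) (IHz _ _ _ hz e) (IHB _ _ _ hB e); apply: nrec_ext => c p a.
  have e' i : (i < n.+2)%N -> econs p (econs a v) i = econs p (econs a v') i.
    by case: i => [|[|i]] //=; exact: e.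
  have le2 m : (m <= n)%N -> (m <= n.+2)%N by lia.
  by rewrite (IH0 _ _ _ (le2 _ h0) e') (IH1 _ _ _ (le2 _ h1) e').
Qed.

(** * Closure properties of the feasible functions *)

Notation oracle := (word -> bool).

(** As with [TD] and [SW], feasibility is a property of semantic functions, derived from their
    shape. For predicates, a nonempty word means truth. *)
Definition EX (f : oracle -> (nat -> word) -> word) := exists e, forall w v, ev w v e = f w v.
Definition EP (p : oracle -> (nat -> word) -> bool) :=
  exists e, forall w v, (ev w v e != [::]) = p w v.

Lemma ex_subst f (g : nat -> oracle -> (nat -> word) -> word) :
  EX f -> (forall i, EX (g i)) -> EX (fun w v => f w (fun i => g i w v)).
Proof.
move=> [e he] hg; exists (esubst (fun i => projT1 (cid (hg i))) e) => w v.
by rewrite ev_subst -he; apply: ev_ext => i; case: cid.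
Qed.

Lemma ep_subst p (g : nat -> oracle -> (nat -> word) -> word) :
  EP p -> (forall i, EX (g i)) -> EP (fun w v => p w (fun i => g i w v)).
Proof.
move=> [e he] hg; exists (esubst (fun i => projT1 (cid (hg i))) e) => w v.
by rewrite ev_subst -he; congr (_ != _); apply: ev_ext => i; case: cid.
Qed.

Lemma ex_var i : EX (fun w v => v i).
Proof. by exists (EVar i). Qed.

Lemma ex_cat f g : EX f -> EX g -> EX (fun w v => f w v ++ g w v).
Proof. by move=> [e he] [e' he']; exists (ECat e e') => w v /=; rewrite he he'. Qed.

Lemma ex_times f g : EX f -> EX g -> EX (fun w v => flatten (nseq (size (g w v)) (f w v))).
Proof. by move=> [e he] [e' he']; exists (ETimes e e') => w v /=; rewrite he he'. Qed.

Lemma ex_const s : EX (fun w v => s).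
Proof.
elim: s => [|b s [e he]]; first by exists EEps.
by exists (ECat (EBit b) e) => w v /=; rewrite he.
Qed.

Lemma ep_flip f : EX f -> EP (fun w v => w (f w v)).
Proof. by move=> [e he]; exists (EFlip e) => w v /=; rewrite he; case: ifP. Qed.

Lemma ep_nonempty f : EX f -> EP (fun w v => f w v != [::]).
Proof. by move=> [e he]; exists e => w v; rewrite he. Qed.

Lemma ex_nrec fx fz h fB : EX fx -> EX fz -> (forall c, EX (fun w v => h c w (v 0) (v 1) (etl (etl v)))) ->
  EX fB -> EX (fun w v => nrec (size (fB w v)) (fun c p a => h c w p a v) (fz w v) (fx w v)).
Proof.
move=> [x hx] [z hz] hh [B hB]; have [s0 h0] := hh false; have [s1 h1] := hh true.
exists (ERec x z s0 s1 B) => w v /=; rewrite hx hz hB; apply: nrec_ext => c p a.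
by case: c; rewrite ?h0 ?h1.
Qed.

(** A function obeying recursion equations is feasible once its values on the prefixes of the
    argument are bounded: there the cut in [nrec] never acts. The bound may depend on the argument
    itself. *)
Lemma ex_rec (g : oracle -> (nat -> word) -> word -> word) fx fz h fB :
  EX fx -> EX fz -> (forall c, EX (fun w v => h c w (v 0) (v 1) (etl (etl v)))) -> EX fB ->
  (forall w v, g w v [::] = fz w v) ->
  (forall w v p c, g w v (rcons p c) = h c w p (g w v p) v) ->
  (forall w v p, prefix p (fx w v) -> (size (g w v p) <= size (fB w v))%N) ->
  EX (fun w v => g w v (fx w v)).
Proof.
move=> hx hz hh hB g0 gS gB; have [e he] := ex_nrec hx hz hh hB; exists e => w v.
rewrite he; have : prefix (fx w v) (fx w v) by exact: prefix_refl.
move: {1 3 4}(fx w v) => t; elim/last_ind: t => [|t c IH] ht.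
  by rewrite nrec_nil -g0 take_oversize //; exact: gB.
have ht' : prefix t (fx w v) by apply: prefix_trans ht; exact: prefix_rcons.
by rewrite nrec_rcons IH // -gS take_oversize //; exact: gB.
Qed.

Lemma ex_ext f g : EX f -> (forall w v, f w v = g w v) -> EX g.
Proof. by move=> [e he] h; exists e => w v; rewrite he h. Qed.

Lemma ep_ext p q : EP p -> (forall w v, p w v = q w v) -> EP q.
Proof. by move=> [e he] h; exists e => w v; rewrite he h. Qed.

Lemma ex_wk k f : EX f -> EX (fun w v => f w (fun i => v (k + i))).
Proof. by move=> hf; apply: (ex_subst hf) => i; exact: ex_var. Qed.

(** Recursion on the condition: [h] at the empty word, [g] after any bit. *)
Lemma ex_ifn f g h : EX f -> EX g -> EX h ->
  EX (fun w v => if f w v != [::] then g w v else h w v).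
Proof.
move=> hf hg hh.
apply: (@ex_rec (fun w v x => if x != [::] then g w v else h w v) f h
  (fun c w p a v => g w v) (fun w v => g w v ++ h w v)) => //.
- by move=> c; exact: (ex_wk 2 hg).
- exact: ex_cat.
- by move=> w v p c; case: p.
- by move=> w v p _; rewrite size_cat; case: ifP => _; [exact: leq_addr|exact: leq_addl].
Qed.

Lemma ex_if p g h : EP p -> EX g -> EX h -> EX (fun w v => if p w v then g w v else h w v).
Proof.
move=> [e he] hg hh; have hf : EX (fun w v => ev w v e) by exists e.
by apply: (ex_ext (ex_ifn hf hg hh)) => w v; rewrite he.
Qed.

Lemma ep_if p q r : EP p -> EP q -> EP r -> EP (fun w v => if p w v then q w v else r w v).
Proof.
move=> hp [e he] [e' he'].
have hf : EX (fun w v => ev w v e) by exists e.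
have hf' : EX (fun w v => ev w v e') by exists e'.
apply: (ep_ext (ep_nonempty (ex_if hp hf hf'))) => w v; by case: (p w v); rewrite ?he ?he'.
Qed.

Lemma ep_const b : EP (fun w v => b).
Proof. by case: b; [exists (EBit true)|exists EEps]. Qed.

Lemma ep_not p : EP p -> EP (fun w v => ~~ p w v).
Proof.
move=> hp; apply: (ep_ext (ep_if hp (ep_const false) (ep_const true))) => w v.
by case: (p w v).
Qed.

Lemma ep_and p q : EP p -> EP q -> EP (fun w v => p w v && q w v).
Proof.
move=> hp hq; apply: (ep_ext (ep_if hp hq (ep_const false))) => w v; by case: (p w v).
Qed.

Lemma ep_or p q : EP p -> EP q -> EP (fun w v => p w v || q w v).
Proof.
move=> hp hq; apply: (ep_ext (ep_if hp (ep_const true) hq)) => w v; by case: (p w v).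
Qed.

Lemma ex_take f g : EX f -> EX g -> EX (fun w v => take (size (g w v)) (f w v)).
Proof.
move=> hf hg; apply: (ex_ext (ex_nrec (h := fun c w p a v => p) (ex_const [::]) hf _ hg)) => //.
by move=> c; exact: ex_var.
Qed.

Lemma ex_pred f : EX f -> EX (fun w v => take (size (f w v)).-1 (f w v)).
Proof.
move=> hf; apply: (@ex_rec (fun w v x => take (size x).-1 x) f (fun w v => [::])
  (fun c w p a v => p) f) => //.
- exact: ex_const.
- by move=> c; exact: ex_var.
- by move=> w v p c; rewrite size_rcons /= -cats1 takel_cat // take_size.
- move=> w v p /prefixP[t ->]; rewrite size_cat size_take_min; lia.
Qed.

Lemma ex_sub f g : EX f -> EX g -> EX (fun w v => take (size (f w v) - size (g w v)) (f w v)).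
Proof.
move=> hf hg; apply: (@ex_rec (fun w v x => take (size (f w v) - size x) (f w v)) g f
  (fun c w p a v => take (size a).-1 a) f) => //.
- by move=> c; apply: ex_pred; exact: ex_var.
- by move=> w v; rewrite subn0 take_size.
- move=> w v p c; rewrite size_rcons size_take_min take_takel; last by lia.
  by congr take; lia.
- by move=> w v p _; rewrite size_take_min; lia.
Qed.

Lemma ep_le f g : EX f -> EX g -> EP (fun w v => size (f w v) <= size (g w v))%N.
Proof.
move=> hf hg; apply: (ep_ext (ep_not (ep_nonempty (ex_sub hf hg)))) => w v.
by rewrite negbK -size_eq0 size_take_min (minn_idPl (leq_subr _ _)) subn_eq0.
Qed.

Lemma ex_drop f g : EX f -> EX g -> EX (fun w v => drop (size (g w v)) (f w v)).
Proof.
move=> hf hg; apply: (@ex_rec (fun w v x => drop (size (g w v)) x) f (fun w v => [::])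
  (fun c w p a v => if (size (g w v) <= size p)%N then a ++ [:: c] else [::]) f) => //.
- exact: ex_const.
- move=> c; apply: ex_if; last exact: ex_const.
    by apply: ep_le; [exact: (ex_wk 2 hg)|exact: ex_var].
  by apply: ex_cat; [exact: ex_var|exact: ex_const].
- move=> w v p c; case: leqP => h; first by rewrite cats1 drop_rcons.
  by rewrite drop_oversize // size_rcons.
- move=> w v p /prefixP[t ->]; rewrite size_drop size_cat; lia.
Qed.

Lemma ex_last f : EX f -> EX (fun w v => drop (size (f w v)).-1 (f w v)).
Proof.
move=> hf; apply: (@ex_rec (fun w v x => drop (size x).-1 x) f (fun w v => [::])
  (fun c w p a v => [:: c]) (fun w v => [:: true])) => //.
- exact: ex_const.
- by move=> c; exact: ex_const.
- exact: ex_const.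
- by move=> w v p c; rewrite size_rcons /= -cats1 drop_cat ltnn subnn drop0.
- by move=> w v p _; rewrite size_drop /=; lia.
Qed.

Lemma ep_bit f : EX f -> EP (fun w v => f w v == [:: true]).
Proof.
move=> hf.
apply: (ep_ext (ep_and (ep_nonempty (ex_nrec (h := fun c w p a v => if c then [:: true] else [::])
  hf (ex_const [::]) _ (ex_const [:: true]))) (ep_le hf (ex_const [:: true])))).
  by case; exact: ex_const.
move=> w v; case: (f w v) => [|c [|c' x]] //=; last by rewrite andbF; apply/esym/eqP; case: c.
by case: c.
Qed.

(** [G] records whether the part of [f] read so far is a prefix of [g]. The bit of [g] to compare
    next is the last bit of its prefix of the next length. *)
Lemma ep_eq f g : EX f -> EX g -> EP (fun w v => f w v == g w v).
Proof.
move=> hf hg.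
pose G (w : oracle) v x := if prefix x (g w v) then [:: true] else [::].
have hG : EX (fun w v => G w v (f w v)).
  pose bitc (c : bool) (u : word) := if c then u == [:: true] else (u != [::]) && (u != [:: true]).
  apply: (@ex_rec G f (fun w v => [:: true])
    (fun c w p a v => if (a != [::]) && bitc c (drop (size (take (size (p ++ [:: c])) (g w v))).-1
      (take (size (p ++ [:: c])) (g w v))) && ~~ (size (g w v) <= size p)%N
      then [:: true] else [::]) (fun w v => [:: true])) => //.
  - exact: ex_const.
  - move=> c; have hg2 := ex_wk 2 hg.
    have hl : EX (fun w v => drop (size (take (size (v 0 ++ [:: c])) (g w (etl (etl v))))).-1
      (take (size (v 0 ++ [:: c])) (g w (etl (etl v))))).
      by apply: ex_last; apply: ex_take => //; apply: ex_cat; [exact: ex_var|exact: ex_const].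
    apply: ex_if; [|exact: ex_const|exact: ex_const].
    apply: ep_and; first apply: ep_and.
    + by apply: ep_nonempty; exact: ex_var.
    + case: c hl => hl; first exact: ep_bit.
      by apply: ep_and; [exact: ep_nonempty|apply: ep_not; exact: ep_bit].
    + by apply: ep_not; apply: ep_le => //; exact: ex_var.
  - exact: ex_const.
  - by move=> w v; rewrite /G prefix0s.
  - move=> w v p c; rewrite /G; move: (g w v) => y.
    case: (boolP (prefix p y)) => [/prefixP[t ->]|np] /=; last first.
      case: ifP => // hp; move: np; rewrite (prefix_trans _ hp) //; exact: prefix_rcons.
    rewrite size_cat addn1 take_cat ltnNge leqnSn /= subSnn size_cat.
    case: t => [|d t] /=.
      by rewrite cats0 leqnn andbF; case: ifP => // /size_prefix; rewrite size_rcons ltnn.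
    rewrite take0 /= addn1 /= drop_cat ltnn subnn drop0.
    rewrite size_cat /= addnS leqNgt ltnS leq_addr /= andbT -cats1 prefix_catr // eqxx /=.
    by case: c; case: d; rewrite ?prefix0s.
  - by move=> w v p _; rewrite /G; case: ifP.
apply: (ep_ext (ep_and (ep_nonempty hG) (ep_le hg hf))) => w v; rewrite /G.
case: (boolP (prefix (f w v) (g w v))) => [/prefixP[t ->]|np] /=.
  rewrite size_cat; case: t => [|d t]; first by rewrite cats0 addn0 leqnn eqxx.
  rewrite addnS ltnNge leq_addr; apply/esym/eqP => /(congr1 size).
  by rewrite size_cat /=; lia.
by apply/esym/eqP => e; move: np; rewrite e prefix_refl.
Qed.

Lemma ep_prefix f g : EX f -> EX g -> EP (fun w v => prefix (f w v) (g w v)).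
Proof.
move=> hf hg; apply: (ep_ext (ep_eq (ex_take hg hf) hf)) => w v.
by rewrite prefixE.
Qed.

Definition einfix (x t : word) : Prop := exists a b, t = a ++ x ++ b.

(** A subword is a suffix of a prefix, so two nested recursions visit all of them: [O] runs through
    the prefixes, [I] through the suffixes of each. When the search fails the value is the empty
    word, still a subword. *)
Lemma ex_search ft (q : oracle -> word -> (nat -> word) -> bool) :
  EX ft -> EP (fun w v => q w (v 0) (etl v)) ->
  exists g, [/\ EX g, (forall w v, einfix (g w v) (ft w v)) &
    forall w v x, einfix x (ft w v) -> q w x v -> q w (g w v) v].
Proof.
move=> ht hq.
(* The leading [true] signals success, since the word found may be empty. *)
pose I w v (u p : word) : word := foldl (fun a j => if a != [::] then a else
  if q w (drop j u) v then true :: drop j u else [::]) [::] (iota 0 (size p).+1).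
have I0 w v u : I w v u [::] = if q w u v then true :: u else [::].
  by rewrite /I /= drop0.
have IS w v u p c : I w v u (rcons p c) = if I w v u p != [::] then I w v u p else
    if q w (drop (size p).+1 u) v then true :: drop (size p).+1 u else [::].
  by rewrite /I size_rcons -[X in iota 0 X]addn1 iotaD foldl_cat.
have Iprop w v u p : (I w v u p <> [::] -> exists2 j, (j <= size p)%N &
    I w v u p = true :: drop j u /\ q w (drop j u) v) /\
    (I w v u p = [::] -> forall j, (j <= size p)%N -> ~~ q w (drop j u) v).
  elim/last_ind: p => [|p c [IH1 IH2]].
    rewrite I0; case: ifP => h; split=> // _; first by exists 0; rewrite ?drop0.
    by case=> // _; rewrite drop0 h.
  rewrite IS size_rcons; case: eqP => [e|ne] /=; last first.
    split; last by move=> e; case: ne.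
    by move=> /IH1[j hj h]; exists j => //; exact: leqW.
  case: ifP => h; split=> //; first by move=> _; exists (size p).+1.
  move=> _ j; rewrite leq_eqVlt => /orP[/eqP->|]; first by rewrite h.
  by move=> hj; exact: IH2.
pose O w v (t : word) : word := foldl (fun a j => if a != [::] then a else
  I w v (take j t) (take j t)) [::] (iota 0 (size t).+1).
have O0 w v : O w v [::] = I w v [::] [::] by rewrite /O /=.
have OS w v t c : O w v (rcons t c) = if O w v t != [::] then O w v t else
    I w v (rcons t c) (rcons t c).
  rewrite /O size_rcons -[X in iota 0 X]addn1 iotaD foldl_cat.
  have -> : foldl (fun a j => if a != [::] then a else
      I w v (take j (rcons t c)) (take j (rcons t c))) [::] (iota 0 (size t).+1) = O w v t.
    have gen l : (forall j, j \in l -> (j <= size t)%N) -> forall a : word,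
        foldl (fun a j => if a != [::] then a else
          I w v (take j (rcons t c)) (take j (rcons t c))) a l =
        foldl (fun a j => if a != [::] then a else I w v (take j t) (take j t)) a l.
      elim: l => //= j l IH h a; rewrite -cats1 takel_cat ?h ?mem_head // cats1 IH //.
      by move=> j' hj'; apply: h; rewrite inE hj' orbT.
    by apply: gen => j; rewrite mem_iota.
  by rewrite /= -[X in take X _](size_rcons t c) take_size.
have Oprop w v t : (O w v t <> [::] -> exists2 x, einfix x t & O w v t = true :: x /\ q w x v) /\
    (O w v t = [::] -> forall x, einfix x t -> ~~ q w x v).
  elim/last_ind: t => [|t c [IH1 IH2]].
    rewrite O0 I0; case: ifP => h; split=> // _.
      by exists [::] => //; exists [::], [::].
    by move=> x [a [b]]; case: a; case: x => //; rewrite h.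
  rewrite OS; case: eqP => [e|ne] /=; last first.
    split; last by move=> e; case: ne.
    move=> /IH1[x [a [b e]] h]; exists x => //; exists a, (rcons b c).
    by rewrite e !rcons_cat.
  have [h1 h2] := Iprop w v (rcons t c) (rcons t c); split.
    move=> /h1[j hj h]; exists (drop j (rcons t c)) => //.
    by exists (take j (rcons t c)), [::]; rewrite cats0 cat_take_drop.
  move=> /h2 h x [a [b]]; case/lastP: b => [|b d].
    rewrite cats0 => e'; have := h (size a); rewrite e' drop_size_cat //.
    by rewrite size_cat leq_addr; exact.
  rewrite -!rcons_cat => /rcons_inj[e' _]; apply: IH2 => //.
  by exists a, b.
have sI w v u p : (size (I w v u p) <= (size u).+1)%N.
  case: (I w v u p =P [::]) => [->//|/((Iprop w v u p).1)[j _ [-> _]]].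
  by rewrite /= ltnS size_drop leq_subr.
have hI (fu fp : oracle -> (nat -> word) -> word) (k : nat) : EX fu -> EX fp ->
    EX (fun w v => I w (fun i => v (k + i)) (fu w v) (fp w v)).
  move=> hu hp; pose tst (fx : oracle -> (nat -> word) -> word) (k : nat) w v : word :=
    if q w (fx w v) (fun i => v (k + i)) then [:: true] ++ fx w v else [::].
  have ht' fx k' : EX fx -> EX (tst fx k').
    move=> hx; apply: ex_if; [|by apply: ex_cat => //; exact: ex_const|exact: ex_const].
    apply: (ep_ext (ep_subst (g := fun i w v => if i is j.+1 then v (k' + j) else fx w v) hq _)) => //.
    by case=> [|i]; [|exact: ex_var].
  apply: (@ex_rec (fun w v p => I w (fun i => v (k + i)) (fu w v) p) fp (tst fu k)
    (fun c w p a v => if a != [::] then a else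
      if q w (drop (size (p ++ [:: c])) (fu w v)) (fun i => v (k + i))
        then true :: drop (size (p ++ [:: c])) (fu w v) else [::])
    (fun w v => [:: true] ++ fu w v)) => //.
  - exact: ht'.
  - move=> c; apply: ex_ifn; [exact: ex_var|exact: ex_var|].
    have hx : EX (fun w v => drop (size (v 0 ++ [:: c])) (fu w (etl (etl v)))).
      apply: ex_drop; first exact: (ex_wk 2 hu).
      by apply: ex_cat; [exact: ex_var|exact: ex_const].
    by apply: (ex_ext (ht' _ k.+2 hx)) => w v; rewrite /tst /etl.
  - by apply: ex_cat => //; exact: ex_const.
  - by move=> w v p c; rewrite IS size_cat addn1.
have hO : EX (fun w v => O w v (ft w v)).
  apply: (@ex_rec O ft (fun w v => I w v [::] [::])
    (fun c w p a v => if a != [::] then a else I w v (p ++ [:: c]) (p ++ [:: c]))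
    (fun w v => [:: true] ++ ft w v)) => //.
  - by apply: (hI _ _ 0); exact: ex_const.
  - move=> c; apply: ex_ifn; [exact: ex_var|exact: ex_var|].
    by apply: (hI _ _ 2); apply: ex_cat; [exact: ex_var|exact: ex_const|exact: ex_var|exact: ex_const].
  - by apply: ex_cat => //; exact: ex_const.
  - by move=> w v p c; rewrite OS cats1.
  - move=> w v p /prefixP[t ->] /=; case: (O w v p =P [::]) => [->//|].
    move=> /((Oprop w v p).1)[x [a [b ->]] [-> _]] /=; rewrite ltnS !size_cat; lia.
exists (fun w v => drop (size [:: true]) (O w v (ft w v))); split.
- by apply: ex_drop => //; exact: ex_const.
- move=> w v; case: (O w v (ft w v) =P [::]) => [->|].
    by exists [::], (ft w v).
  by move=> /((Oprop w v _).1)[x hx [-> _]]; rewrite /= drop0.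
- move=> w v x hx hqx; case: (O w v (ft w v) =P [::]) => [e|].
    by have := (Oprop w v _).2 e _ hx; rewrite hqx.
  by move=> /((Oprop w v _).1)[y _ [-> hy]]; rewrite /= drop0.
Qed.

(** Self-delimiting: the ones before the first 0 tell the length of [x]. *)
Definition pr (x y : word) : word := nseq (size x) true ++ false :: x ++ y.

Lemma pr_inj x y x' y' : pr x y = pr x' y' -> x = x' /\ y = y'.
Proof.
have aux n m (a b : word) : nseq n true ++ false :: a = nseq m true ++ false :: b -> n = m.
  by elim: n m => [|n IH] [|m] //= [/IH ->].
rewrite /pr => e; have en := aux _ _ _ _ e.
move: e => /eqP; rewrite eqseq_cat ?size_nseq // => /andP[_ /eqP[]] /eqP.
by rewrite eqseq_cat // => /andP[/eqP -> /eqP ->].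
Qed.

Lemma ex_pr f g : EX f -> EX g -> EX (fun w v => pr (f w v) (g w v)).
Proof.
move=> hf hg; apply: (ex_ext (ex_cat (ex_times (ex_const [:: true]) hf)
  (ex_cat (ex_const [:: false]) (ex_cat hf hg)))) => w v.
by rewrite /pr /=; congr cat; elim: (size _) => //= n ->.
Qed.

(** Both components are subwords of the pair, so [ex_search] finds them. The oracle argument only
    comes from the form of [EX]; on pairs the values do not depend on it. *)
Lemma unpair : exists p1 p2 : oracle -> word -> word,
  [/\ (forall f, EX f -> EX (fun w v => p1 w (f w v))),
      (forall f, EX f -> EX (fun w v => p2 w (f w v))),
      (forall w x y, p1 w (pr x y) = x) & forall w x y, p2 w (pr x y) = y].
Proof.
have e1 : EP (fun w v => prefix (pr (v 0) [::]) (etl v 0)).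
  by apply: ep_prefix; [apply: ex_pr; [|exact: ex_const]|]; exact: ex_var.
have [g1 [hg1 _ g1P]] := @ex_search (fun w v => v 0) (fun w x v => prefix (pr x [::]) (v 0))
  (ex_var 0) e1.
pose p1 w (p : word) := g1 w (fun=> p).
have hp1 f : EX f -> EX (fun w v => p1 w (f w v)) by move=> hf; exact: (ex_subst hg1).
have p1E w x y : p1 w (pr x y) = x.
  have : prefix (pr (p1 w (pr x y)) [::]) (pr x y).
    apply: (g1P w (fun=> pr x y) x).
      by exists (nseq (size x) true ++ [:: false]), y; rewrite -catA.
    by apply/prefixP; exists y; rewrite /pr -!catA /= -catA.
  move=> /prefixP[t]; rewrite /pr -catA /= -catA => e.
  by have [h _] := @pr_inj _ _ _ _ e; exact: esym h.
have e2 : EP (fun w v => pr (p1 w (etl v 0)) (v 0) == etl v 0).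
  by apply: ep_eq; [apply: ex_pr; [apply: hp1|]|]; exact: ex_var.
have [g2 [hg2 _ g2P]] := @ex_search (fun w v => v 0)
  (fun w x v => pr (p1 w (v 0)) x == v 0) (ex_var 0) e2.
exists p1, (fun w p => g2 w (fun=> p)); split=> //.
  by move=> f hf; exact: (ex_subst hg2).
move=> w x y; have hin : einfix y (pr x y).
  by exists (nseq (size x) true ++ false :: x), [::]; rewrite cats0 -catA.
have := g2P w (fun=> pr x y) y hin; rewrite p1E eqxx => /(_ isT)/eqP/pr_inj[].
by [].
Qed.

Definition pr1 : oracle -> word -> word := projT1 (cid unpair).
Definition pr2 : oracle -> word -> word := projT1 (cid (projT2 (cid unpair))).

Lemma unpairP : [/\ (forall f, EX f -> EX (fun w v => pr1 w (f w v))),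
      (forall f, EX f -> EX (fun w v => pr2 w (f w v))),
      (forall w x y, pr1 w (pr x y) = x) & forall w x y, pr2 w (pr x y) = y].
Proof. exact: projT2 (cid (projT2 (cid unpair))). Qed.

Lemma ex_pr1 f : EX f -> EX (fun w v => pr1 w (f w v)).
Proof. by have [h _ _ _] := unpairP; exact: h. Qed.

Lemma ex_pr2 f : EX f -> EX (fun w v => pr2 w (f w v)).
Proof. by have [_ h _ _] := unpairP; exact: h. Qed.

Lemma pr1E w x y : pr1 w (pr x y) = x.
Proof. by have [_ _ h _] := unpairP; exact: h. Qed.

Lemma pr2E w x y : pr2 w (pr x y) = y.
Proof. by have [_ _ _ h] := unpairP; exact: h. Qed.

(** * Bounded formulas are feasible *)

Lemma ex_term t : EX (fun w v => teval v t).
Proof.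
elim: t => [i||b|t IH s IH'|t IH s IH'] /=.
- exact: ex_var.
- exact: ex_const.
- exact: ex_const.
- exact: ex_cat.
- exact: ex_times.
Qed.

Definition holdsb w (v : nat -> word) F : bool := `[< holds w v F >].

Lemma holdsP w v F : reflect (holds w v F) (holdsb w v F).
Proof. exact: asboolP. Qed.

Lemma holds_ext w v v' F : v =1 v' -> holds w v F <-> holds w v' F.
Proof. by move=> h; rewrite !holds_std; apply: sat_ext. Qed.

Lemma holds_tlift (w : oracle) (v : nat -> word) x t : teval (scons x v) (tlift t) = teval v t.
Proof. by rewrite !(teval_std w) /tlift tev_subst. Qed.

Lemma holds_flift w v x F : holds w (scons x v) (flift F) <-> holds w v F.
Proof. by rewrite !holds_std /flift sat_subst. Qed.

Lemma einfixP (x t : word) : (exists u, prefix u t /\ prefix (u ++ x) t) <-> einfix x t.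
Proof.
split=> [[u [_ /prefixP[b ->]]]|[a [b ->]]]; first by exists u, b; rewrite -catA.
by exists a; split; apply/prefixP; [exists (x ++ b)|exists b; rewrite -catA].
Qed.

Lemma holds_ex_subword w v t A :
  holds w v (ex_subword t A) <-> exists x, einfix x (teval v t) /\ holds w (scons x v) A.
Proof.
split=> [[x [u [[h1 h2] h3]]]|[x [/einfixP[u [h1 h2]] h3]]].
  exists x; split; last by move/holds_flift : h3.
  by apply/einfixP; exists u; move: h1 h2; rewrite /= !(holds_tlift w).
by exists x, u; split; [split; rewrite /= !(holds_tlift w)|apply/holds_flift].
Qed.

Lemma holds_all_subword w v t A :
  holds w v (all_subword t A) <-> forall x, einfix x (teval v t) -> holds w (scons x v) A.
Proof.
split=> [h x /einfixP[u [h1 h2]]|h x].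
  case: (h x) => // nh; case: nh; exists u.
  by split; rewrite /= !(holds_tlift w).
have [/h|nx] := pselect (einfix x (teval v t)); [by right|left].
move=> [u [h1 h2]]; apply: nx; apply/einfixP; exists u.
by move: h1 h2; rewrite /= !(holds_tlift w).
Qed.

Lemma ep_scons F : EP (fun w v => holdsb w v F) ->
  EP (fun w v => holdsb w (scons (v 0) (etl v)) F).
Proof.
move=> h; apply: (ep_ext h) => w v; apply: asbool_equiv_eq; apply: holds_ext.
by case.
Qed.

(** A subword quantifier is decided at the one subword that the search returns: a witness for an
    existential, a counterexample for a universal. *)
Lemma ep_sw F : subword_bounded F -> EP (fun w v => holdsb w v F).
Proof.
elim=> {F} [t|t s|t s|A _ IA|A B _ IA _ IB|A B _ IA _ IB|t A _ IA|t A _ IA].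
- apply: (ep_ext (ep_flip (ex_term t))) => w v.
  by rewrite /holdsb /=; apply/esym; apply: asboolb.
- apply: (ep_ext (ep_eq (ex_term t) (ex_term s))) => w v.
  by apply/eqP/(holdsP w v (FEq t s)).
- apply: (ep_ext (ep_prefix (ex_term t) (ex_term s))) => w v.
  by rewrite /holdsb /= asboolb.
- by apply: (ep_ext (ep_not IA)) => w v; rewrite /holdsb /= asbool_neg.
- by apply: (ep_ext (ep_and IA IB)) => w v; rewrite /holdsb /= asbool_and.
- by apply: (ep_ext (ep_or IA IB)) => w v; rewrite /holdsb /= asbool_or.
- have [g [hg g1 g2]] := @ex_search _ (fun w x v => holdsb w (scons x v) A)
    (ex_term t) (ep_scons IA).
  have h : EP (fun w v => holdsb w (scons (g w v) v) A).
    apply: (ep_ext (ep_subst (g := fun i w v => if i is j.+1 then v j else g w v) IA _)).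
      by case=> [|i]; [|exact: ex_var].
    by move=> w v; apply: asbool_equiv_eq; apply: holds_ext; case.
  apply: (ep_ext h) => w v; apply: asbool_equiv_eq; rewrite holds_ex_subword.
  split=> [hA|[x [hx /holdsP hA]]]; first by exists (g w v).
  exact/holdsP/(g2 w v x).
- have [g [hg g1 g2]] := @ex_search _ (fun w x v => ~~ holdsb w (scons x v) A)
    (ex_term t) (ep_not (ep_scons IA)).
  have h : EP (fun w v => holdsb w (scons (g w v) v) A).
    apply: (ep_ext (ep_subst (g := fun i w v => if i is j.+1 then v j else g w v) IA _)).
      by case=> [|i]; [|exact: ex_var].
    by move=> w v; apply: asbool_equiv_eq; apply: holds_ext; case.
  apply: (ep_ext h) => w v; apply: asbool_equiv_eq; rewrite holds_all_subword.
  split=> [hA x hx|hA]; last exact: hA.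
  apply/holdsP; apply: contraT => hn.
  by have := g2 w v x hx hn => /negP; case; apply/holdsP.
Qed.

Lemma size_teval_mono v v' t : (forall i, (size (v i) <= size (v' i))%N) ->
  (size (teval v t) <= size (teval v' t))%N.
Proof.
move=> h; elim: t => //= t IH s IH'; first by rewrite !size_cat; exact: leq_add.
rewrite !size_flatten /shape !map_nseq !sumn_nseq; exact: leq_mul.
Qed.

(* A witness of a bounded existential formula is a single word coding all the
   existentially quantified ones. *)
Record wit : Type := Wit {
  wit_rel : oracle -> word -> (nat -> word) -> bool;
  wit_bound : term;
  wit_ep : EP (fun w v => wit_rel w (v 0) (etl v));
  wit_size : forall w z v, wit_rel w z v -> (size z <= size (teval v wit_bound))%N;
  wit_ext : forall w z v v', v =1 v' -> wit_rel w z v = wit_rel w z v' }.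

Definition wit_base F (hF : subword_bounded F) : wit.
Proof.
refine (@Wit (fun w z v => (z == [::]) && holdsb w v F) TEps _ _ _).
- apply: ep_and; first by apply: ep_eq; [exact: ex_var|exact: ex_const].
  by apply: (ep_subst (ep_sw hF)) => i; exact: ex_var.
- by move=> w z v /andP[/eqP->].
- by move=> w z v v' h; congr andb; apply: asbool_equiv_eq; exact: holds_ext.
Defined.

Definition inst_env (t : term) (n : nat) : term := if n is m.+1 then TVar m else t.

Lemma teval_ext v v' t : v =1 v' -> teval v t = teval v' t.
Proof. by move=> h; elim: t => //= [t -> s ->|t -> s ->]. Qed.

Lemma teval_subst v f t : teval v (tsubst f t) = teval (fun n => teval v (f n)) t.
Proof. by elim: t => //= [t -> s ->|t -> s ->]. Qed.

(** Requiring that [z] is a genuine pair makes its length computable from its components: the bound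
    counts the first one twice, one separator, and the bound of the inner witness with [t] in place
    of the quantified word. *)
Definition wit_ex (t : term) (W : wit) : wit.
Proof.
refine (@Wit (fun w z v => [&& pr (pr1 w z) (pr2 w z) == z,
    (size (pr1 w z) <= size (teval v t))%N & wit_rel W w (pr2 w z) (econs (pr1 w z) v)])
  (TCat (TCat t t) (TCat (TBit true) (tsubst (inst_env t) (wit_bound W)))) _ _ _).
- apply: ep_and; first apply: ep_eq; last apply: ep_and.
  + by apply: ex_pr; [apply: ex_pr1|apply: ex_pr2]; exact: ex_var.
  + exact: ex_var.
  + apply: ep_le; first by apply: ex_pr1; exact: ex_var.
    by apply: (ex_subst (ex_term t)) => i; exact: ex_var.
  + apply: (ep_ext (ep_subst (g := fun i w v => match i with
      | 0 => pr2 w (v 0) | 1 => pr1 w (v 0) | j.+2 => v j.+1 end) (wit_ep W) _)).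
      by case=> [|[|i]]; [apply: ex_pr2|apply: ex_pr1|]; exact: ex_var.
    by move=> w v; apply: wit_ext; case.
- move=> w z v /and3P[/eqP e h1 /wit_size h2]; rewrite -[in X in (X <= _)%N]e.
  rewrite -[teval v (TCat _ _)]/((teval v t ++ teval v t) ++
    true :: teval v (tsubst (inst_env t) (wit_bound W))) /pr !size_cat size_nseq.
  rewrite ![size (_ :: _)]/= size_cat.
  have : (size (teval (econs (pr1 w z) v) (wit_bound W)) <=
          size (teval v (tsubst (inst_env t) (wit_bound W))))%N.
    by rewrite teval_subst; apply: size_teval_mono; case.
  by move: h2; lia.
- move=> w z v v' h; rewrite (teval_ext _ h); congr [&& _, _ & _]; apply: wit_ext.
  by case=> /=.
Defined.

Lemma wit_exE t W w z v : wit_rel (wit_ex t W) w z v =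
  [&& pr (pr1 w z) (pr2 w z) == z, (size (pr1 w z) <= size (teval v t))%N &
      wit_rel W w (pr2 w z) (econs (pr1 w z) v)].
Proof. by []. Qed.

Lemma wit_baseE F (hF : subword_bounded F) w z v :
  wit_rel (wit_base hF) w z v = (z == [::]) && holdsb w v F.
Proof. by []. Qed.

(** A relation, because a proof of [Sigma1b], a proposition, cannot be analysed to build a [wit]. *)
Inductive is_wit : formula -> wit -> Prop :=
| IW_base F (hF : subword_bounded F) : is_wit F (wit_base hF)
| IW_ex t A W : is_wit A W -> is_wit (ex_le t A) (wit_ex t W).

Lemma sigma_wit B : Sigma1b B -> exists W, is_wit B W.
Proof.
elim=> {B} [A hA|t A _ [W hW]]; first by exists (wit_base hA); constructor.
by exists (wit_ex t W); constructor.
Qed.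

Lemma std_ones_le (x y : word) :
  prefix (flatten (nseq (size x) [:: true])) (flatten (nseq (size y) [:: true])) =
  (size x <= size y)%N.
Proof.
have e n : flatten (nseq n [:: true]) = nseq n true by elim: n => //= n ->.
rewrite !e; apply/prefixP/idP => [[t h]|h].
  by rewrite -(size_nseq (size y) true) h size_cat size_nseq leq_addr.
by exists (nseq (size y - size x) true); rewrite -nseqD subnKC.
Qed.

Lemma wit_holds B W w v : is_wit B W -> holds w v B <-> exists z, wit_rel W w z v.
Proof.
move=> h; elim: h w v => {B W} [F hF|t A W _ IH] w v /=.
  split=> [h|[z /andP[_ /holdsP]]] //; by exists [::]; rewrite eqxx; apply/holdsP.
split=> [[x [hx /IH[z hz]]]|[z]].
  exists (pr x z); rewrite ?wit_exE pr1E pr2E eqxx /=.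
  move: hx; rewrite /= (holds_tlift w) std_ones_le => -> /=.
  by move: hz; rewrite (@wit_ext W w z _ (econs x v)) //; case.
rewrite ?wit_exE => /and3P[_ h1 h2]; exists (pr1 w z); split.
  by rewrite /= (holds_tlift w) std_ones_le.
apply/IH; exists (pr2 w z); move: h2; rewrite (@wit_ext W w _ _ (scons (pr1 w z) v)) //.
Qed.

(** * Witnessing, by a saturated restricted ultrapower *)

Fixpoint expr_tree (e : expr) : GenTree.tree nat :=
  match e with
  | EVar n => GenTree.Leaf n
  | EEps => GenTree.Node 0 [::]
  | EBit b => GenTree.Node (1 + b) [::]
  | ECat e1 e2 => GenTree.Node 3 [:: expr_tree e1; expr_tree e2]
  | ETimes e1 e2 => GenTree.Node 4 [:: expr_tree e1; expr_tree e2]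
  | EFlip e1 => GenTree.Node 5 [:: expr_tree e1]
  | ERec x z s0 s1 B => GenTree.Node 6
      [:: expr_tree x; expr_tree z; expr_tree s0; expr_tree s1; expr_tree B]
  end.

Fixpoint tree_expr (x : GenTree.tree nat) : expr :=
  match x with
  | GenTree.Leaf n => EVar n
  | GenTree.Node 1 _ => EBit false
  | GenTree.Node 2 _ => EBit true
  | GenTree.Node 3 [:: t; s] => ECat (tree_expr t) (tree_expr s)
  | GenTree.Node 4 [:: t; s] => ETimes (tree_expr t) (tree_expr s)
  | GenTree.Node 5 [:: t] => EFlip (tree_expr t)
  | GenTree.Node 6 [:: x; z; s; t; B] =>
      ERec (tree_expr x) (tree_expr z) (tree_expr s) (tree_expr t) (tree_expr B)
  | _ => EEps
  end.

Lemma expr_treeK : cancel expr_tree tree_expr.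
Proof. by elim=> //= [[]//|e1 -> e2 ->|e1 -> e2 ->|e ->|x -> z -> s0 -> s1 -> B ->]. Qed.

Definition expr_enum (n : nat) : expr := odflt EEps (omap tree_expr (unpickle n)).

Lemma expr_enum_surj e : exists n, expr_enum n = e.
Proof. by exists (pickle (expr_tree e)); rewrite /expr_enum pickleK /= expr_treeK. Qed.

(** The Herbrand step: if at each point one of finitely many candidates works, then a case
    distinction on the decidable property [q] makes them a single feasible function. *)
Lemma ex_pick (q : oracle -> word -> (nat -> word) -> bool) (es : seq expr) :
  EP (fun w v => q w (v 0) (etl v)) ->
  exists h, forall w v, (exists2 e, List.In e es & q w (ev w v e) v) -> q w (ev w v h) v.
Proof.
move=> hq; elim: es => [|e es [h IH]]; first by exists EEps => w v [].
have he : EX (fun w v => ev w v e) by exists e.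
have hh : EX (fun w v => ev w v h) by exists h.
have hp : EP (fun w v => q w (ev w v e) v).
  apply: (ep_ext (ep_subst (g := fun i w v => if i is j.+1 then v j else ev w v e) hq _)) => //.
  by case=> [|i]; [|exact: ex_var].
have [e' he'] := ex_if hp he hh; exists e' => w v [f hf hqf]; rewrite he'.
case: ifP => // nq; case: hf => [ef|hf]; first by rewrite ef hqf in nq.
by apply: IH; exists f.
Qed.

(** * A filter saturated for universal constraints *)

Section Saturation.
Local Open Scope classical_set_scope.

Definition point : Type := (oracle * (nat -> word))%type.

(* The constraint [(p, j)] stands for: p(u, c_j, c) holds for all u. *)
Definition constr : Type := (expr * nat)%type.
Definition inst_at (q : constr) (e : expr) (x : point) : Prop :=
  ev x.1 (econs (ev x.1 x.2 e) (econs (x.2 q.2) x.2)) q.1 <> [::].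

Definition fip (G : seq constr) : Prop := forall l : seq (constr * expr),
  (forall q, List.In q l -> List.In q.1 G) ->
  exists x, forall q, List.In q l -> inst_at q.1 q.2 x.

(** Points have infinitely many coordinates; one that no earlier constraint mentions acts as a new
    Henkin constant. *)
Definition cfresh (p : expr) (G : seq constr) : nat :=
  foldr (fun q n => maxn (maxn (ebound q.1) q.2.+1) n) (ebound p) G.

Variable c0 : constr.
Hypothesis fip0 : fip [:: c0].

Fixpoint chain (n : nat) : seq constr :=
  if n is m.+1 then
    let c := (expr_enum m, cfresh (expr_enum m) (chain m)) in
    if `[< fip (c :: chain m) >] then c :: chain m else chain m
  else [:: c0].

Lemma chain_fip n : fip (chain n).
Proof. by elim: n => //= n IH; case: asboolP. Qed.

Lemma chain_mono m n c : (m <= n)%N -> List.In c (chain m) -> List.In c (chain n).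
Proof.
move=> /subnK <-; elim: (n - m)%N => //= k IH /IH h.
by case: asboolP => // _; right.
Qed.

Definition base : set_system point :=
  [set A | exists l : seq (constr * expr), (exists n, forall q, List.In q l -> List.In q.1 (chain n)) /\
     (forall x, (forall q, List.In q l -> inst_at q.1 q.2 x) -> A x)].

Lemma base_proper : ProperFilter base.
Proof.
split.
  move=> [l [[n hn] h]]; have [x hx] := chain_fip hn; exact: h hx.
split.
- by exists [::]; split=> //; exists 0.
- move=> A B [l [[n hn] h]] [l' [[n' hn'] h']]; exists (l ++ l'); split.
    exists (maxn n n') => q /List.in_app_iff[/hn|/hn']; apply: chain_mono.
      exact: leq_maxl.
    exact: leq_maxr.
  move=> x hx; split; [apply: h|apply: h'] => q hq; apply: hx; apply/List.in_app_iff.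
    by left.
  by right.
- by move=> A B sAB [l [hl h]]; exists l; split=> // x /h /sAB.
Qed.

(** If the constraint [p] for a fresh coordinate was added to the chain, that coordinate realises
    it. Otherwise finitely many instances have no common solution; the other constraints being true
    almost everywhere, one of finitely many expressions refutes [p] there, and [ex_pick] turns them
    into [h]. *)
Lemma saturated_filter : exists U : set_system point, UltraFilter U /\
  (forall e, U (inst_at c0 e)) /\
  (forall p : expr,
    (exists c, forall e, U (fun x =>
      ev x.1 (econs (ev x.1 x.2 e) (econs (ev x.1 x.2 c) x.2)) p <> [::])) \/
    (exists h, forall a, U (fun x =>
      ev x.1 (econs (ev x.1 (econs (ev x.1 x.2 a) x.2) h) (econs (ev x.1 x.2 a) x.2)) p = [::]))).
Proof.
have [U [hU sU]] := ultraFilterLemma base_proper; exists U; split=> //.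
have hin c n e : List.In c (chain n) -> U (inst_at c e).
  move=> hc; apply: sU; exists [:: (c, e)]; split; first by exists n => q [<-|].
  by move=> x h; exact: (h (c, e) (or_introl erefl)).
split; first by move=> e; apply: (hin c0 0); left.
move=> p; have [n en] := expr_enum_surj p.
set j := cfresh p (chain n).
have jp : (ebound p <= j)%N.
  by rewrite /j; elim: (chain n) => //= q G IH; exact: leq_trans IH (leq_maxr _ _).
have jG q : List.In q (chain n) -> (ebound q.1 <= j)%N /\ (q.2 < j)%N.
  rewrite /j; elim: (chain n) => //= q' G IH [->|/IH[h1 h2]].
    by split; apply: leq_trans (leq_maxl _ _); [exact: leq_maxl|exact: leq_maxr].
  by split; [apply: leq_trans h1 _|apply: leq_trans h2 _]; exact: leq_maxr.
have [yes|no] := pselect (fip ((p, j) :: chain n)); [left|right].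
  exists (EVar j) => e; apply: (hin (p, j) n.+1 e).
  by rewrite /= en -/j; case: asboolP => // _; left.
have [l hl no'] : exists2 l : seq (constr * expr),
    (forall q, List.In q l -> List.In q.1 ((p, j) :: chain n)) &
    forall x, exists2 q, List.In q l & ~ inst_at q.1 q.2 x.
  apply: contrapT => hno; apply: no => l hl; apply: contrapT => hx; apply: hno.
  exists l => // x; apply: contrapT => hq; apply: hx; exists x => q hq'.
  by apply: contrapT => hi; apply: hq; exists q.
(* The fresh coordinate [j] becomes the argument of [h]: semantically [upd] stores the value of [a]
   in it, syntactically [rn] moves it to index 0. *)
pose upd (v : nat -> word) a i := if i == j then a else v i.
pose rn i := if i == j then 0 else i.+1.
pose Q w (u : word) (v : nat -> word) := ev w (econs u v) p == [::].
have hQ : EP (fun w v => Q w (v 0) (etl v)).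
  have hp : EX (fun w v => ev w v p) by exists p.
  apply: (ep_ext (ep_not (ep_nonempty hp))) => w v; rewrite negbK /Q.
  by congr (_ == _); apply: ev_ext; case.
have [h hh] := ex_pick [seq eren rn q.2 | q <- l] hQ.
exists h => a.
(* The constraints of the chain do not mention [j], so their instances survive the change of this
   coordinate, with [a] substituted in the instantiating expressions. *)
have US (l' : seq (constr * expr)) : U (fun x : point => forall q, List.In q l' ->
    List.In q.1 (chain n) -> inst_at q.1 q.2 (x.1, upd x.2 (ev x.1 x.2 a))).
  elim: l' => [|q l' IH].
    by apply: filterE => x q [].
  have Uq : U (fun x => List.In q.1 (chain n) ->
      inst_at q.1 q.2 (x.1, upd x.2 (ev x.1 x.2 a))).
    have [hq|nq] := pselect (List.In q.1 (chain n)); last by apply: filterE.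
    have [b1 b2] := jG _ hq.
    pose e' := esubst (fun i => if i == j then a else EVar i) q.2.
    apply: filterS (hin _ _ e' hq) => -[w v] /= hi _; move: hi; rewrite /inst_at /=.
    have -> : upd v (ev w v a) q.1.2 = v q.1.2.
      by rewrite /upd; case: eqP => // e; move: b2; rewrite e ltnn.
    have -> : ev w v e' = ev w (upd v (ev w v a)) q.2.
      by rewrite /e' ev_subst; apply: ev_ext => i; rewrite /upd; case: eqP.
    rewrite (@ev_bound w _ (econs (ev w (upd v (ev w v a)) q.2)
      (econs (v q.1.2) (upd v (ev w v a)))) q.1.1 j.+2) //; first by lia.
    case=> [|[|i]] //= hi; rewrite /upd; case: eqP => // e.
    by move: hi; rewrite e ltnn.
  apply: filterS (filterI IH Uq) => x [h1 h2] q' [<-|] //; exact: h1.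
apply: filterS (US l) => -[w v] hS /=.
(* The instance that fails at the changed point is not one of the chain, hence one of the new
   constraint [p]. *)
have [q hq nq] := no' (w, upd v (ev w v a)).
case: (hl _ hq) => [eq|hc]; last by case: nq; exact: hS hc.
apply/eqP; apply: (hh w (econs (ev w v a) v)).
exists (eren rn q.2); first by apply/List.in_map_iff; exists q.
have -> : ev w (econs (ev w v a) v) (eren rn q.2) = ev w (upd v (ev w v a)) q.2.
  by rewrite ev_ren; apply: ev_ext => i; rewrite /rn /upd; case: eqP.
apply/eqP; apply: contrapT => hne; apply: nq; rewrite /inst_at -eq /=.
have -> : upd v (ev w v a) j = ev w v a by rewrite /upd eqxx.
rewrite (@ev_bound w _ (econs (ev w (upd v (ev w v a)) q.2)
      (econs (ev w v a) v)) p j.+2) //; first by lia.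
case=> [|[|i]] //= hi; rewrite /upd; case: eqP => // e.
by move: hi; rewrite e ltnn.
Qed.

End Saturation.

Lemma sat_ex_subword (M : structure) (r : nat -> M) t A :
  sat r (ex_subword t A) <-> exists x, subw x (tev r t) /\ sat (econs x r) A.
Proof.
rewrite /=; split=> [[x [u]]|[x [[u [h1 h2]] h3]]].
  by rewrite !tev_tlift sat_flift => -[[h1 h2] h3]; exists x; split=> //; exists u.
by exists x, u; rewrite !tev_tlift sat_flift.
Qed.

Lemma sat_all_subword (M : structure) (r : nat -> M) t A :
  sat r (all_subword t A) <-> forall x, subw x (tev r t) -> sat (econs x r) A.
Proof.
rewrite /=; split=> h x.
  move=> [u [h1 h2]]; case: (h x) => // k; case: k; exists u.
  by rewrite !tev_tlift.
have [/h|nx] := pselect (subw x (tev r t)); [by right|left].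
by move=> [u]; rewrite !tev_tlift => -[h1 h2]; apply: nx; exists u.
Qed.

(** * The restricted ultrapower *)

Section Ultrapower.
Local Open Scope classical_set_scope.
Variable U : set_system point.
Hypothesis hU : UltraFilter U.

Definition ae (P : oracle -> (nat -> word) -> Prop) : Prop := U (fun x => P x.1 x.2).

Lemma ae_all (P : oracle -> (nat -> word) -> Prop) : (forall w v, P w v) -> ae P.
Proof. by move=> h; apply: filterE => -[w v]; exact: h. Qed.

Lemma ae_mono (P Q : oracle -> (nat -> word) -> Prop) :
  (forall w v, P w v -> Q w v) -> ae P -> ae Q.
Proof. by move=> h; apply: filterS => -[w v]; exact: h. Qed.

Lemma ae_and (P Q : oracle -> (nat -> word) -> Prop) : ae P -> ae Q ->
  ae (fun w v => P w v /\ Q w v).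
Proof. exact: filterI. Qed.

Lemma ae_mono2 (P Q S : oracle -> (nat -> word) -> Prop) :
  (forall w v, P w v -> Q w v -> S w v) -> ae P -> ae Q -> ae S.
Proof. by move=> h hP hQ; apply: ae_mono (ae_and hP hQ) => w v [/h]; exact. Qed.

Lemma ae_not (P : oracle -> (nat -> word) -> Prop) :
  ~ ae P <-> ae (fun w v => ~ P w v).
Proof.
split=> [nP|h1 h2].
  by have [] := in_ultra_setVsetC (fun x : point => P x.1 x.2) hU.
have [x [h3 h4]] : exists x : point, P x.1 x.2 /\ ~ P x.1 x.2 by apply: filter_ex (filterI h2 h1).
exact: h4.
Qed.

Lemma ae_contra (P : oracle -> (nat -> word) -> Prop) :
  (forall w v, ~ P w v) -> ~ ae P.
Proof. by move=> h; apply/ae_not; exact: ae_all. Qed.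

Lemma ae_or (P Q : oracle -> (nat -> word) -> Prop) :
  ae (fun w v => P w v \/ Q w v) <-> ae P \/ ae Q.
Proof.
split=> [h|[]]; last 2 first.
- by apply: ae_mono => w v; left.
- by apply: ae_mono => w v; right.
apply: contrapT => /not_orP[/ae_not h1 /ae_not h2].
by apply: ae_contra (ae_and (ae_and h1 h2) h) => w v [[nP nQ] []].
Qed.

Definition um : structure.
Proof.
refine (@Structure expr EEps EBit ECat ETimes
  (fun e e' => ae (fun w v => prefix (ev w v e) (ev w v e')))
  (fun e => ae (fun w v => w (ev w v e) = true))
  (fun e e' => ae (fun w v => ev w v e = ev w v e')) _ _ _ _ _ _ _).
- by move=> x; exact: ae_all.
- by move=> x y; apply: ae_mono => w v ->.
- by move=> x y z; apply: ae_mono2 => w v -> ->.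
- by move=> x x' y y'; apply: ae_mono2 => w v /= -> ->.
- by move=> x x' y y'; apply: ae_mono2 => w v /= -> ->.
- by move=> x x' y y' h1 h2; apply: ae_mono2 (ae_and h1 h2) => w v [-> ->].
- by move=> x x'; apply: ae_mono2 => w v ->.
Defined.

Definition evr (r : nat -> um) w v (n : nat) : word := ev w v (r n).

Lemma ev_tev (r : nat -> um) w v t : ev w v (tev r t) = teval (evr r w v) t.
Proof. by elim: t => //= [t -> s ->|t -> s ->]. Qed.

Lemma evr_econs (x : um) r w v : evr (econs x r) w v =1 scons (ev w v x) (evr r w v).
Proof. by case. Qed.

(** [subw] in the ultrapower also asks for an element that gives, at almost every point, the word
    before the occurrence; a search provides it. *)
Lemma um_infix (x t : expr) : ae (fun w v => einfix (ev w v x) (ev w v t)) ->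
  exists u, ae (fun w v => prefix (ev w v u) (ev w v t)) /\
            ae (fun w v => prefix (ev w v u ++ ev w v x) (ev w v t)).
Proof.
have hq : EP (fun w v => prefix (v 0) (etl v 1) && prefix (v 0 ++ etl v 0) (etl v 1)).
  by apply: ep_and; apply: ep_prefix; try exact: ex_var; apply: ex_cat; exact: ex_var.
have [g [[e he] g1 g2]] := @ex_search _ (fun w u v => prefix u (v 1) && prefix (u ++ v 0) (v 1))
  (ex_var 1) hq.
move=> h; exists (esubst (fun i => if i is 0 then x else t) e).
have hh w v : einfix (ev w v x) (ev w v t) ->
    prefix (ev w v (esubst (fun i => if i is 0 then x else t) e)) (ev w v t) &&
    prefix (ev w v (esubst (fun i => if i is 0 then x else t) e) ++ ev w v x) (ev w v t).
  move=> /einfixP[u [h1 h2]]; rewrite ev_subst he.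
  apply: (g2 w (fun i => ev w v (if i is 0 then x else t)) u); last by rewrite h1.
  by apply/einfixP; exists [::]; rewrite prefix0s.
by split; apply: ae_mono h => w v /hh/andP[].
Qed.

(** For a subword quantifier, [ex_search] returns one feasible function of the point, which is an
    element of the structure; pointwise truth thereby becomes truth at an element. *)
Lemma los F (r : nat -> um) : subword_bounded F ->
  sat r F <-> ae (fun w v => holds w (evr r w v) F).
Proof.
move=> hF; elim: hF r => {F} [t|t s|t s|A _ IA|A B _ IA _ IB|A B _ IA _ IB|t A hA IA|t A hA IA] r.
- by split; apply: ae_mono => w v; rewrite /= ev_tev.
- by split; apply: ae_mono => w v; rewrite /= !ev_tev.
- by split; apply: ae_mono => w v; rewrite /= !ev_tev.
- by rewrite /= IA ae_not.
- rewrite /= IA IB; split=> [[]|h]; first exact: ae_and.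
  by split; apply: ae_mono h => w v [].
- by rewrite /= IA IB ae_or.
- rewrite sat_ex_subword; split=> [[x [[u [h1 h2]] /IA h3]]|h].
    apply: ae_mono2 (ae_and h1 h2) h3 => w v [k1 k2] k3.
    apply/holds_ex_subword; exists (ev w v x); split.
      by apply/einfixP; exists (ev w v u); move: k1 k2; rewrite /= !ev_tev.
    exact: (@holds_ext w _ _ A (evr_econs x r w v)).1 k3.
  have [g [[e he] g1 g2]] := @ex_search _ (fun w x v => holdsb w (scons x v) A)
    (ex_term t) (ep_scons (ep_sw hA)).
  pose x : um := esubst r e.
  have xE w v : ev w v x = g w (evr r w v) by rewrite /x ev_subst he.
  have hx : ae (fun w v => einfix (ev w v x) (ev w v (tev r t))).
    by apply: ae_all => w v; rewrite xE ev_tev; exact: g1.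
  have [u [hu1 hu2]] := um_infix hx.
  exists x; split; first by exists u.
  apply/IA; apply: ae_mono h => w v /holds_ex_subword[y [hy /holdsP hyA]].
  have /holdsP := g2 w _ y hy hyA; rewrite -xE.
  exact: (@holds_ext w _ _ A (evr_econs x r w v)).2.
- rewrite sat_all_subword; split=> [h|h x [u [k1 k2]]].
    apply: contrapT => /ae_not hn.
    have [g [[e he] g1 g2]] := @ex_search _ (fun w x v => ~~ holdsb w (scons x v) A)
      (ex_term t) (ep_not (ep_scons (ep_sw hA))).
    pose x : um := esubst r e.
    have xE w v : ev w v x = g w (evr r w v) by rewrite /x ev_subst he.
    have hx : ae (fun w v => einfix (ev w v x) (ev w v (tev r t))).
      by apply: ae_all => w v; rewrite xE ev_tev; exact: g1.
    have [u [hu1 hu2]] := um_infix hx.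
    have /IA k : sat (econs x r) A by apply: h; exists u.
    have : ae (fun w v => ~ holds w (evr (econs x r) w v) A); last by move=> /ae_not.
    apply: ae_mono hn => w v; rewrite holds_all_subword => /existsNP[y /not_implyP[hy nA]].
    have /negP := g2 w _ y hy (introN (holdsP _ _ _) nA); rewrite -xE => k' k''; apply: k'.
    by apply/holdsP; exact: (@holds_ext w _ _ A (evr_econs x r w v)).1 k''.
  apply/IA; apply: ae_mono2 h (ae_and k1 k2) => w v /holds_all_subword hh [k1' k2'].
  have /hh : einfix (ev w v x) (teval (evr r w v) t).
    by apply/einfixP; exists (ev w v u); move: k1' k2'; rewrite /= !ev_tev.
  exact: (@holds_ext w _ _ A (evr_econs x r w v)).2.
Qed.

(** The right side asks for one expression; the mere existence of a witness at each point would not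
    give an element of the structure. *)
Lemma los_wit B W (r : nat -> um) : is_wit B W ->
  sat r B <-> exists e, ae (fun w v => wit_rel W w (ev w v e) (evr r w v)).
Proof.
move=> h; elim: h r => {B W} [F hF|t A W _ IH] r.
  rewrite (los _ hF); split=> [h|[e h]].
    by exists EEps; apply: ae_mono h => w v h; rewrite wit_baseE eqxx; apply/holdsP.
  by apply: ae_mono h => w v; rewrite wit_baseE => /andP[_ /holdsP].
split=> [[x [hx /IH[e he]]]|[z hz]].
  have hpr : EX (fun w v => pr (v 0) (v 1)) by apply: ex_pr; exact: ex_var.
  have [p hp] := hpr; exists (esubst (fun i => if i is 0 then x else e) p).
  apply: ae_mono2 hx he => w v; rewrite wit_exE ev_subst hp pr1E pr2E eqxx /= ev_tev.
  rewrite (teval_ext _ (evr_econs _ _ _ _)) (holds_tlift w) std_ones_le => -> /=.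
  by rewrite (@wit_ext W w _ _ (econs (ev w v x) (evr r w v))) //; case.
have hp1 : EX (fun w v => pr1 w (v 0)) by apply: ex_pr1; exact: ex_var.
have hp2 : EX (fun w v => pr2 w (v 0)) by apply: ex_pr2; exact: ex_var.
have [p1 e1] := hp1; have [p2 e2] := hp2.
exists (esubst (fun=> z) p1); split.
  apply: ae_mono hz => w v; rewrite wit_exE => /and3P[_ k _] /=; rewrite ev_tev.
  by rewrite (teval_ext _ (evr_econs _ _ _ _)) (holds_tlift w) std_ones_le ev_subst e1.
apply/IH; exists (esubst (fun=> z) p2); apply: ae_mono hz => w v.
rewrite wit_exE => /and3P[_ _]; rewrite ev_subst e2.
by rewrite (@wit_ext W w _ _ (evr (econs (esubst (fun=> z) p1 : um) r) w v)) //;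
  case=> //=; rewrite /evr /= ev_subst e1.
Qed.

Hypothesis sat_herbrand : forall p : expr,
    (exists c, forall e, ae (fun w v =>
      ev w (econs (ev w v e) (econs (ev w v c) v)) p <> [::])) \/
    (exists h, forall a, ae (fun w v =>
      ev w (econs (ev w (econs (ev w v a) v) h) (econs (ev w v a) v)) p = [::])).

(* The induction step has a feasible witness [h] by saturation; iterating it by
   recursion on notation yields a witness for all words, and a failure of the
   latter would be located at a feasible prefix. *)
Lemma um_induction B W (r : nat -> um) : is_wit B W ->
  sat (econs (EEps : um) r) B ->
  (forall (x : um) b, sat (econs x r) B -> sat (econs (ECat x (EBit b) : um) r) B) ->
  forall x : um, sat (econs x r) B.
Proof.
move=> hW /(los_wit _ hW)[e0 he0] hS X.
pose D w (z x : word) v := wit_rel W w z (econs x (evr r w v)).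
have hr i : EX (fun w v => evr r w v i) by exists (r i).
have hD fz fx (k : nat) : EX fz -> EX fx ->
    EP (fun w v => D w (fz w v) (fx w v) (fun i => v (k + i))).
  move=> hz hx; apply: (ep_ext (ep_subst (g := fun i w v => match i with
      | 0 => fz w v | 1 => fx w v | j.+2 => evr r w (fun i => v (k + i)) j end)
      (wit_ep W) _)).
    by case=> [|[|i]] //; exact: (ex_wk k (hr i)).
  by move=> w v; apply: wit_ext; case.
(* [p] says that [v 1] codes a word with a witness and that [v 0] is no witness for this word
   followed by [b]. An element [c] for which this holds whatever [v 0] would contradict the
   induction step [hS]; the other alternative is a feasible [h]. *)
have hstep b : exists h, forall a, ae (fun w v =>
    D w (pr2 w (ev w v a)) (pr1 w (ev w v a)) v ->
    D w (ev w (econs (ev w v a) v) h) (pr1 w (ev w v a) ++ [:: b]) v).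
  have hp : EP (fun w v => D w (pr2 w (v 1)) (pr1 w (v 1)) (fun i => v (2 + i)) &&
     ~~ D w (v 0) (pr1 w (v 1) ++ [:: b]) (fun i => v (2 + i))).
    apply: ep_and; first by apply: hD; [apply: ex_pr2|apply: ex_pr1]; exact: ex_var.
    apply: ep_not; apply: hD; first exact: ex_var.
    by apply: ex_cat; [apply: ex_pr1; exact: ex_var|exact: ex_const].
  have [p pE] := hp; case: (sat_herbrand p) => [[c hc]|[h hh]]; last first.
    exists h => a; apply: ae_mono (hh a) => w v /eqP; rewrite -[_ == _]negbK pE /=.
    by rewrite negb_and negbK => /orP[/negP//|].
  have [p1 e1] : EX (fun w v => pr1 w (v 0)) by apply: ex_pr1; exact: ex_var.
  have [p2 e2] : EX (fun w v => pr2 w (v 0)) by apply: ex_pr2; exact: ex_var.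
  have /(los_wit _ hW)[e he] : sat (econs (ECat (esubst (fun=> c) p1) (EBit b) : um) r) B.
    apply: hS; apply/(los_wit _ hW); exists (esubst (fun=> c) p2).
    apply: ae_mono (hc EEps) => w v /eqP; rewrite pE => /andP[h _]; move: h.
    rewrite /D ev_subst e2 (@wit_ext W w _ _ (evr (econs (esubst (fun=> c) p1 : um) r) w v)) //.
    by case=> //=; rewrite /evr /= ev_subst e1.
  have : ~ ae (fun w v => False) by apply: ae_contra => w v.
  case; apply: ae_mono2 he (hc e) => w v h /eqP; rewrite pE => /andP[_ /negP]; apply.
  move: h; rewrite /D (@wit_ext W w _ _ (econs (pr1 w (ev w v c) ++ [:: b]) (evr r w v))) //.
  by case=> //=; rewrite /evr /= ev_subst e1.
have [h0 hh0] := hstep false; have [h1 hh1] := hstep true.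
pose hb (b : bool) := if b then h1 else h0.
have hhb b a : ae (fun w v => D w (pr2 w (ev w v a)) (pr1 w (ev w v a)) v ->
    D w (ev w (econs (ev w v a) v) (hb b)) (pr1 w (ev w v a) ++ [:: b]) v).
  by case: b; [exact: hh1|exact: hh0].
pose stp b w (x k : word) v := ev w (econs (pr x k) v) (hb b).
(* A candidate that is not a witness is replaced by the empty word; so every value of [K] is empty
   or a witness, and [wit_size] bounds it as [ex_rec] requires. *)
pose K w v (x : word) : word := (foldl (fun a b =>
   (rcons a.1 b, if D w (stp b w a.1 a.2 v) (rcons a.1 b) v then stp b w a.1 a.2 v else [::]))
   ([::], if D w (ev w v e0) [::] v then ev w v e0 else [::]) x).2.
have K1 w v x : (foldl (fun a b =>
   (rcons a.1 b, if D w (stp b w a.1 a.2 v) (rcons a.1 b) v then stp b w a.1 a.2 v else [::]))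
   ([::], if D w (ev w v e0) [::] v then ev w v e0 else [::]) x).1 = x.
  by elim/last_ind: x => // x b IH; rewrite foldl_rcons /= IH.
have K0 w v : K w v [::] = if D w (ev w v e0) [::] v then ev w v e0 else [::] by [].
have KS w v x b : K w v (rcons x b) = if D w (stp b w x (K w v x) v) (rcons x b) v
    then stp b w x (K w v x) v else [::].
  by rewrite /K foldl_rcons /= K1.
have Kbound w v x X' : prefix x X' ->
    (size (K w v x) <= size (teval (econs X' (evr r w v)) (wit_bound W)))%N.
  move=> hx; have : K w v x = [::] \/ D w (K w v x) x v.
    case/lastP: x hx => [|x b] _; rewrite ?K0 ?KS; case: ifP; by [left|right].
  case=> [->//|/wit_size h]; apply: leq_trans h _; apply: size_teval_mono.
  by case=> //=; exact: size_prefix.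
have hK fx (k : nat) : EX fx -> EX (fun w v => K w (fun i => v (k + i)) (fx w v)).
  move=> hx; have he (e : expr) (j : nat) : EX (fun w v => ev w (fun i => v (j + i)) e).
    by have he' : EX (fun w v => ev w v e) by [exists e]; exact: (ex_wk j he').
  apply: (@ex_rec (fun w v x => K w (fun i => v (k + i)) x) fx
    (fun w v => if D w (ev w (fun i => v (k + i)) e0) [::] (fun i => v (k + i))
                then ev w (fun i => v (k + i)) e0 else [::])
    (fun b w x a v => if D w (stp b w x a (fun i => v (k + i))) (x ++ [:: b]) (fun i => v (k + i))
      then stp b w x a (fun i => v (k + i)) else [::])
    (fun w v => teval (econs (fx w v) (evr r w (fun i => v (k + i)))) (wit_bound W))) => //.
  - apply: ex_if => //; last exact: ex_const.
    by apply: hD => //; exact: ex_const.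
  - move=> b; have hs : EX (fun w v => stp b w (v 0) (v 1) (fun i => v (k.+2 + i))).
      have hb' : EX (fun w v => ev w v (hb b)) by exists (hb b).
      apply: (ex_ext (ex_subst (g := fun i w v => if i is j.+1 then v (k.+2 + j)
        else pr (v 0) (v 1)) hb' _)).
        by case=> [|i]; [apply: ex_pr|]; exact: ex_var.
      by move=> w v; apply: ev_ext; case.
    apply: ex_if => //; last exact: ex_const.
    by apply: (hD _ _ k.+2) => //; apply: ex_cat; [exact: ex_var|exact: ex_const].
  - apply: (ex_ext (ex_subst (g := fun i w v => if i is j.+1 then evr r w (fun i => v (k + i)) j
       else fx w v) (ex_term (wit_bound W)) _)).
      by case=> [|i] //; exact: (ex_wk k (hr i)).
    by move=> w v; apply: teval_ext; case.
  - by move=> w v p b; rewrite KS cats1.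
  - by move=> w v p hp; exact: Kbound.
(* [L] stops before the first prefix at which [K] is no witness, and so locates a failure
   feasibly. *)
pose L w v (x : word) : word := (foldl (fun a b =>
   (rcons a.1 b, if (a.2 == a.1) && D w (K w v (rcons a.1 b)) (rcons a.1 b) v
      then rcons a.1 b else a.2)) ([::], [::]) x).2.
have L1 w v x : (foldl (fun a b =>
   (rcons a.1 b, if (a.2 == a.1) && D w (K w v (rcons a.1 b)) (rcons a.1 b) v
      then rcons a.1 b else a.2)) ([::] : word, [::] : word) x).1 = x.
  by elim/last_ind: x => // x b IH; rewrite foldl_rcons /= IH.
have LS w v x b : L w v (rcons x b) =
    if (L w v x == x) && D w (K w v (rcons x b)) (rcons x b) v then rcons x b else L w v x.
  by rewrite /L foldl_rcons /= L1.
have Lprop w v x : D w (K w v [::]) [::] v ->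
    (L w v x = x /\ D w (K w v x) x v) \/ exists b, [/\ prefix (rcons (L w v x) b) x,
      D w (K w v (L w v x)) (L w v x) v & ~~ D w (K w v (rcons (L w v x) b)) (rcons (L w v x) b) v].
  move=> hD0; elim/last_ind: x => [|x b IH]; first by left.
  rewrite LS; case: eqP IH => [e|ne] [[h1' h2]|[b' [h1' h2 h3]]] //=.
  - case: ifP => hd; [by left|right]; exists b; rewrite e; split=> //.
      exact: prefix_refl.
    by rewrite hd.
  - by move: h1'; rewrite e => /size_prefix; rewrite size_rcons ltnn.
  - right; exists b'; split=> //; apply: prefix_trans h1' _; exact: prefix_rcons.
have [kX kXE] : EX (fun w v => K w v (ev w v X)) by apply: (hK _ 0); exists X.
apply/(los_wit _ hW); exists kX; apply: contrapT => /ae_not hn.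
have hL : EX (fun w v => L w v (ev w v X)).
  apply: (@ex_rec L (fun w v => ev w v X) (fun w v => [::])
    (fun b w x a v => if (a == x) && D w (K w v (x ++ [:: b])) (x ++ [:: b]) v
       then x ++ [:: b] else a) (fun w v => ev w v X)) => //.
  - by exists X.
  - exact: ex_const.
  - move=> b; have hxb : EX (fun w v => v 0 ++ [:: b]).
      by apply: ex_cat; [exact: ex_var|exact: ex_const].
    apply: ex_if => //; last exact: ex_var.
    apply: ep_and; first by apply: ep_eq; exact: ex_var.
    by apply: (hD _ _ 2) => //; exact: (hK _ 2).
  - by exists X.
  - by move=> w v p b; rewrite LS cats1.
  - move=> w v p hp; apply: leq_trans (size_prefix hp).
    by elim/last_ind: (p) => // p' b IH; rewrite LS; case: ifP => // _;
      rewrite size_rcons; exact: leqW.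
have [l lE] := hL.
(* The element at which the step fails; [hhb] at [a] asserts that it succeeds. *)
have [a aE] : EX (fun w v => pr (L w v (ev w v X)) (K w v (L w v (ev w v X)))).
  by apply: ex_pr => //; exact: (hK _ 0).
have bad : ae (fun w v => exists b, D w (K w v (L w v (ev w v X))) (L w v (ev w v X)) v /\
    ~~ D w (K w v (rcons (L w v (ev w v X)) b)) (rcons (L w v (ev w v X)) b) v).
  apply: ae_mono2 he0 hn => w v k1 k2.
  have kD : D w (ev w v e0) [::] v.
    by move: k1; rewrite /D; rewrite (@wit_ext W w _ _ (econs [::] (evr r w v))) //; case.
  have : D w (K w v [::]) [::] v by rewrite K0 kD.
  move=> /(Lprop w v (ev w v X))[[_ k3]|[b [_ k3 k4]]]; last by exists b.
  case: k2; rewrite kXE; move: k3; rewrite /D.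
  by rewrite (@wit_ext W w _ _ (evr (econs X r) w v)) //; case.
have no b : ~ ae (fun w v => D w (K w v (L w v (ev w v X))) (L w v (ev w v X)) v /\
    ~~ D w (K w v (rcons (L w v (ev w v X)) b)) (rcons (L w v (ev w v X)) b) v).
  move=> hb'; have := ae_and hb' (hhb b a); apply: ae_contra => w v [[k1 k2]].
  rewrite aE pr1E pr2E => /(_ k1); rewrite cats1 => k3.
  by move: k2; rewrite KS /stp k3 k3.
(* The failing bit varies with the point; the ultrafilter selects one of the two. *)
have : ae (fun w v => (D w (K w v (L w v (ev w v X))) (L w v (ev w v X)) v /\
    ~~ D w (K w v (rcons (L w v (ev w v X)) true)) (rcons (L w v (ev w v X)) true) v) \/
    (D w (K w v (L w v (ev w v X))) (L w v (ev w v X)) v /\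
    ~~ D w (K w v (rcons (L w v (ev w v X)) false)) (rcons (L w v (ev w v X)) false) v)).
  by apply: ae_mono bad => w v [[] h]; [left|right].
by move=> /ae_or[]; exact: no.
Qed.

(** The axioms other than induction are free of unbounded quantifiers and true at every point by
    [std_model], so [los] transfers them. *)
Lemma um_model A (r : nat -> um) : NIA A -> sat r A.
Proof.
have open F : subword_bounded F -> NIA F -> sat r F.
  move=> hF hN; apply/los => //; apply: ae_all => w v; apply/holds_std.
  exact: (std_model w).2.
case=> [x|b x y|x|b x y|x|b x y|b x y|x y|b x|B x hB].
- by apply: open; constructor.
- by apply: open; constructor.
- by apply: open; constructor.
- by apply: open; constructor.
- by apply: open; repeat constructor.
- by apply: open; repeat constructor.
- by apply: open; repeat constructor.
- by apply: open; repeat constructor.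
- by apply: open; repeat constructor.
have [W hW] := sigma_wit hB.
have [h|nh] := pselect (sat r (FAnd (inst TEps B) (FAll (FImp B
   (FAnd (repl (snoc (TVar 0) false) B) (repl (snoc (TVar 0) true) B)))))); last by left.
right=> X; case: h => h0 hS; apply: (um_induction hW); first by move/sat_inst : h0.
move=> y b hy; case: (hS y) => // -[k0 k1].
have : sat (econs y r) (repl (snoc (TVar 0) b) B) by case: b.
by rewrite /repl sat_subst; apply: (sat_ext _ _).1; case.
Qed.

End Ultrapower.

Theorem witnessing G k : Sigma1b G -> proves NIA [::] (iter k FAll (ex_unique G)) ->
  exists e, forall w v, holds w (scons (ev w v e) v) G.
Proof.
move=> hG hpr; have [W hW] := sigma_wit hG.
pose D w (u : word) v := wit_rel W w (pr2 w u) (econs (pr1 w u) v).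
have hD k' fu : EX fu -> EP (fun w v => D w (fu w v) (fun i => v (k' + i))).
  move=> hu; apply: (ep_ext (ep_subst (g := fun i w v => match i with
      | 0 => pr2 w (fu w v) | 1 => pr1 w (fu w v) | j.+2 => v (k' + j) end) (wit_ep W) _)).
    by case=> [|[|i]]; [apply: ex_pr2|apply: ex_pr1|exact: ex_var].
  by move=> w v; apply: wit_ext; case.
suff [e he] : exists e, forall w v, D w (ev w v e) v.
  have [y hy] : EX (fun w v => pr1 w (ev w v e)) by apply: ex_pr1; exists e.
  exists y => w v; apply/(wit_holds _ _ hW); exists (pr2 w (ev w v e)).
  by move: (he w v); rewrite /D (@wit_ext W w _ _ (scons (ev w v y) v)) //; case; rewrite ?hy.
apply: contrapT => none.
have [p pE] : EP (fun w v => ~~ D w (v 0) (fun i => v (2 + i))).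
  by apply: ep_not; apply: hD; exact: ex_var.
(* Were finitely many expressions to cover all points with witnesses, [ex_pick] would combine them
   into one, against [none]. *)
have fip0 : fip [:: (p, 0)].
  move=> l hl; apply: contrapT => hx; apply: none.
  have hD1 : EP (fun w v => D w (v 0) (etl v)) by apply: (hD 1); exact: ex_var.
  have [h hh] := ex_pick [seq q.2 | q <- l] hD1; exists h => w v; apply: hh.
  apply: contrapT => hn; apply: hx; exists (w, v) => q hq.
  case: (hl _ hq) => // eq; rewrite /inst_at -eq /=; apply/eqP; rewrite pE /=.
  apply/negP => hDq; apply: hn; exists q.2 => //.
  by apply/List.in_map_iff; exists q.
have [U [hU [hc hh]]] := saturated_filter fip0.
(* With the environment shifted by [k], instantiating the [k] quantifiers by the first coordinates
   restores the identity environment [EVar], to which the constraint refers. *)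
have hs : sat (M := um hU) (fun n => EVar (n + k)) (iter k FAll (ex_unique G)).
  by apply: (soundness _ hpr) => // B r; exact: um_model.
have : sat (M := um hU) EVar (ex_unique G).
  elim: k {hpr} hs => [|k' IH].
    by apply: (sat_ext _ _).1 => n; rewrite addn0.
  rewrite iterS => /(_ (EVar k')) h; apply: IH; move: h.
  by apply: (sat_ext _ _).1 => -[|n] /=; rewrite ?add0n // addSnnS.
move=> [y [/(los_wit _ hW)[e he] _]].
have [u uE] : EX (fun w v => pr (ev w v y) (ev w v e)).
  by apply: ex_pr; [exists y|exists e].
have : ~ ae U (fun w v => False) by apply: ae_contra => // w v.
case; have hcu : ae U (fun w v => ev w (econs (ev w v u) (econs (v 0) v)) p <> [::]) := hc u.
apply: ae_mono2 he hcu => // w v k1 /eqP.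
rewrite pE /= uE /D pr1E pr2E => /negP; apply; move: k1.
by rewrite (@wit_ext W w _ _ (econs (ev w v y) v)) //; case.
Qed.

(** * Lazy sampling of the oracle *)

Fixpoint dbind (I S T : Type) (t : dtree I S) (f : S -> dtree I T) : dtree I T :=
  match t with DLeaf a => f a | DNode i k => DNode i (fun b => dbind (k b) f) end.

Lemma drun_bind (I S T : Type) (w : I -> bool) (t : dtree I S) (f : S -> dtree I T) :
  drun w (dbind t f) = drun w (f (drun w t)).
Proof. by elim: t => //= i k IH; rewrite IH. Qed.

Fixpoint dall (I T : Type) (P : T -> Prop) (Q : I -> Prop) (t : dtree I T) : Prop :=
  match t with DLeaf a => P a | DNode i k => Q i /\ forall b, dall P Q (k b) end.

Fixpoint dle (I T : Type) (n : nat) (t : dtree I T) : Prop :=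
  if t is DNode i k then (0 < n)%N /\ forall b, dle n.-1 (k b) else True.

Lemma dall_bind (I S T : Type) P P' Q (t : dtree I S) (f : S -> dtree I T) :
  dall P Q t -> (forall a, P a -> dall P' Q (f a)) -> dall P' Q (dbind t f).
Proof.
move=> + h; elim: t => [a /h //|i k IH] /= [hi hk]; split=> // b; exact: IH.
Qed.

Lemma dall_mono (I T : Type) (P P' : T -> Prop) (Q Q' : I -> Prop) (t : dtree I T) :
  (forall a, P a -> P' a) -> (forall i, Q i -> Q' i) -> dall P Q t -> dall P' Q' t.
Proof.
move=> h h'; elim: t => [a /h //|i k IH] /= [/h' hi hk]; split=> // b; exact: IH.
Qed.

Lemma dall_run (I T : Type) P Q (t : dtree I T) w : dall P Q t -> P (drun w t).
Proof. by elim: t => //= i k IH [_ hk]; exact: IH. Qed.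

Lemma dle_mono (I T : Type) n m (t : dtree I T) : (n <= m)%N -> dle n t -> dle m t.
Proof.
elim: t n m => //= i k IH n m nm [h hk]; split; first by lia.
by move=> b; apply: IH (hk b); lia.
Qed.

Lemma dle_bind (I S T : Type) n m P Q (t : dtree I S) (f : S -> dtree I T) :
  dle n t -> dall P Q t -> (forall a, P a -> dle m (f a)) -> dle (n + m) (dbind t f).
Proof.
move=> + + h; elim: t n => [a n _ /h|i k IH n] /=.
  by apply: dle_mono; exact: leq_addl.
move=> [n0 hk] [_ hk']; split; first by lia.
by move=> b; have -> : (n + m).-1 = (n.-1 + m)%N by [lia]; exact: IH.
Qed.

Fixpoint qrec (b : nat) (h : bool -> word -> word -> dtree word word) (pa : word * word)
    (x : word) : dtree word word :=
  if x is c :: x' then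
    dbind (h c pa.1 pa.2) (fun r => qrec b h (rcons pa.1 c, take b r) x')
  else DLeaf pa.2.

(** The evaluation of [e] as a decision tree: each oracle query is a node, so the tree depends on
    the valuation alone. *)
Fixpoint qt (v : nat -> word) (e : expr) : dtree word word :=
  match e with
  | EVar i => DLeaf (v i)
  | EEps => DLeaf [::]
  | EBit b => DLeaf [:: b]
  | ECat e1 e2 => dbind (qt v e1) (fun a => dbind (qt v e2) (fun b => DLeaf (a ++ b)))
  | ETimes e1 e2 => dbind (qt v e1) (fun a => dbind (qt v e2) (fun b =>
      DLeaf (flatten (nseq (size b) a))))
  | EFlip e1 => dbind (qt v e1) (fun a => DNode a (fun b => DLeaf (if b then [:: true] else [::])))
  | ERec x z s0 s1 B => dbind (qt v x) (fun ax => dbind (qt v z) (fun az => dbind (qt v B) (fun aB =>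
      qrec (size aB) (fun c p a => if c then qt (econs p (econs a v)) s1
                                   else qt (econs p (econs a v)) s0)
        ([::], take (size aB) az) ax)))
  end.

Lemma drun_qrec w b h g pa x : (forall c p a, drun w (h c p a) = g c p a) ->
  drun w (qrec b h pa x) = (nrec_pair b g pa x).2.
Proof. by move=> e; elim: x pa => //= c x IH pa; rewrite drun_bind IH e. Qed.

Lemma drun_qt w v e : drun w (qt v e) = ev w v e.
Proof.
elim: e v => //= [e1 IH1 e2 IH2|e1 IH1 e2 IH2|e1 IH1|x IHx z IHz s0 IH0 s1 IH1 B IHB] v;
  rewrite !drun_bind /= ?drun_bind ?IH1 ?IH2 //=.
rewrite IHx IHz IHB; apply: drun_qrec => c p a; by case: c; rewrite ?IH0 ?IH1.
Qed.

(** Terms are monotone in lengths, so in a recursion the bounds of the step functions may be taken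
    at the bound [Lx] of the prefix and the bound [LB] of the value. [L], [N] and [D] concern the
    value, each query, and the number of queries on a branch, whatever the answers. *)
Lemma qt_bound e : exists L N D : term, forall v,
  dall (fun a => size a <= size (teval v L))%N (fun q => size q <= size (teval v N))%N (qt v e) /\
  dle (size (teval v D)) (qt v e).
Proof.
elim: e => [i||b|e1 [L1 [N1 [D1 h1]]] e2 [L2 [N2 [D2 h2]]]|e1 [L1 [N1 [D1 h1]]] e2 [L2 [N2 [D2 h2]]]
  |e1 [L1 [N1 [D1 h1]]]|x [Lx [Nx [Dx hx]]] z [Lz [Nz [Dz hz]]] s0 [L0 [N0 [D0 h0]]]
   s1 [L1 [N1 [D1 h1]]] B [LB [NB [DB hB]]]].
- by exists (TVar i), TEps, TEps => v; split=> /=.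
- by exists TEps, TEps, TEps => v; split=> /=.
- by exists (TBit true), TEps, TEps => v; split=> /=.
- exists (TCat L1 L2), (TCat N1 N2), (TCat D1 D2) => v.
  have [a1 b1] := h1 v; have [a2 b2] := h2 v; split=> /=.
    apply: (dall_bind (P := fun a => size a <= size (teval v L1))%N).
      by apply: dall_mono a1 => // q; rewrite size_cat; lia.
    move=> a ha; apply: (dall_bind (P := fun a => size a <= size (teval v L2))%N).
      by apply: dall_mono a2 => // q; rewrite size_cat; lia.
    by move=> a' ha' /=; rewrite !size_cat; exact: leq_add.
  rewrite size_cat; apply: (dle_bind b1 a1) => a ha.
  by rewrite -[size _]addn0; apply: (dle_bind b2 a2).
- exists (TTimes L1 L2), (TCat N1 N2), (TCat D1 D2) => v.
  have [a1 b1] := h1 v; have [a2 b2] := h2 v; split=> /=.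
    apply: (dall_bind (P := fun a => size a <= size (teval v L1))%N).
      by apply: dall_mono a1 => // q; rewrite size_cat; lia.
    move=> a ha; apply: (dall_bind (P := fun a => size a <= size (teval v L2))%N).
      by apply: dall_mono a2 => // q; rewrite size_cat; lia.
    move=> a' ha' /=; rewrite !size_flatten /shape !map_nseq !sumn_nseq; exact: leq_mul.
  rewrite size_cat; apply: (dle_bind b1 a1) => a ha.
  by rewrite -[size _]addn0; apply: (dle_bind b2 a2).
- exists (TBit true), (TCat N1 L1), (TCat D1 (TBit true)) => v.
  have [a1 b1] := h1 v; split=> /=.
    apply: (dall_bind (P := fun a => size a <= size (teval v L1))%N).
      by apply: dall_mono a1 => // q; rewrite size_cat; lia.
    by move=> a ha /=; split; [rewrite size_cat; lia|case].
  by rewrite size_cat; apply: (dle_bind b1 a1).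
pose sb (n : nat) : term := match n with 0 => Lx | 1 => LB | m.+2 => TVar m end.
pose Ns := tsubst sb (TCat N0 N1); pose Ds := tsubst sb (TCat D0 D1).
exists LB, (TCat (TCat Nx Nz) (TCat NB Ns)), (TCat (TCat Dx Dz) (TCat DB (TTimes Ds Lx))) => v.
have [ax bx] := hx v; have [az bz] := hz v; have [aB bB] := hB v.
have hs c p a : (size p <= size (teval v Lx))%N -> (size a <= size (teval v LB))%N ->
    dall (fun=> True) (fun q => size q <= size (teval v Ns))%N
      (if c then qt (econs p (econs a v)) s1 else qt (econs p (econs a v)) s0) /\
    dle (size (teval v Ds)) (if c then qt (econs p (econs a v)) s1 else qt (econs p (econs a v)) s0).
  move=> hp ha.
  have mono t : (size (teval (econs p (econs a v)) t) <= size (teval v (tsubst sb t)))%N.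
    by rewrite teval_subst; apply: size_teval_mono => -[|[|i]].
  have [a0 b0] := h0 (econs p (econs a v)); have [a1 b1] := h1 (econs p (econs a v)).
  have m0 := mono N0; have m1 := mono N1; have m0' := mono D0; have m1' := mono D1.
  case: c; split.
  + apply: dall_mono a1 => // q hq; apply: leq_trans hq _; rewrite /Ns /= size_cat; lia.
  + by apply: dle_mono b1; apply: leq_trans m1' _; rewrite /Ds /= size_cat leq_addl.
  + apply: dall_mono a0 => // q hq; apply: leq_trans hq _; rewrite /Ns /= size_cat; lia.
  + by apply: dle_mono b0; apply: leq_trans m0' _; rewrite /Ds /= size_cat leq_addr.
pose h c p a := if c then qt (econs p (econs a v)) s1 else qt (econs p (econs a v)) s0.
have hrec b pa y : (b <= size (teval v LB))%N -> (size pa.2 <= b)%N ->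
    (size pa.1 + size y <= size (teval v Lx))%N ->
    dall (fun a => size a <= b)%N (fun q => size q <= size (teval v Ns))%N (qrec b h pa y) /\
    dle (size y * size (teval v Ds)) (qrec b h pa y).
  move=> hb; elim: y pa => [|c y IH] pa h2 /=; first by move=> _.
  move=> h3; have [k1 k2] := hs c pa.1 pa.2 ltac:(lia) ltac:(lia).
  have tk (r : word) : (size (rcons pa.1 c, take b r).2 <= b)%N by rewrite size_take_min geq_minl.
  have sz (r : word) : (size (rcons pa.1 c, take b r).1 + size y <= size (teval v Lx))%N.
    by rewrite /= size_rcons; lia.
  split.
    by apply: (dall_bind k1) => r _; have [] := IH _ (tk r) (sz r).
  by rewrite mulSn; apply: (dle_bind k2 k1) => r _; have [] := IH _ (tk r) (sz r).
have hq (a b c : word) : (size a <= size (teval v Lx))%N -> (size c <= size (teval v LB))%N ->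
   dall (fun a => size a <= size (teval v LB))%N (fun q => size q <= size (teval v Ns))%N
      (qrec (size c) h ([::], take (size c) b) a) /\
   dle (size (teval v (TTimes Ds Lx))) (qrec (size c) h ([::], take (size c) b) a).
  move=> ha hc.
  have [] := hrec (size c) ([::], take (size c) b) a hc _ _.
  + by rewrite size_take_min geq_minl.
  + by rewrite add0n.
  move=> k1 k2; split; first by apply: dall_mono k1 => // r; lia.
  apply: dle_mono k2; rewrite /= size_flatten /shape map_nseq sumn_nseq mulnC.
  by rewrite leq_mul2l ha orbT.
split=> /=.
  apply: (dall_bind (P := fun a => size a <= size (teval v Lx))%N).
    by apply: dall_mono ax => // q; rewrite !size_cat; lia.
  move=> a ha; apply: (dall_bind (P := fun a => size a <= size (teval v Lz))%N).
    by apply: dall_mono az => // q; rewrite !size_cat; lia.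
  move=> b hb; apply: (dall_bind (P := fun a => size a <= size (teval v LB))%N).
    by apply: dall_mono aB => // q; rewrite !size_cat; lia.
  move=> c hc; have [k1 _] := hq a b c ha hc; apply: dall_mono k1 => // q.
  by rewrite !size_cat; lia.
rewrite !size_cat -addnA; apply: (dle_bind bx ax) => a ha.
apply: (dle_bind bz az) => b hb; apply: (dle_bind bB aB) => c hc.
by have [_] := hq a b c ha hc.
Qed.

(** * Tables of answers and trees without repeated queries *)

Definition table : Type := seq (word * bool).

Definition lookup (l : table) (q : word) : option bool :=
  if (q, true) \in l then Some true else if (q, false) \in l then Some false else None.

(** A query outside the table counts as answered by 0; the resulting value is the intended one when
    [dmiss] reports no missing query. *)
Definition answer (lk : word -> option bool) (q : word) : bool := lk q == Some true.

Fixpoint dmiss (lk : word -> option bool) (t : dtree word word) : option word :=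
  if t is DNode q k then
    if lk q is Some b then dmiss lk (k b) else Some q
  else None.

Definition sample (t : dtree word word) (l : table) (b : bool) : table :=
  if dmiss (lookup l) t is Some q then (q, b) :: l else l.

(** Repeated queries are answered from the table of earlier ones. The tree becomes [dfresh], as the
    independence of the reads requires, and keeps its value by [ded_run]. *)
Fixpoint ded (l : table) (t : dtree word word) : dtree word word :=
  if t is DNode q k then
    if lookup l q is Some b then ded l (k b) else DNode q (fun b => ded ((q, b) :: l) (k b))
  else t.

Definition dom (l : table) : seq word := [seq p.1 | p <- l].

Lemma lookup_dom l q : (lookup l q == None) = (q \notin dom l).
Proof.
apply/idP/idP.
  rewrite /lookup; case: ifP => // h1; case: ifP => // h2 _.
  by apply/negP => /mapP[[q' []] hq /= e]; move: hq; rewrite -e ?h1 ?h2.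
move=> hq; rewrite /lookup; case: ifP => [h|_].
  by case/negP: hq; apply/mapP; exists (q, true).
by case: ifP => // h; case/negP: hq; apply/mapP; exists (q, false).
Qed.

Lemma ded_fresh l t : dfresh (dom l) (ded l t).
Proof.
elim: t l => //= q k IH l; case e: (lookup l q) => [b|]; first exact: IH.
split=> [|b]; first by rewrite -lookup_dom e.
exact: (IH b ((q, b) :: l)).
Qed.

Lemma ded_run l t (w : word -> bool) : (forall p, p \in l -> w p.1 = p.2) ->
  drun w (ded l t) = drun w t.
Proof.
elim: t l => //= q k IH l hl; case e: (lookup l q) => [b|] /=.
  have -> : w q = b; last exact: IH.
  move: e; rewrite /lookup; case: ifP => [h [<-]|_]; first exact: (hl _ h).
  by case: ifP => // h [<-]; exact: (hl _ h).
by apply: IH => p; rewrite inE => /orP[/eqP->//|]; exact: hl.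
Qed.

Lemma ded_le l t n : dle n t -> dle n (ded l t).
Proof.
elim: t l n => //= q k IH l n [n0 hk]; case: (lookup l q) => [b|] /=.
  by apply: IH; apply: dle_mono (hk b); exact: leq_pred.
by split=> // b; exact: IH.
Qed.

Lemma lookup_cons q b l q' : lookup l q = None -> lookup ((q, b) :: l) q' =
  if q' == q then Some b else lookup l q'.
Proof.
move=> hq; rewrite /lookup !inE !xpair_eqE; case: eqP => [->|_] //=.
move: hq; rewrite /lookup; case: ifP => // h1; case: ifP => // h2 _.
by case: b; rewrite ?h1.
Qed.

Lemma ded_node l t q k' : ded l t = DNode q k' ->
  dmiss (lookup l) t = Some q /\ forall b, k' b = ded ((q, b) :: l) t.
Proof.
elim: t => //= q0 k IH; case e: (lookup l q0) => [b0|].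
  move=> h; have [h1 h2] := IH _ h; split=> // b; rewrite h2 lookup_cons.
    case: eqP => [e'|_]; last by rewrite e.
    have := ded_fresh l (k b0); rewrite h /= => -[/negP h3 _].
    by case: h3; rewrite -e'; apply: contraT => hn; move: e; rewrite -lookup_dom in hn;
      rewrite (eqP hn).
  have := ded_fresh l (k b0); rewrite h /= => -[h3 _]; apply/eqP.
  by rewrite lookup_dom.
by move=> [<- <-]; split=> // b; rewrite lookup_cons // eqxx.
Qed.

Lemma ded_leaf l t a : ded l t = DLeaf a -> dmiss (lookup l) t = None /\ drun (answer (lookup l)) t = a.
Proof.
elim: t => /= [a' [->]//|q k IH]; case e: (lookup l q) => [b|] //.
move=> h; have [h1 h2] := IH _ h; split=> //.
by rewrite /answer e; case: b {e h h1} h2.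
Qed.

Section Sampling.
Local Open Scope ring_scope.
Variable R : realType.

(** Each coin answers the first query that the table lacks, just as the next node of [ded] does.
    Once no query is missing, further coins leave the table unchanged and the two halves of the
    weight add up, so [n] may exceed the depth of the branch. *)
Lemma fweight_sample (t : dtree word word) (y : word) n p
    (l := foldl (sample t) [::] p) : dle n (ded l t) ->
  fweight R y n p (fun r => drun (answer (lookup (foldl (sample t) [::] r))) t) = dweight R y (ded l t).
Proof.
rewrite /l => {l}; elim: n p => [|n IH] p /=.
  case e: (ded _ t) => [a|q k'] /=; last by case.
  by move=> _; have [_ ->] := ded_leaf e.
case e: (ded _ t) => [a|q k'] hd.
  have [h1 h2] := ded_leaf e.
  have eb b : foldl (sample t) [::] (rcons p b) = foldl (sample t) [::] p.
    by rewrite foldl_rcons /sample h1.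
  rewrite !IH ?eb ?e //= -mulrDl (_ : 2^-1 + 2^-1 = 1) ?mul1r //.
  by rewrite -mulr2n -[RHS](@mulVf _ (2 : R)) ?pnatr_eq0 // mulr_natr.
have [h1 h2] := ded_node e.
have eb b : foldl (sample t) [::] (rcons p b) = (q, b) :: foldl (sample t) [::] p.
  by rewrite foldl_rcons /sample h1.
have [_ hk] := hd.
by rewrite !IH ?eb -?h2 //=; have := hk true; have := hk false; rewrite /=.
Qed.

End Sampling.

(* The empty word stands for the absence of a missing query. *)
Definition missw (lk : word -> option bool) (t : dtree word word) : word :=
  if dmiss lk t is Some q then true :: q else [::].

Lemma dmiss_bind lk t f : dmiss lk (dbind t f) =
  if dmiss lk t is Some q then Some q else dmiss lk (f (drun (answer lk) t)).
Proof.
elim: t => //= q k IH; rewrite /answer; case: (lk q) => [b|] //.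
by rewrite IH; case: b.
Qed.

Lemma missw_bind lk t f : missw lk (dbind t f) =
  if missw lk t != [::] then missw lk t else missw lk (f (drun (answer lk) t)).
Proof. by rewrite /missw dmiss_bind; case: (dmiss lk t). Qed.

Lemma missw_qrec_rcons lk b h pa x c : missw lk (qrec b h pa (rcons x c)) =
  if missw lk (qrec b h pa x) != [::] then missw lk (qrec b h pa x)
  else missw lk (h c (pa.1 ++ x) (drun (answer lk) (qrec b h pa x))).
Proof.
elim: x pa => [|d x IH] pa.
  rewrite /= missw_bind cats0 {3}/missw /=.
  by case: (missw _ _).
rewrite /= !missw_bind; case: (missw lk (h d pa.1 pa.2)) => [|? ?] //=.
by rewrite IH drun_bind /= cat_rcons.
Qed.

Lemma size_missw_qrec lk b h pa p x : prefix p x ->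
  (size (missw lk (qrec b h pa p)) <= size (missw lk (qrec b h pa x)))%N.
Proof.
move=> /prefixP[t ->]; elim/last_ind: t => [|t c IH]; first by rewrite cats0.
rewrite -rcons_cat missw_qrec_rcons; case: eqP => //= e.
by move: IH; rewrite e leqn0 => /nilP ->.
Qed.

Lemma size_missw n P lk t : dall P (fun q => size q <= n)%N t -> (size (missw lk t) <= n.+1)%N.
Proof.
rewrite /missw; elim: t => //= q k IH [hq hk]; case: (lk q) => [b|] //=.
exact: IH.
Qed.

Lemma dall_sub (I S T : Type) P Q w (t : dtree I S) (f : S -> dtree I T) :
  dall P Q (dbind t f) -> dall P Q (f (drun w t)).
Proof. by elim: t => //= i k IH [_ hk]; exact: IH. Qed.

Lemma missw_ext lk lk' t : lk =1 lk' -> missw lk t = missw lk' t.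
Proof.
move=> e; rewrite /missw (_ : dmiss lk t = dmiss lk' t) //.
by elim: t => //= q k IH; rewrite e; case: (lk' q).
Qed.

(** * Tables coded as words *)

Definition tblw (l : table) : word := foldr (fun p a => pr (p.2 :: p.1) a) [::] l.

Definition scan (w : oracle) (x a : word) : word :=
  if (a == [::]) || (pr1 w a == x) then a else pr2 w a.

(** The recursion over [tb] only counts rounds of [scan], each of which drops an entry unless the
    key is found; a coded table has at least as many bits as entries. *)
Definition memt (w : oracle) (tb x : word) : bool :=
  nrec (size tb) (fun c p a => scan w x a) tb tb != [::].

Lemma size_pr x y : size (pr x y) = ((size x).*2 + size y).+1.
Proof. by rewrite /pr size_cat size_nseq /= size_cat; lia. Qed.

Lemma memt_tblw w l q b : memt w (tblw l) (b :: q) = ((q, b) \in l).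
Proof.
have hl : (size l <= size (tblw l))%N.
  elim: l => // p l IH; rewrite -[tblw _]/(pr (p.2 :: p.1) (tblw l)) size_pr.
  by move: IH => /=; lia.
have key x : exists l', [/\ nrec (size (tblw l)) (fun c p a => scan w (b :: q) a) (tblw l) x = tblw l',
    (size (tblw l') <= size (tblw l))%N, ((q, b) \in l') = ((q, b) \in l) &
    (size l' <= size l - size x)%N \/ exists l'', l' = (q, b) :: l''].
  elim/last_ind: x => [|x c [l' [IH h1 h2 h3]]].
    by exists l; rewrite nrec_nil take_size subn0; split=> //; left.
  rewrite nrec_rcons IH /scan; case: l' h1 h2 h3 IH => [|[q' b'] l'] h1 h2 h3 IH /=.
    by exists [::]; split=> //; left.
  rewrite pr1E pr2E.
  case: eqP => [[eb eq]|ne].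
    exists ((q', b') :: l'); rewrite take_oversize //; split=> //.
    by right; exists l'; rewrite eb eq.
  rewrite -[tblw _]/(pr (b' :: q') (tblw l')) size_pr in h1; exists l'; rewrite take_oversize; last by lia.
  split=> //; first by lia.
    rewrite -h2 inE xpair_eqE; case: eqP => // e1; case: eqP => // e2.
    by case: ne; rewrite e1 e2.
  case: h3 => [h3|[l'' [e1 e2 _]]]; first by left; rewrite size_rcons; move: h3 => /=; lia.
  by case: ne; rewrite e1 e2.
have [l' [h1 h2 h3 h4]] := key (tblw l); rewrite /memt h1 -h3.
case: l' h1 h2 h3 h4 => // -[q' b'] l' _ _ _ [/=|]; first by lia.
by move=> [l'' [-> -> _]]; rewrite mem_head.
Qed.

Definition lookupw (w : oracle) (tb q : word) : option bool :=
  if memt w tb (true :: q) then Some true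
  else if memt w tb (false :: q) then Some false else None.

Lemma lookupw_tblw w l : lookupw w (tblw l) =1 lookup l.
Proof. by move=> q; rewrite /lookupw !memt_tblw. Qed.

Lemma ep_memt f g : EX f -> EX g -> EP (fun w v => memt w (f w v) (g w v)).
Proof.
move=> hf hg; apply: ep_nonempty.
apply: (@ex_nrec f f (fun c w p a v => scan w (g w v) a) f) => // c.
apply: ex_if; [|exact: ex_var|by apply: ex_pr2; exact: ex_var].
apply: ep_or; apply: ep_eq; [exact: ex_var|exact: ex_const|by apply: ex_pr1; exact: ex_var|].
exact: (ex_wk 2 hg).
Qed.

Lemma ep_answer f g : EX f -> EX g -> EP (fun w v => answer (lookupw w (f w v)) (g w v)).
Proof.
move=> hf hg; have hb b : EX (fun w v => b :: g w v).
  by apply: (ex_cat (ex_const [:: b]) hg).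
apply: (ep_ext (ep_memt hf (hb true))) => w v; rewrite /answer /lookupw.
by case: ifP => // _; case: ifP.
Qed.

Lemma ep_lookup_none f g : EX f -> EX g -> EP (fun w v => lookupw w (f w v) (g w v) == None).
Proof.
move=> hf hg; have hb b : EX (fun w v => b :: g w v).
  by apply: (ex_cat (ex_const [:: b]) hg).
apply: (ep_ext (ep_and (ep_not (ep_memt hf (hb true))) (ep_not (ep_memt hf (hb false))))) => w v.
by rewrite /lookupw; case: ifP => // _; case: ifP.
Qed.

(** Relativisation: an oracle query becomes a search in the table held in variable 0. *)
Lemma ex_relative e : EX (fun w v => ev (answer (lookupw w (v 0))) (etl v) e).
Proof.
elim: e => /= [i||b|e1 IH1 e2 IH2|e1 IH1 e2 IH2|e1 IH1|x IHx z IHz s0 IH0 s1 IH1 B IHB].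
- exact: (ex_var i.+1).
- exact: ex_const.
- exact: ex_const.
- exact: ex_cat.
- exact: ex_times.
- by apply: ex_if; [exact: (ep_answer (ex_var 0) IH1)|exact: ex_const|exact: ex_const].
apply: (@ex_nrec _ _ (fun c w p a v => if c
    then ev (answer (lookupw w (v 0))) (econs p (econs a (etl v))) s1
    else ev (answer (lookupw w (v 0))) (econs p (econs a (etl v))) s0) _ IHx IHz _ IHB).
have sw s : EX (fun w v => ev (answer (lookupw w (v 0))) (etl v) s) ->
    EX (fun w v => ev (answer (lookupw w (v 2))) (econs (v 0) (econs (v 1) (etl (etl (etl v))))) s).
  move=> h; apply: (ex_ext (ex_subst (g := fun i w v => match i with
    0 => v 2 | 1 => v 0 | 2 => v 1 | j => v j end) h _)).
    by case=> [|[|[|i]]]; exact: ex_var.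
  by move=> w v; apply: ev_ext => -[|[|i]].
by case; [exact: (sw _ IH1)|exact: (sw _ IH0)].
Qed.

(** Subexpressions are tried in the order of evaluation: the first missing query is passed on, and a
    later subexpression is consulted only when the table answers all earlier queries. *)
Lemma ex_missw e : EX (fun w v => missw (lookupw w (v 0)) (qt (etl v) e)).
Proof.
elim: e => /= [i||b|e1 IH1 e2 IH2|e1 IH1 e2 IH2|e1 IH1|x IHx z IHz s0 IH0 s1 IH1 B IHB];
  try exact: (ex_const [::]).
- apply: (ex_ext (ex_ifn IH1 IH1 IH2)) => w v; rewrite !missw_bind.
  by case: (missw _ (qt _ e1)) => //=; case: (missw _ _).
- apply: (ex_ext (ex_ifn IH1 IH1 IH2)) => w v; rewrite !missw_bind.
  by case: (missw _ (qt _ e1)) => //=; case: (missw _ _).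
- apply: (ex_ext (ex_ifn IH1 IH1 (ex_if (ep_lookup_none (ex_var 0) (ex_relative e1))
    (ex_cat (ex_const [:: true]) (ex_relative e1)) (ex_const [::])))) => w v.
  rewrite missw_bind drun_qt; case: (missw _ (qt _ e1)) => //=.
  by rewrite /missw /=; case: (lookupw _ _ _) => // b; case: b.
pose va w v e := ev (answer (lookupw w (v 0))) (etl v) e.
pose h (w : oracle) v (c : bool) p a := if c then qt (econs p (econs a (etl v))) s1
  else qt (econs p (econs a (etl v))) s0.
pose q w v := qrec (size (va w v B)) (h w v) ([::], take (size (va w v B)) (va w v z)).
pose M w v p := missw (lookupw w (v 0)) (q w v p).
(* The value reached on the prefix [p] is recomputed as a recursion over [p], so that [M] has to
   carry the missing query only. *)
have qE w v p : drun (answer (lookupw w (v 0))) (q w v p) =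
    va w (econs (v 0) (econs p (etl v))) (ERec (EVar 0) (eren succn z) (eren (rup succn) s0)
      (eren (rup succn) s1) (eren succn B)).
  rewrite /va /= !ev_ren; apply: drun_qrec => c p' a.
  by case: c; rewrite /h /= drun_qt ev_ren; apply: ev_ext => -[|[|i]].
have hM : EX (fun w v => M w v (va w v x)).
  have [L [N [D hb]]] := qt_bound (ERec x z s0 s1 B).
  apply: (@ex_rec M (fun w v => va w v x) (fun w v => [::])
    (fun c w p a v => if a != [::] then a else
       missw (lookupw w (v 0)) (h w v c p (drun (answer (lookupw w (v 0))) (q w v p))))
    (fun w v => [:: true] ++ teval (etl v) N)).
  - exact: ex_relative.
  - exact: ex_const.
  - move=> c; apply: ex_ifn; [exact: ex_var|exact: ex_var|].
    have hq : EX (fun w v => drun (answer (lookupw w (v 2))) (q w (etl (etl v)) (v 0))).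
      apply: (ex_ext (ex_subst (g := fun i w v => match i with
        0 => v 2 | 1 => v 0 | j.+2 => v j.+3 end) (ex_relative _) _)); last first.
        by move=> w v; rewrite -[v 2]/(etl (etl v) 0) qE; apply: ev_ext => -[|i].
      by case=> [|[|i]]; exact: ex_var.
    have hs s : EX (fun w v => missw (lookupw w (v 0)) (qt (etl v) s)) -> EX (fun w v =>
        missw (lookupw w (v 2)) (qt (econs (v 0) (econs
         (drun (answer (lookupw w (v 2))) (q w (etl (etl v)) (v 0))) (etl (etl (etl v))))) s)).
      move=> hs; apply: (ex_ext (ex_subst (g := fun i w v => match i with
        0 => v 2 | 1 => v 0 | 2 => drun (answer (lookupw w (v 2))) (q w (etl (etl v)) (v 0))
        | j => v j end) hs _)).
        by case=> [|[|[|i]]] //; exact: ex_var.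
      move=> w v; congr (missw _ (qt _ s)); apply: funext => -[|[|i]] //.
    by case: c; rewrite /h; [exact: (hs _ IH1)|exact: (hs _ IH0)].
  - apply: ex_cat; first exact: ex_const.
    exact: (ex_wk 1 (ex_term N)).
  - by [].
  - by move=> w v p c; rewrite /M missw_qrec_rcons.
  - move=> w v p hp; have [hb1 _] := hb (etl v).
    apply: leq_trans (size_missw_qrec _ _ _ _ hp) _.
    move: hb1 => /= /(dall_sub (answer (lookupw w (v 0)))).
    move=> /(dall_sub (answer (lookupw w (v 0)))) /(dall_sub (answer (lookupw w (v 0)))).
    rewrite !drun_qt; exact: size_missw.
apply: (ex_ext (ex_ifn IHx IHx (ex_ifn IHz IHz (ex_ifn IHB IHB hM)))) => w v.
by rewrite !missw_bind !drun_qt.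
Qed.

(** A coin adds at most one entry [pr (c :: q) _], which costs [2|q| + 3] bits; this is the origin
    of the three ones and of the doubled [N] in the bound. *)
Lemma ex_sampled_table e :
  EX (fun w v => tblw (foldl (sample (qt (etl v) e)) [::] (v 0))).
Proof.
have [L [N [D hb]]] := qt_bound e.
apply: (@ex_rec (fun w v p => tblw (foldl (sample (qt (etl v) e)) [::] p)) (fun w v => v 0)
  (fun w v => [::]) (fun c w p a v =>
    if missw (lookupw w a) (qt (etl v) e) != [::]
    then pr ([:: c] ++ drop (size [:: true]) (missw (lookupw w a) (qt (etl v) e))) a else a)
  (fun w v => flatten (nseq (size (v 0)) ([:: true; true; true] ++
     teval (etl v) N ++ teval (etl v) N)))).
- exact: ex_var.
- exact: ex_const.
- have hm : EX (fun w v => missw (lookupw w (v 1)) (qt (etl (etl (etl v))) e)).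
    apply: (ex_ext (ex_subst (g := fun i w v => if i is j.+1 then v j.+3 else v 1) (ex_missw e) _)) => //.
    by case=> [|i]; exact: ex_var.
  move=> c; apply: ex_ifn => //; last exact: ex_var.
  apply: ex_pr; last exact: ex_var.
  by apply: ex_cat; [exact: ex_const|apply: ex_drop => //; exact: ex_const].
- apply: ex_times; last exact: ex_var.
  apply: ex_cat; first exact: ex_const.
  by apply: ex_cat; exact: (ex_wk 1 (ex_term N)).
- by [].
- move=> w v p c; rewrite foldl_rcons /sample (missw_ext _ (lookupw_tblw w _)) /missw.
  by case: (dmiss _ _) => //= q; rewrite drop0.
- move=> w v p /prefixP[t ->]; rewrite size_flatten /shape map_nseq sumn_nseq size_cat.
  apply: (@leq_trans (size ([:: true; true; true] ++ teval (etl v) N ++ teval (etl v) N) * size p)%N); last first.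
    by rewrite !size_cat leq_mul2l leq_addr orbT.
  elim/last_ind: p => [|p c IH]; first by rewrite muln0.
  rewrite foldl_rcons size_rcons mulnS; have [hb1 _] := hb (etl v).
  move: (foldl _ _ p) (muln _ (size p)) IH => l k IH.
  have := size_missw (lookup l) hb1; rewrite /sample /missw.
  case: (dmiss _ _) => [q hq|_]; last by rewrite !size_cat; lia.
  rewrite -[tblw _]/(pr (c :: q) (tblw l)) size_pr !size_cat /=; move: hq => /=; lia.
Qed.

(** The function on display ignores [w], so the expression obtained has the same value for all
    oracles and can be run with [no_oracle]. *)
Lemma ex_lazy e : EX (fun w v =>
  drun (answer (lookup (foldl (sample (qt (etl v) e)) [::] (v 0)))) (qt (etl v) e)).
Proof.
apply: (ex_ext (ex_subst (g := fun i w v => if i is j.+1 then v j.+1 else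
  tblw (foldl (sample (qt (etl v) e)) [::] (v 0))) (ex_relative e) _)).
  by case=> [|i]; [exact: ex_sampled_table|exact: ex_var].
move=> w v; rewrite drun_qt; congr (ev _ _ e).
by apply: funext => q; rewrite /answer lookupw_tblw.
Qed.

(** * Register machines on a multitrack tape *)

Section Tracks.
Variable K : nat.

Notation cell := {ffun 'I_K -> option bool}.
Notation sym := (symbol (option cell)).
Notation Home := (@Work (option cell) None).
Notation Cel c := (@Work (option cell) (Some c)).

Definition no_cell : cell := [ffun=> None].

Definition rdc (c : cell) (d : nat) : option bool := if insub d is Some r then c r else None.

Definition updc (c : cell) (d : nat) (x : option bool) : cell :=
  [ffun r => if val r == d then x else c r].

Definition cell2 (x y : bool) : cell := updc (updc no_cell 0 (Some x)) 1 (Some y).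

(* An input symbol is read as a cell holding its value on track 0 and, on track 1,
   a bit that tells the binary symbols from the separator. *)
Definition rds (a : sym) : cell :=
  match a with
  | Work (Some c) => c
  | Bit b => cell2 b true
  | Sharp => cell2 true false
  | _ => no_cell
  end.

(* Register [r] is written from left to right on track [r] of the tape. *)
Fixpoint cells (n : nat) (s : nat -> word) : seq cell :=
  if n is n'.+1 then [ffun r => ohead (s (val r))] :: cells n' (fun r => behead (s r)) else [::].

Definition upd (s : nat -> word) (d : nat) (x : word) (r : nat) : word :=
  if r == d then x else s r.

Definition fits (n : nat) (s : nat -> word) : Prop := forall r, (r < K)%N -> (size (s r) <= n)%N.

Lemma cells_ext n s s' : (forall r, (r < K)%N -> s r = s' r) -> cells n s = cells n s'.
Proof.
elim: n s s' => //= n IH s s' h; congr cons.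
  by apply/ffunP => r; rewrite !ffunE h.
by apply: IH => r hr; rewrite h.
Qed.

Lemma fits_behead n s : fits n.+1 s -> fits n (fun r => behead (s r)).
Proof. by move=> h r /h; rewrite size_behead; case: (size _). Qed.

Lemma cellsS n s : fits n s -> rcons (cells n s) no_cell = cells n.+1 s.
Proof.
elim: n s => [|n IH] s h.
  rewrite /=; congr cons; apply/ffunP => r; rewrite !ffunE.
  by have := h _ (ltn_ord r); rewrite leqn0 => /nilP ->.
by rewrite -[LHS]/(_ :: rcons (cells n (fun r => behead (s r))) no_cell) IH //; exact: fits_behead.
Qed.

Lemma size_cells n s : size (cells n s) = n.
Proof. by elim: n s => //= n IH s; rewrite IH. Qed.

Lemma rdc_head s d : (d < K)%N -> rdc [ffun r => ohead (s (val r))] d = ohead (s d).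
Proof. by move=> h; rewrite /rdc insubT ffunE. Qed.

Lemma behead_upd s d x : (fun r => behead (upd s d x r)) = upd (fun r => behead (s r)) d (behead x).
Proof. by apply: funext => r; rewrite /upd; case: eqP. Qed.

Lemma head_upd s d x : [ffun r => ohead (upd s d x (val r))] =
  updc [ffun r => ohead (s (val r))] d (ohead x).
Proof. by apply/ffunP => r; rewrite !ffunE /upd; case: eqP. Qed.

Lemma cells_upd n s d x : cells n.+1 (upd s d x) =
  updc [ffun r => ohead (s (val r))] d (ohead x) ::
  cells n (upd (fun r => behead (s r)) d (behead x)).
Proof. by rewrite /= head_upd behead_upd. Qed.

(** * Primitive register operations as tape sweeps *)

Inductive prim : Type :=
| Copy of nat & nat
| Clear of nat
| Push of nat & bool
| Pop of nat
| Trunc of nat & nat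
| Coin of nat.

Definition pinit (o : prim) (c : bool) : option bool :=
  match o with Push _ b => Some b | Coin _ => Some c | _ => None end.

(** An operation is one sweep to the right by [pF] and one back by [pG], with an optional bit in the
    state. Here it is the bit to be written, carried to the first free cell of the track. *)
Definition pF (o : prim) (q : option bool) (c : cell) : option bool * cell :=
  match o with
  | Copy d r => (q, updc c d (rdc c r))
  | Clear d => (q, updc c d None)
  | Push d _ | Coin d => if q is Some b then
      if rdc c d is None then (None, updc c d (Some b)) else (q, c) else (q, c)
  | Pop d => (q, c)
  | Trunc d r => (q, if rdc c r is None then updc c d None else c)
  end.

(** Popping shifts a track one cell to the left, hence happens on the way back: each cell takes the
    bit of its right neighbour, and the bit left over at the end is the exit value. *)
Definition pG (o : prim) (q : option bool) (c : cell) : option bool * cell :=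
  if o is Pop d then (rdc c d, updc c d q) else (q, c).

Definition psem (o : prim) (c : bool) (s : nat -> word) : nat -> word :=
  match o with
  | Copy d r => upd s d (s r)
  | Clear d => upd s d [::]
  | Push d b => upd s d (rcons (s d) b)
  | Pop d => upd s d (behead (s d))
  | Trunc d r => upd s d (take (size (s r)) (s d))
  | Coin d => upd s d (rcons (s d) c)
  end.

Definition pexit (o : prim) (s : nat -> word) : option bool :=
  if o is Pop d then ohead (s d) else None.

Definition pregs (o : prim) : nat :=
  match o with
  | Copy d r | Trunc d r => (maxn d r).+1
  | Clear d | Push d _ | Pop d | Coin d => d.+1
  end.

Fixpoint fscan (F : option bool -> cell -> option bool * cell) q (cs : seq cell) :
    option bool * seq cell :=
  if cs is c :: cs' then
    let r := fscan F (F q c).1 cs' in (r.1, (F q c).2 :: r.2)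
  else (q, [::]).

Fixpoint bscan (F : option bool -> cell -> option bool * cell) q (cs : seq cell) :
    option bool * seq cell :=
  if cs is c :: cs' then
    let r := bscan F q cs' in ((F r.1 c).1, (F r.1 c).2 :: r.2)
  else (q, [::]).

Lemma fscan_rcons F q cs c : fscan F q (rcons cs c) =
  let r := fscan F q cs in ((F r.1 c).1, rcons r.2 (F r.1 c).2).
Proof. by elim: cs q => //= d cs IH q; rewrite IH. Qed.

Lemma bscan_rcons F q cs c : bscan F q (rcons cs c) =
  let r := bscan F (F q c).1 cs in (r.1, rcons r.2 (F q c).2).
Proof. by elim: cs => //= d cs IH; rewrite IH. Qed.

Lemma size_fscan F q cs : size (fscan F q cs).2 = size cs.
Proof. by elim: cs q => //= c cs IH q; rewrite IH. Qed.

(** The sweep includes one empty cell beyond the contents, which leaves room for a pushed bit;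
    therefore each operation lengthens the tape by one cell. *)
Lemma pscan o c s n : (pregs o <= K)%N -> fits n s ->
  let f := fscan (pF o) (pinit o c) (cells n.+1 s) in
  bscan (pG o) f.1 f.2 = (pexit o s, cells n.+1 (psem o c s)) /\ fits n.+1 (psem o c s).
Proof.
have updK (x : cell) d y : rdc x d = y -> updc x d y = x.
  by move=> <-; apply/ffunP => r; rewrite ffunE /rdc; case: eqP => // <-; rewrite valK.
have bid o' q cs : (if o' is Pop _ then False else True) -> bscan (pG o') q cs = (q, cs).
  by move=> h; elim: cs => //= x cs ->; case: o' h.
have push d b m s' : (d < K)%N -> (size (s' d) < m)%N ->
    fscan (fun q (c : cell) => if q is Some b then
      if rdc c d is None then (None, updc c d (Some b)) else (q, c) else (q, c)) (Some b) (cells m s') =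
    (None, cells m (upd s' d (rcons (s' d) b))).
  move=> hd; have idle cs : fscan (fun q (c : cell) => if q is Some b then
      if rdc c d is None then (None, updc c d (Some b)) else (q, c) else (q, c)) None cs = (None, cs).
    by elim: cs => //= x cs ->.
  elim: m s' => // m IH s' hs; rewrite cells_upd /= rdc_head //.
  case e: (s' d) => [|x u] /=.
    rewrite idle /=; congr (_, _ :: _); apply: cells_ext => r _.
    by rewrite /upd; case: eqP => // ->; rewrite e.
  rewrite IH ?e //=; last by rewrite e in hs.
  by congr (_, _ :: _); rewrite updK // rdc_head // e.
move=> ho hs; split; last first.
  move=> r hr; have h := hs _ hr.
  case: o ho => [d r'|d|d b|d|d r'|d] /= ho; rewrite /upd; case: eqP => [e|_];
    rewrite ?size_rcons ?size_behead ?size_take_min -?e //; try by lia.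
  by have := hs r'; lia.
have fmap g q cs : fscan (fun q c => (q, g c)) q cs = (q, map g cs).
  by elim: cs => //= x cs ->.
have fst_snd T (x : T) (cs : seq cell) p : p = (x, cs) -> (p.1 = x) * (p.2 = cs).
  by move=> ->.
case: o ho => [d r|d|d b|d|d r|d] ho.
- rewrite bid // -[pF _]/(fun q c => (q, updc c d (rdc c r))) fmap /= -/cells.
  congr (_, _); rewrite -[LHS]/(map (fun c => updc c d (rdc c r)) (cells n.+1 s)).
  rewrite -[RHS]/(cells n.+1 (upd s d (s r))).
  have hr : (r < K)%N by move: ho => /=; lia.
  elim: n.+1 s {hs} => // m IH s; rewrite cells_upd [cells _ _]/= map_cons IH.
  by rewrite rdc_head.
- rewrite bid // -[pF _]/(fun q c => (q, updc c d None)) fmap.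
  congr (_, _); rewrite -[LHS]/(map (fun c => updc c d None) (cells n.+1 s)).
  rewrite -[RHS]/(cells n.+1 (upd s d [::])).
  elim: n.+1 s {hs} => // m IH s; rewrite cells_upd [cells _ _]/= map_cons IH.
  by [].
- have hd : (size (s d) < n.+1)%N by rewrite ltnS hs.
  have := fst_snd _ _ _ _ (push d b n.+1 s ho hd).
  by rewrite bid // /pF /pinit => h; rewrite !h.
- have -> : pF (Pop d) = fun q c => (q, id c) by [].
  rewrite fmap map_id /pinit -[LHS]/(bscan (pG (Pop d)) None (cells n.+1 s)).
  rewrite -[RHS]/(ohead (s d), cells n.+1 (upd s d (behead (s d)))).
  have hs' : fits n.+1 s by move=> r /hs; exact: leqW.
  elim: n.+1 s hs' {hs} => [|m IH] s hs'.
    by rewrite /=; have := hs' d ho; rewrite leqn0 => /nilP ->.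
  rewrite cells_upd [cells _ _]/= [bscan _ _ _]/= IH ?rdc_head //=; last exact: fits_behead.
- rewrite bid // -[pF _]/(fun q c => (q, if rdc c r is None then updc c d None else c)) fmap.
  congr (_, _).
  rewrite -[LHS]/(map (fun c => if rdc c r is None then updc c d None else c) (cells n.+1 s)).
  rewrite -[RHS]/(cells n.+1 (upd s d (take (size (s r)) (s d)))).
  have [hr hd] : (r < K)%N /\ (d < K)%N by move: ho => /=; lia.
  elim: n.+1 s {hs} => // m IH s; rewrite cells_upd [cells _ _]/= map_cons IH rdc_head //.
  case: (s r) => [|x u] /=; first by rewrite !take0.
  congr (_ :: cells _ (upd _ _ _)); last by case: (s d).
  by rewrite updK // rdc_head //; case: (s d).
- have hd : (size (s d) < n.+1)%N by rewrite ltnS hs.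
  have := fst_snd _ _ _ _ (push d c n.+1 s ho hd).
  by rewrite bid // /pF /pinit => h; rewrite !h.
Qed.

(** * Machine components and their composition *)

Record comp : Type := Comp {
  cst : finType;
  cinit : cst;
  cdelta : bool -> cst -> sym -> (cst + option bool) * sym * move }.

Definition mach (A : comp) : ptm :=
  @Ptm (cst A + option bool)%type (option cell) (inl (cinit A)) (fun q => if q is inr _ then true else false)
    (fun c q a => if q is inl s then cdelta c s a else (q, a, MoveN)).

(** Coins are indexed by absolute time, whence the start time [t]. No earlier configuration is
    halted, so that runs of components can be glued with their times added. *)
Fixpoint reach (M : ptm) (c : nat -> bool) (t k : nat) (x y : config M) : Prop :=
  if k is k'.+1 then ~~ halted x /\ reach c t.+1 k' (step (c t) x) y else x = y.

Lemma reach_cat M c t k k' (x y z : config M) :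
  reach c t k x y -> reach c (t + k) k' y z -> reach c t (k + k') x z.
Proof.
elim: k t x => [|k IH] t x /=; first by rewrite addn0 => ->.
by move=> [h1 h2]; rewrite addnS -addSn => h3; split=> //; exact: IH h3.
Qed.

Lemma reach_run M c t k (x y : config M) :
  reach c t k x y -> run (fun i => c (t + i)) k x = y.
Proof.
have runS d n z : run d n.+1 z = run (fun i => d i.+1) n (step (d 0) z) :> config M.
  by elim: n => // n IH; rewrite -[LHS]/(step (d n.+1) (run d n.+1 z)) IH.
elim: k t x => // k IH t x [_ h]; rewrite runS addn0 -(IH _ _ h).
by congr run; apply: funext => i; rewrite addnS addSn.
Qed.

(** A component runs unchanged inside a larger one: [inj] embeds its states and [ex] redirects its
    exits. Sequence and loop are both instances. *)
Lemma reach_map (A C : comp) (inj : cst A -> cst C) (ex : option bool -> cst C + option bool)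
    (phi := fun x : cst A + option bool => match x with inl s => inl (inj s) | inr q => ex q end)
    c t k x l r y l' r' :
  (forall b s a, cdelta b (inj s) a = let: (x, d, m) := cdelta b s a in (phi x, d, m)) ->
  reach (M := mach A) c t k (x, l, r) (y, l', r') ->
  reach (M := mach C) c t k (phi x, l, r) (phi y, l', r').
Proof.
move=> hd; elim: k t x l r => [|k IH] t x l r /=; first by move=> [-> -> ->].
case: x => [s|q] [] //= _ h; split=> //; rewrite hd.
by case: (cdelta _ s _) h => [[x a] []] h; exact: IH.
Qed.

(** The coin that counts is the one tossed at the first step, when the head leaves [Home]. The state
    bit [true] means moving right, [false] moving back. *)
Definition cprim (o : prim) : comp := @Comp (option (bool * option bool))%type None
  (fun c st a => match st with
   | None => (inl (Some (true, pinit o c)), a, MoveR)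
   | Some (true, q) => match a with
       | Blank => let g := pF o q no_cell in (inl (Some (false, g.1)), Cel g.2, MoveN)
       | _ => let g := pF o q (rds a) in (inl (Some (true, g.1)), Cel g.2, MoveR)
       end
   | Some (false, q) => match a with
       | Work None => (inr q, a, MoveN)
       | _ => let g := pG o q (rds a) in (inl (Some (false, g.1)), Cel g.2, MoveL)
       end
   end).

Definition cseq (A B : comp) : comp := @Comp (cst A + cst B)%type (inl (cinit A))
  (fun c st a => match st with
   | inl s => let: (x, d, m) := cdelta c s a in
       (match x with inl s' => inl (inl s') | inr q => inl (inr (cinit B)) end, d, m)
   | inr s => let: (x, d, m) := cdelta c s a in
       (match x with inl s' => inl (inr s') | inr q => inr q end, d, m)
   end).

Definition cloop (T A B : comp) : comp := @Comp (cst T + (cst A + cst B))%type (inl (cinit T))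
  (fun c st a => match st with
   | inl s => let: (x, d, m) := cdelta c s a in
       (match x with
        | inl s' => inl (inl s')
        | inr (Some true) => inl (inr (inl (cinit A)))
        | inr (Some false) => inl (inr (inr (cinit B)))
        | inr None => inr None
        end, d, m)
   | inr (inl s) => let: (x, d, m) := cdelta c s a in
       (match x with inl s' => inl (inr (inl s')) | inr q => inl (inl (cinit T)) end, d, m)
   | inr (inr s) => let: (x, d, m) := cdelta c s a in
       (match x with inl s' => inl (inr (inr s')) | inr q => inl (inl (cinit T)) end, d, m)
   end).

Definition does (A : comp) (c : nat -> bool) (t k : nat) (l r : seq sym) q (l' r' : seq sym) :=
  reach (M := mach A) c t k (inl (cinit A), l, r) (inr q, l', r').

Lemma does_seq A B c t k k' l r q l' r' q' l'' r'' :
  does A c t k l r q l' r' -> does B c (t + k) k' l' r' q' l'' r'' ->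
  does (cseq A B) c t (k + k') l r q' l'' r''.
Proof.
move=> h1 h2; apply: (reach_cat (y := (inl (inr (cinit B)), l', r') : config (mach (cseq A B)))).
  apply: (@reach_map A (cseq A B) inl (fun=> inl (inr (cinit B))) _ _ _ _ _ _ _ _ _ _ h1) => b s a /=.
  by case: (cdelta b s a) => [[[]]].
apply: (@reach_map B (cseq A B) inr inr _ _ _ _ _ _ _ _ _ _ h2) => b s a /=.
by case: (cdelta b s a) => [[[]]].
Qed.

Lemma does_loop_exit T A B c t k l r l' r' :
  does T c t k l r None l' r' -> does (cloop T A B) c t k l r None l' r'.
Proof.
move=> h; pose ex q : cst (cloop T A B) + option bool := match q with
  | Some true => inl (inr (inl (cinit A)))
  | Some false => inl (inr (inr (cinit B)))
  | None => inr None end.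
apply: (@reach_map T (cloop T A B) inl ex _ _ _ _ _ _ _ _ _ _ h) => b s a /=.
by case: (cdelta b s a) => [[[|[[]|]]]].
Qed.

Lemma does_loop_step T A B c t k1 k2 k3 l r b l1 r1 q2 l2 r2 q3 l3 r3 :
  does T c t k1 l r (Some b) l1 r1 ->
  does (if b then A else B) c (t + k1) k2 l1 r1 q2 l2 r2 ->
  does (cloop T A B) c (t + k1 + k2) k3 l2 r2 q3 l3 r3 ->
  does (cloop T A B) c t (k1 + k2 + k3) l r q3 l3 r3.
Proof.
move=> h1 h2 h3; pose ex q : cst (cloop T A B) + option bool := match q with
  | Some true => inl (inr (inl (cinit A)))
  | Some false => inl (inr (inr (cinit B)))
  | None => inr None end.
have {}h1 : reach (M := mach (cloop T A B)) c t k1 (inl (inl (cinit T)), l, r) (ex (Some b), l1, r1).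
  apply: (@reach_map T (cloop T A B) inl ex _ _ _ _ _ _ _ _ _ _ h1) => b' s a /=.
  by case: (cdelta b' s a) => [[[|[[]|]]]].
have {}h2 : reach (M := mach (cloop T A B)) c (t + k1) k2 (ex (Some b), l1, r1)
    (inl (inl (cinit T)), l2, r2).
  case: b h2 {h1} => h2.
    apply: (@reach_map A (cloop T A B) (fun s => inr (inl s)) (fun=> inl (inl (cinit T)))
      _ _ _ _ _ _ _ _ _ _ h2) => b s a /=.
    by case: (cdelta b s a) => [[[]]].
  apply: (@reach_map B (cloop T A B) (fun s => inr (inr s)) (fun=> inl (inl (cinit T)))
    _ _ _ _ _ _ _ _ _ _ h2) => b s a /=.
  by case: (cdelta b s a) => [[[]]].
rewrite -addnA in h3; rewrite /does.
apply: reach_cat (reach_cat h1 h2) h3.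
Qed.

Definition nonblank (a : sym) : bool := if a is Blank then false else true.

Lemma does_prim o c t L us tl : all nonblank us -> tl = [::] \/ tl = [:: Blank] ->
  let f := fscan (pF o) (pinit o (c t)) (rcons (map rds us) no_cell) in
  let b := bscan (pG o) f.1 f.2 in
  does (cprim o) c t ((size us).*2 + 4) L (Home :: us ++ tl) b.1 L
    (Home :: [seq Cel x | x <- b.2]).
Proof.
move=> hu ht; rewrite fscan_rcons /=.
have fwd q l t' : reach (M := mach (cprim o)) c t' (size us) (inl (Some (true, q)), l, us ++ tl)
    (inl (Some (true, (fscan (pF o) q (map rds us)).1)),
     rev [seq Cel x | x <- (fscan (pF o) q (map rds us)).2] ++ l, tl).
  elim: us q l t' hu => // a us IH q l t' /= /andP[ha hu]; split=> //.
  rewrite rev_cons cat_rcons; case: a ha => [|b||x] // _; exact: IH.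
have bwd cs q x r t' : reach (M := mach (cprim o)) c t' (size cs).+1
    (inl (Some (false, q)), rev [seq Cel x | x <- cs] ++ Home :: L, Cel x :: r)
    (inl (Some (false, (bscan (pG o) q (rcons cs x)).1)), L,
      Home :: [seq Cel x | x <- (bscan (pG o) q (rcons cs x)).2] ++ r).
  elim/last_ind: cs q x r t' => [|cs y IH] q x r t'; first by [].
  rewrite size_rcons bscan_rcons [size _]/= map_rcons rev_rcons.
  split=> //; rewrite [step _ _]/= map_rcons cat_rcons; exact: IH.
set q0 := pinit _ _; set f := fscan _ _ _.
(* Leave [Home], cross the cells, turn the blank into a cell, come back, exit at [Home]. *)
have e : ((size us).*2 + 4 = 1 + (size us + (1 + ((size us).+1 + 1))))%N by lia.
rewrite e /does; apply: (reach_cat (y := (inl (Some (true, q0)), Home :: L, us ++ tl) : config (mach (cprim o)))).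
  by [].
apply: (reach_cat (fwd q0 (Home :: L) _)); rewrite -/f.
set g := pF o f.1 no_cell.
apply: (reach_cat (y := (inl (Some (false, g.1)), rev [seq Cel x | x <- f.2] ++ Home :: L,
  [:: Cel g.2]) : config (mach (cprim o)))).
  by case: ht => ->.
have -> : size us = size f.2 by rewrite size_fscan size_map.
apply: (reach_cat (bwd f.2 g.1 g.2 [::] _)).
by rewrite cats0.
Qed.

Lemma nonblank_Cel cs : all nonblank [seq Cel x | x <- cs].
Proof. by elim: cs. Qed.

Lemma rds_Cel cs : [seq rds a | a <- [seq Cel x | x <- cs]] = cs.
Proof. by elim: cs => //= x cs ->. Qed.

Lemma does_psem o c t L us tl n s : (pregs o <= K)%N -> fits n s -> all nonblank us ->
  map rds us = cells n s -> tl = [::] \/ tl = [:: Blank] ->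
  does (cprim o) c t (n.*2 + 4) L (Home :: us ++ tl) (pexit o s) L
    (Home :: [seq Cel x | x <- cells n.+1 (psem o (c t) s)]).
Proof.
move=> ho hs hu e ht; have := does_prim o c t L hu ht.
rewrite e cellsS // -(size_map rds us) e size_cells.
by have [] := pscan (c t) ho hs; cbv zeta; move=> -> _.
Qed.

Lemma does_cells o c t L n s : (pregs o <= K)%N -> fits n s ->
  does (cprim o) c t (n.*2 + 4) L (Home :: [seq Cel x | x <- cells n s]) (pexit o s) L
    (Home :: [seq Cel x | x <- cells n.+1 (psem o (c t) s)]).
Proof.
move=> ho hs; have := @does_psem o c t L [seq Cel x | x <- cells n s] [::] n s ho hs.
rewrite cats0; apply; [exact: nonblank_Cel|exact: rds_Cel|by left].
Qed.

(** * Register programs and their running time *)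

Inductive prog : Type :=
| Prim of prim
| Seq of prog & prog
| Loop of nat & prog & prog.

Fixpoint compile (p : prog) : comp :=
  match p with
  | Prim o => cprim o
  | Seq p1 p2 => cseq (compile p1) (compile p2)
  | Loop r p1 p0 => cloop (cprim (Pop r)) (compile p1) (compile p0)
  end.

Fixpoint progregs (p : prog) : nat :=
  match p with
  | Prim o => pregs o
  | Seq p1 p2 => maxn (progregs p1) (progregs p2)
  | Loop r p1 p0 => maxn r.+1 (maxn (progregs p1) (progregs p0))
  end.

(* [Coin] has no deterministic execution. *)
Inductive exec : prog -> (nat -> word) -> (nat -> word) -> nat -> Prop :=
| exec_prim o s : (if o is Coin _ then False else True) -> exec (Prim o) s (psem o false s) 1
| exec_seq p1 p2 s s1 s2 t1 t2 : exec p1 s s1 t1 -> exec p2 s1 s2 t2 ->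
    exec (Seq p1 p2) s s2 (t1 + t2)
| exec_exit r p1 p0 s : s r = [::] -> exec (Loop r p1 p0) s (upd s r [::]) 1
| exec_loop r p1 p0 s b x s1 s2 t1 t2 : s r = b :: x ->
    exec (if b then p1 else p0) (upd s r x) s1 t1 -> exec (Loop r p1 p0) s1 s2 t2 ->
    exec (Loop r p1 p0) s s2 (1 + t1 + t2).

Definition tape (n : nat) (s : nat -> word) : seq sym := Home :: [seq Cel x | x <- cells n s].

(** Each of the [t] operations adds one cell, so a sweep never crosses more than [n + t] cells. The
    number [k] of machine steps does not depend on the coins. *)
Lemma exec_does p s s' t : exec p s s' t -> (progregs p <= K)%N -> forall n, fits n s ->
  fits (n + t) s' /\ exists2 k, (k <= t * ((n + t).*2 + 4))%N &
  exists q, forall c t0 L, does (compile p) c t0 k L (tape n s) q L (tape (n + t) s').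
Proof.
elim=> {p s s' t} [ o s ho|p1 p2 s s1 s2 t1 t2 _ IH1 _ IH2|r p1 p0 s e|r p1 p0 s b x s1 s2 t1 t2 e _ IH1 _ IH2] /= hK n hs.
- have [_ hf] := pscan false hK hs; rewrite addn1; split=> //.
  exists (n.*2 + 4)%N; first by lia.
  exists (pexit o s) => c t0 L.
  by have := does_cells c t0 L hK hs; rewrite (_ : psem o (c t0) s = psem o false s) //; case: o ho {hK hf}.
- have [] := IH1 _ _ hs; first by lia.
  move=> hf [k1 hk1 [q1 h1]]; have [] := IH2 _ _ hf; first by lia.
  rewrite -addnA => hf' [k2 hk2 [q2 h2]]; split=> //; exists (k1 + k2)%N; first by nia.
  by exists q2 => c t0 L; exact: does_seq (h1 c t0 L) (h2 c _ L).
- have hr : (pregs (Pop r) <= K)%N by move: hK => /=; lia.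
  have [_ hf] := pscan false hr hs; rewrite addn1; move: hf; rewrite /psem e => hf; split=> //.
  exists (n.*2 + 4)%N; first by lia.
  exists None => c t0 L; apply: does_loop_exit.
  by have := does_cells c t0 L hr hs; rewrite /psem /pexit e.
- have hr : (pregs (Pop r) <= K)%N by move: hK => /=; lia.
  have [_] := pscan false hr hs; rewrite /psem e [behead _]/= => hf.
  have [] := IH1 _ _ hf; first by move: hK; case: (b); lia.
  move=> hf1 [k1 hk1 [q1 h1]]; have [] := IH2 hK _ hf1.
  rewrite (_ : n.+1 + t1 + t2 = n + (1 + t1 + t2))%N; last by lia.
  move=> hf2 [k2 hk2 [q2 h2]]; split=> //.
  exists ((n.*2 + 4) + k1 + k2)%N; first by nia.
  exists q2 => c t0 L.
  have h0 := does_cells c t0 L hr hs; rewrite /psem /pexit e [behead _]/= [ohead _]/= in h0.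
  apply: (does_loop_step (q2 := q1) h0 _ (h2 c _ L)).
  by move: (h1 c (t0 + (n.*2 + 4))%N L); case: (b).
Qed.

(* The time of the [j]-th toss when the loop starts at time [t] with [n] cells. *)
Fixpoint toss (t n j : nat) : nat :=
  if j is j'.+1 then toss (t + (n.*2 + 4) + (n.+1.*2 + 4)) n.+2 j' else (t + (n.*2 + 4))%N.

Lemma toss_lt t n j : (toss t n j < toss t n j.+1)%N.
Proof. by elim: j t n => [|j IH] t n; [rewrite /=; lia|exact: IH]. Qed.

Lemma toss_inj t n : injective (toss t n).
Proof.
have mono : {homo toss t n : i j / (i < j)%N} by apply: homo_ltn; [exact: ltn_trans|exact: toss_lt].
by move=> i j e; case: (ltngtP i j) => // /mono; rewrite e ltnn.
Qed.

(** * Tossing coins into a register *)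

Section CoinLoop.
Variables (r d : nat).
Hypotheses (rK : (r < K)%N) (dK : (d < K)%N) (rd : r != d).

Lemma coin_loop_does c L n s t : fits n s -> exists2 k,
  (k <= ((size (s r)).*2 + 1) * ((n + (size (s r)).*2).*2 + 8))%N &
  exists s', [/\ fits (n + (size (s r)).*2 + 1) s',
    s' d = s d ++ [seq c (toss t n j) | j <- iota 0 (size (s r))],
    (forall i, i != r -> i != d -> s' i = s i) &
    exists q, does (compile (Loop r (Prim (Coin d)) (Prim (Coin d)))) c t k L (tape n s) q L
      (tape (n + (size (s r)).*2 + 1) s')].
Proof.
have hr : (pregs (Pop r) <= K)%N by [].
have hd : (pregs (Coin d) <= K)%N by [].
move e: (size (s r)) => m; elim: m n s t e => [|m IH] n s t /esym e hs.
  have {}e : s r = [::] by apply/nilP; rewrite /nilp -e.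
  have [_ hf] := pscan false hr hs; have h0 := does_cells c t L hr hs.
  rewrite /psem /pexit e in h0 hf.
  exists (n.*2 + 4)%N; first by lia.
  exists (upd s r [::]); rewrite addn0 addn1; split=> //.
  - by rewrite cats0 /upd eq_sym (negbTE rd).
  - by move=> i h _; rewrite /upd (negbTE h).
  - by exists None; exact: does_loop_exit.
case es: (s r) e => [|b x] //= [e].
have [_ hf] := pscan false hr hs; have h0 := does_cells c t L hr hs.
rewrite /psem /pexit es [behead _]/= [ohead _]/= in h0 hf.
have [_ hf1] := pscan (c (t + (n.*2 + 4))%N) hd hf; have h1 := does_cells c (t + (n.*2 + 4)) L hd hf.
set s1 := psem _ _ _ in hf1 h1.
have e1 : size (s1 r) = m by rewrite /s1 /= /upd (negbTE rd) eqxx e.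
have [k hk [s' [h2 h3 h4 [q h5]]]] := IH n.+2 s1 (t + (n.*2 + 4) + (n.+1.*2 + 4))%N e1 hf1.
exists ((n.*2 + 4) + (n.+1.*2 + 4) + k)%N; first by nia.
rewrite (_ : n.+2 + m.*2 + 1 = n + m.+1.*2 + 1)%N in h2 h5; last by lia.
exists s'; split=> //.
- rewrite h3 {1}/s1 /= /upd eqxx eq_sym (negbTE rd) -cats1 -catA; congr (_ ++ (_ :: _)).
  by rewrite -[iota 1 m]/(iota (1 + 0) m) iotaDl -map_comp; apply: eq_map => j.
- by move=> i hi hi'; rewrite h4 // /s1 /= /upd (negbTE hi) (negbTE hi').
- exists q; apply: (does_loop_step (q2 := pexit (Coin d) (upd s r x)) h0 _ h5).
  by case: (b).
Qed.

End CoinLoop.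

(** * Entering and leaving the multitrack tape *)

Definition chome : comp := @Comp bool true
  (fun c st a => if st then (inl false, a, MoveL) else (inr None, Home, MoveN)).

Lemma chome_does c t us : exists2 tl, tl = [::] \/ tl = [:: Blank] &
  does chome c t 2 [::] us None [::] (Home :: us ++ tl).
Proof.
case: us => [|a us]; first by exists [:: Blank]; [right|].
by exists [::]; [left|rewrite cats0].
Qed.

(** The bits of register [d] overwrite the cells; the symbol that ends them is a cell or a blank, so
    the output read from there is exactly the register. *)
Definition cout (d : nat) : comp := @Comp (option bool) None
  (fun c st a => match st with
   | None => (inl (Some true), a, MoveR)
   | Some true => match a with
       | Work (Some x) => if rdc x d is Some b then (inl (Some true), Bit b, MoveR)
                          else (inl (Some false), a, MoveL)
       | _ => (inl (Some false), a, MoveL)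
       end
   | Some false => match a with
       | Work None => (inr None, a, MoveR)
       | _ => (inl (Some false), a, MoveL)
       end
   end).

Lemma cout_does d c t L n s : (d < K)%N -> fits n s -> exists l r,
  does (cout d) c t ((size (s d)).*2 + 3) L (tape n s) None l r /\ leading_bits r = s d.
Proof.
move=> dK hs.
pose bits (y : word) : seq sym := map Bit y.
have fwd t' l : exists r, leading_bits r = [::] /\
    reach (M := mach (cout d)) c t' (size (s d)) (inl (Some true), l, [seq Cel x | x <- cells n s])
    (inl (Some true), rev (bits (s d)) ++ l, r) /\
    (r = [::] \/ exists x r', r = Cel x :: r' /\ rdc x d = None).
  elim: n s hs t' l => [|n IH] s hs t' l.
    by have := hs d dK; rewrite leqn0 => /nilP ->; exists [::]; split=> //; split=> //; left.
  case e: (s d) => [|b y].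
    exists [seq Cel x | x <- cells n.+1 s]; split=> //; split=> //; right.
    by do 2 eexists; split; [reflexivity|rewrite rdc_head // e].
  have [r [h1 [h2 h3]]] := IH _ (fits_behead hs) t'.+1 (Bit b :: l).
  rewrite e /= in h2; exists r; split=> //; split=> //; split=> //.
  by rewrite /= rdc_head // e /= rev_cons cat_rcons.
have bwd y a r t' : reach (M := mach (cout d)) c t' (size y).+1
    (inl (Some false), rev (bits y) ++ Home :: L, Bit a :: r)
    (inl (Some false), L, Home :: bits y ++ Bit a :: r).
  elim/last_ind: y a r t' => [|y b IH] a r t'; first by [].
  by rewrite size_rcons /bits map_rcons rev_rcons cat_rcons; split=> //; exact: IH.
have [r [h1 [h2 h3]]] := fwd t.+1 (Home :: L).
exists (Home :: L).
have [r' [e0 back]] : exists r', leading_bits r' = [::] /\ forall t',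
    reach (M := mach (cout d)) c t' 1 (inl (Some true), rev (bits (s d)) ++ Home :: L, r)
    (inl (Some false), behead (rev (bits (s d)) ++ Home :: L), head Blank (rev (bits (s d)) ++ Home :: L) :: r').
  case: h3 => [->|[x [r' [-> hx]]]]; first by exists [:: Blank].
  by exists (Cel x :: r'); split=> // t' /=; rewrite hx.
exists (bits (s d) ++ r'); split; last by elim: (s d) => //= b y ->.
rewrite (_ : (size (s d)).*2 + 3 = 1 + (size (s d) + (1 + (size (s d) + 1))))%N; last by lia.
apply: (reach_cat (y := (inl (Some true), Home :: L, [seq Cel x | x <- cells n s]) : config (mach (cout d)))).
  by [].
apply: reach_cat; first by rewrite addn1; exact: h2.
apply: (reach_cat (back _)).
case/lastP: (s d) => [|y a]; first by [].
rewrite size_rcons /bits map_rcons rev_rcons cat_rcons /=.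
exact: (reach_cat (bwd y a r' _)).
Qed.

End Tracks.

(** * Compiling feasible functions *)

Definition append (d r : nat) : prog := Loop r (Prim (Push d true)) (Prim (Push d false)).

(** During a recursion register [m] holds the unread part of the argument, [m.+1] the value reached,
    [m.+2] the bound and [m.+3] the prefix read. *)
Definition rec_regs (a : nat -> nat) (m i : nat) : nat :=
  match i with 0 => m.+3 | 1 => m.+1 | j.+2 => a j end.

(* Variable [i] is held in register [a i] and the result goes to register [m];
   registers below [m] are left unchanged. An oracle query returns 0. *)
Fixpoint cexp (a : nat -> nat) (m : nat) (e : expr) : prog :=
  match e with
  | EVar i => Prim (Copy m (a i))
  | EEps => Prim (Clear m)
  | EBit b => Seq (Prim (Clear m)) (Prim (Push m b))
  | ECat e1 e2 => Seq (cexp a m e1) (Seq (cexp a m.+1 e2) (append m m.+1))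
  | ETimes e1 e2 =>
      let body := Seq (Prim (Copy m.+3 m)) (append m.+2 m.+3) in
      Seq (cexp a m e1) (Seq (cexp a m.+1 e2) (Seq (Prim (Clear m.+2))
        (Seq (Loop m.+1 body body) (Prim (Copy m m.+2)))))
  | EFlip e1 => Prim (Clear m)
  | ERec x z s0 s1 B =>
      let body c s := Seq (cexp (rec_regs a m) m.+4 s) (Seq (Prim (Copy m.+1 m.+4))
        (Seq (Prim (Trunc m.+1 m.+2)) (Prim (Push m.+3 c)))) in
      Seq (cexp a m x) (Seq (cexp a m.+1 z) (Seq (cexp a m.+2 B)
        (Seq (Prim (Trunc m.+1 m.+2)) (Seq (Prim (Clear m.+3))
        (Seq (Loop m (body true s1) (body false s0)) (Prim (Copy m m.+1)))))))
  end.

Lemma updE s d x : upd s d x d = x.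
Proof. by rewrite /upd eqxx. Qed.

Lemma updN s d x r : r != d -> upd s d x r = s r.
Proof. by rewrite /upd => /negbTE ->. Qed.

Ltac read_upd := repeat first [rewrite updE | rewrite updN; last by lia].

Lemma exec_append d r s : d != r -> exists s', [/\ exec (append d r) s s' ((size (s r)).*2 + 1),
  s' d = s d ++ s r & forall i, i != d -> i != r -> s' i = s i].
Proof.
move=> dr; move e: (s r) => y; elim: y s e => [|b y IH] s e.
  exists (upd s r [::]); split; first exact: exec_exit.
    by rewrite updN // cats0.
  by move=> i _ hi; rewrite updN.
have h0 : exec (if b then Prim (Push d true) else Prim (Push d false)) (upd s r y)
    (upd (upd s r y) d (rcons (s d) b)) 1.
  rewrite -[s d](@updN s r y) //; case: (b); exact: (@exec_prim (Push _ _)).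
have [|s' [h1 h2 h3]] := IH (upd (upd s r y) d (rcons (s d) b)).
  by rewrite updN ?updE // eq_sym.
exists s'; split; last by move=> i hi hi'; rewrite h3 // !updN.
  have -> : ((size (b :: y)).*2 + 1 = 1 + 1 + ((size y).*2 + 1))%N by rewrite /=; lia.
  exact: exec_loop e h0 h1.
by rewrite h2 updE cat_rcons.
Qed.

Lemma ev_size e : exists L, forall w v, (size (ev w v e) <= size (teval v L))%N.
Proof.
have [L [N [D h]]] := qt_bound e; exists L => w v; have [h1 _] := h v.
by have := dall_run w h1; rewrite drun_qt.
Qed.

Notation no_oracle := (fun _ : word => false).

Lemma size_times (n : nat) (x : word) : size (flatten (nseq n x)) = (size x * n)%N.
Proof. by rewrite size_flatten /shape map_nseq sumn_nseq. Qed.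

(** As in [qt_bound], the time of a recursion is obtained by taking the time of the step functions
    at the length bounds of the prefix and of the value; so it is again a term in the arguments. *)
Lemma cexp_exec e : exists T, forall a m s, (forall i, (a i < m)%N) -> exists s' t,
  [/\ exec (cexp a m e) s s' t, s' m = ev no_oracle (fun i => s (a i)) e,
      (forall r, (r < m)%N -> s' r = s r) & (t <= size (teval (fun i => s (a i)) T))%N].
Proof.
have env a m s s' : (forall i, (a i < m)%N) -> (forall r, (r < m)%N -> s' r = s r) ->
    (fun i => s' (a i)) = (fun i => s (a i)) :> (nat -> word).
  by move=> h1 h2; apply: funext => i; rewrite h2.
have lt1 (a : nat -> nat) m k : (forall i, (a i < m)%N) -> forall i, (a i < k + m)%N.
  by move=> h i; have := h i; lia.
elim: e => [i||b|e1 [T1 IH1] e2 [T2 IH2]|e1 [T1 IH1] e2 [T2 IH2]|e1 _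
  |x [Tx IHx] z [Tz IHz] s0 [T0 IH0] s1 [T1 IH1] B [TB IHB]].
- exists (TBit true) => a m s ha; exists (upd s m (s (a i))), 1; split=> //.
  + exact: (@exec_prim (Copy _ _)).
  + by rewrite updE.
  + by move=> r hr; rewrite updN //; lia.
- exists (TBit true) => a m s ha; exists (upd s m [::]), 1; split=> //.
  + exact: (@exec_prim (Clear _)).
  + by rewrite updE.
  + by move=> r hr; rewrite updN //; lia.
- exists (TCat (TBit true) (TBit true)) => a m s ha.
  exists (upd (upd s m [::]) m (rcons (upd s m [::] m) b)), (1 + 1)%N; split=> //.
  + exact: (exec_seq (@exec_prim (Clear _) _ I) (@exec_prim (Push _ _) _ I)).
  + by rewrite !updE.
  + by move=> r hr; rewrite !updN //; lia.
- have [L2 hL2] := ev_size e2.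
  exists (TCat (TCat T1 T2) (TCat (TBit true) (TCat L2 L2))) => a m s ha.
  have [s1 [t1 [h1 v1 k1 b1]]] := IH1 a m s ha.
  have [s2 [t2 [h2 v2 k2 b2]]] := IH2 a m.+1 s1 (lt1 _ _ 1 ha).
  rewrite (env _ _ _ _ ha k1) in v2 b2.
  have ne : m != m.+1 by lia.
  have [s3 [h3 v3 k3]] := exec_append s2 ne.
  exists s3; eexists; split; first exact: exec_seq h1 (exec_seq h2 h3).
  + by rewrite v3 v2 k2 // v1.
  + by move=> r hr; rewrite k3 ?k2 ?k1 //; lia.
  + have := hL2 no_oracle (fun i => s (a i)); rewrite v2 /= !size_cat /= !size_cat; move: b1 b2.
    move: (size (ev _ _ _)) (size (teval _ L2)) (size (teval _ T1)) (size (teval _ T2)) => p1 p2 p3 p4.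
    lia.
- have [L2 hL2] := ev_size e2; have [L1 hL1] := ev_size e1.
  exists (TCat (TCat T1 T2) (TCat (numeral [:: true; true; true])
    (TTimes (TCat (numeral [:: true; true; true]) (TCat L1 L1)) L2))) => a m s ha.
  have [s1 [t1 [h1 v1 k1 b1]]] := IH1 a m s ha.
  have [s2 [t2 [h2 v2 k2 b2]]] := IH2 a m.+1 s1 (lt1 _ _ 1 ha).
  rewrite (env _ _ _ _ ha k1) in v2 b2.
  pose body := Seq (Prim (Copy m.+3 m)) (append m.+2 m.+3).
  have loop u : exists u', [/\ exec (Loop m.+1 body body) u u'
      (size (u m.+1) * ((size (u m)).*2 + 3) + 1),
      u' m.+2 = u m.+2 ++ flatten (nseq (size (u m.+1)) (u m)) &
      forall r, (r <= m)%N -> u' r = u r].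
    move e: (u m.+1) => y; elim: y u e => [|b y IH] u e.
      exists (upd u m.+1 [::]); split; first exact: exec_exit.
        by rewrite updN ?cats0 //; lia.
      by move=> r hr; rewrite updN //; lia.
    pose u1 := upd (upd u m.+1 y) m.+3 (u m).
    have g1 : exec (Prim (Copy m.+3 m)) (upd u m.+1 y) u1 1.
      have -> : u1 = psem (Copy m.+3 m) false (upd u m.+1 y).
        by rewrite /= /u1 [in RHS](@updN _ _ _ m) //; lia.
      exact: exec_prim.
    have ne : m.+2 != m.+3 by lia.
    have [u2 [g2 w2 j2]] := exec_append u1 ne.
    have u2m r : (r <= m)%N -> u2 r = u r by move=> hr; rewrite j2 /u1 ?updN //; lia.
    have [|u3 [g3 w3 j3]] := IH u2; first by rewrite j2 ?/u1; read_upd => //; lia.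
    rewrite u2m // in g3 w3; exists u3; split; last by move=> r hr; rewrite j3 ?u2m.
      rewrite /u1 updE in g2.
      have -> : (size (b :: y) * ((size (u m)).*2 + 3) + 1 =
        1 + (1 + ((size (u m)).*2 + 1)) + (size y * ((size (u m)).*2 + 3) + 1))%N.
        by rewrite /= mulSn; lia.
      by apply: exec_loop e _ g3; case: (b); exact: exec_seq g1 g2.
    by rewrite w3 w2 /u1; read_upd; rewrite /= catA.
  have [s3 [h3 v3 k3]] := loop (upd s2 m.+2 [::]).
  rewrite !updE [upd _ _ _ m.+1]updN ?[upd _ _ _ m]updN in h3 v3; try by lia.
  exists (upd s3 m (s3 m.+2)); eexists; split.
  + apply: exec_seq h1 (exec_seq h2 (exec_seq (@exec_prim (Clear _) _ I)
      (exec_seq h3 (@exec_prim (Copy m m.+2) _ I)))).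
  + by rewrite updE v3 v2 k2 // v1.
  + by move=> r hr; rewrite updN ?k3 ?updN ?k2 ?k1 //; lia.
  + have g2 := hL2 no_oracle (fun i => s (a i)); have g1 := hL1 no_oracle (fun i => s (a i)).
    rewrite v2 k2 // v1 /= !(size_cat, size_times) /= !(size_cat, size_times) /= ?(size_cat, size_times); move: g1 g2 b1 b2.
    move: (size (ev _ _ e1)) (size (ev _ _ e2)) (size (teval _ L1)) (size (teval _ L2))
      (size (teval _ T1)) (size (teval _ T2)) => p1 p2 p3 p4 p5 p6; nia.
- exists (TBit true) => a m s ha; exists (upd s m [::]), 1; split=> //.
  + exact: (@exec_prim (Clear _)).
  + by rewrite updE.
  + by move=> r hr; rewrite updN //; lia.
have [Lx hLx] := ev_size x; have [LB hLB] := ev_size B.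
pose sb (n : nat) : term := match n with 0 => Lx | 1 => LB | j.+2 => TVar j end.
pose Ts := tsubst sb (TCat T0 T1).
(* A round costs one pop, at most [Ts] for the step function, and three operations to copy, truncate
   and push. The other four units are the initial truncation, the clearing, the exit of the loop and
   the final copy. *)
exists (TCat (TCat Tx Tz) (TCat (TCat TB (numeral [:: true; true; true; true]))
  (TTimes (TCat Ts (numeral [:: true; true; true; true])) Lx))) => a m s ha.
have [u1 [t1 [h1 v1 k1 b1]]] := IHx a m s ha.
have [u2 [t2 [h2 v2 k2 b2]]] := IHz a m.+1 u1 (lt1 _ _ 1 ha).
rewrite (env _ _ _ _ ha k1) in v2 b2.
have k2' r : (r < m)%N -> u2 r = s r by move=> hr; rewrite k2 ?k1 //; lia.
have [u3 [t3 [h3 v3 k3 b3]]] := IHB a m.+2 u2 (lt1 _ _ 2 ha).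
rewrite (env _ _ _ _ ha k2') in v3 b3.
set v := (fun i => s (a i)) in v1 v2 v3 b1 b2 b3 *.
pose body c e := Seq (cexp (rec_regs a m) m.+4 e) (Seq (Prim (Copy m.+1 m.+4))
  (Seq (Prim (Trunc m.+1 m.+2)) (Prim (Push m.+3 c)))).
have ha' i : (rec_regs a m i < m.+4)%N.
  by case: i => [|[|i]] /=; [lia|lia|have := ha i; lia].
have step c u (p := u m.+3) (d := u m.+1) : (forall r, (r < m)%N -> u r = s r) ->
    (size p <= size (teval v Lx))%N -> (size d <= size (teval v LB))%N ->
    exists u' t, [/\ exec (body c (if c then s1 else s0)) u u' t,
      (u' m.+1 = take (size (u m.+2)) (ev no_oracle (econs p (econs d v)) (if c then s1 else s0)))
      /\ u' m.+3 = rcons p c,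
      (forall r, (r <= m)%N -> u' r = u r), u' m.+2 = u m.+2 &
      (t <= size (teval v Ts) + 3)%N].
  move=> hu hp hd.
  have [u' [t [g1 w1 j1 c1]]] : exists u' t, [/\ exec (cexp (rec_regs a m) m.+4 (if c then s1 else s0)) u u' t,
      u' m.+4 = ev no_oracle (econs p (econs d v)) (if c then s1 else s0),
      (forall r, (r < m.+4)%N -> u' r = u r) & (t <= size (teval v Ts))%N].
    have ee : (fun i => u (rec_regs a m i)) = econs p (econs d v).
      by apply: funext => -[|[|i]] //=; rewrite hu.
    have mono T : (size (teval (econs p (econs d v)) T) <= size (teval v (tsubst sb T)))%N.
      by rewrite teval_subst; apply: size_teval_mono => -[|[|i]].
    have m0 := mono T0; have m1 := mono T1; case: c.
      have [u' [t [g1 w1 j1 c1]]] := IH1 _ _ u ha'; rewrite ee in w1 c1.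
      by exists u', t; split=> //; rewrite /Ts /= size_cat; lia.
    have [u' [t [g1 w1 j1 c1]]] := IH0 _ _ u ha'; rewrite ee in w1 c1.
    by exists u', t; split=> //; rewrite /Ts /= size_cat; lia.
  pose y1 := upd u' m.+1 (u' m.+4).
  pose y2 := upd y1 m.+1 (take (size (y1 m.+2)) (y1 m.+1)).
  exists (upd y2 m.+3 (rcons (y2 m.+3) c)); eexists; split.
  - apply: exec_seq g1 (exec_seq (@exec_prim (Copy _ _) _ I)
      (exec_seq (@exec_prim (Trunc _ _) _ I) (@exec_prim (Push _ _) _ I))).
  - rewrite updE updN; last by lia.
    rewrite /y2 updE updN; last by lia.
    by rewrite /y1; read_upd; rewrite w1 !j1 //; lia.
  - by move=> r hr; rewrite /y2 /y1 !updN ?j1 //; lia.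
  - by rewrite /y2 /y1 !updN ?j1 //; lia.
  - lia.
pose h c p d := if c then ev no_oracle (econs p (econs d v)) s1 else ev no_oracle (econs p (econs d v)) s0.
have loop u : (forall r, (r < m)%N -> u r = s r) ->
    (size (u m.+3) + size (u m) <= size (teval v Lx))%N ->
    (size (u m.+2) <= size (teval v LB))%N -> (size (u m.+1) <= size (teval v LB))%N ->
    exists u' t, [/\ exec (Loop m (body true s1) (body false s0)) u u' t,
      u' m.+1 = (nrec_pair (size (u m.+2)) h (u m.+3, u m.+1) (u m)).2,
      (forall r, (r < m)%N -> u' r = s r) &
      (t <= size (u m) * (size (teval v Ts) + 4) + 1)%N].
  move e: (u m) => y; elim: y u e => [|c y IH] u e hu hp hB hd.
    exists (upd u m [::]), 1; split=> //; first exact: exec_exit.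
      by rewrite updN //; lia.
    by move=> r hr; rewrite updN ?hu //; lia.
  pose u0 := upd u m y.
  have eu r : r != m -> u0 r = u r by move=> hr; rewrite /u0 updN.
  have [| | |u' [t [g1 [w1 w1'] j1 j1' c1]]] := step c u0.
  - by move=> r hr; rewrite eu ?hu //; lia.
  - by rewrite eu; move: hp => /=; lia.
  - by rewrite eu //; lia.
  rewrite !eu in w1 w1' j1'; try by lia.
  have [| | | | |u'' [t' [g2 w2 j2 c2]]] := IH u'.
  - by rewrite j1 // /u0 updE.
  - by move=> r hr; rewrite j1 ?eu ?hu //; lia.
  - by rewrite w1' size_rcons; move: hp => /=; lia.
  - by rewrite j1'.
  - by rewrite w1 size_take_min; lia.
  exists u'', (1 + t + t')%N; split=> //.
  - by apply: exec_loop e _ g2; move: g1; case: (c).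
  - by rewrite w2 j1' w1 w1' /=; case: (c).
  - by rewrite -[size (c :: y)]/(size y).+1 mulSn; lia.
pose y1 := upd u3 m.+1 (take (size (u3 m.+2)) (u3 m.+1)).
pose y2 := upd y1 m.+3 [::].
have hx := hLx no_oracle v; have hB := hLB no_oracle v.
have y3 : y2 m.+3 = [::] by rewrite /y2 updE.
have y22 : y2 m.+2 = ev no_oracle v B by rewrite /y2 /y1 !updN ?v3 //; lia.
have y21 : y2 m.+1 = take (size (ev no_oracle v B)) (ev no_oracle v z).
  by rewrite /y2 /y1; read_upd; rewrite v3 k3 ?v2 //; lia.
have y20 : y2 m = ev no_oracle v x by rewrite /y2 /y1 !updN ?k3 ?k2 ?v1 //; lia.
have [| | | |u4 [t4 [h4 v4 k4 b4]]] := loop y2.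
- by move=> r hr; rewrite /y2 /y1 !updN ?k3 ?k2' //; lia.
- by rewrite y3 y20.
- by rewrite y22.
- by rewrite y21 size_take_min; lia.
rewrite y3 y22 y21 y20 in v4 b4.
exists (upd u4 m (u4 m.+1)); eexists; split.
- apply: exec_seq h1 (exec_seq h2 (exec_seq h3 (exec_seq (@exec_prim (Trunc _ _) _ I)
    (exec_seq (@exec_prim (Clear _) _ I) (exec_seq h4 (@exec_prim (Copy _ _) _ I)))))).
- by rewrite updE v4.
- by move=> r hr; rewrite updN ?k4 //; lia.
- clearbody Ts; rewrite -[teval v (TCat _ _)]/((teval v Tx ++ teval v Tz) ++ (teval v TB ++ [:: true; true; true; true]) ++
    flatten (nseq (size (teval v Lx)) (teval v Ts ++ [:: true; true; true; true]))) !(size_cat, size_times).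
  rewrite -[size [:: _; _; _; _]]/4; move: hx b4 b1 b2 b3.
  move: (size (ev _ _ _)) (size (teval v Ts)) (size (teval v Lx)) (size (teval v Tx))
    (size (teval v Tz)) (size (teval v TB)) => p1 p2 p3 p4 p5 p6; nia.
Qed.

(** * Representable functions are computed by machines *)

Definition polyb (f : nat -> nat) : Prop := exists p : {poly nat}, forall n, (f n <= p.[n]%R)%N.

Lemma polyb_id : polyb id.
Proof. by exists 'X%R => n; rewrite hornerX. Qed.

Lemma polyb_const k : polyb (fun=> k).
Proof. by exists (k%:P)%R => n; rewrite hornerC. Qed.

Lemma polyb_add f g : polyb f -> polyb g -> polyb (fun n => f n + g n)%N.
Proof. by move=> [p hp] [q hq]; exists (p + q)%R => n; rewrite hornerD leq_add. Qed.

Lemma polyb_mul f g : polyb f -> polyb g -> polyb (fun n => f n * g n)%N.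
Proof. by move=> [p hp] [q hq]; exists (p * q)%R => n; rewrite hornerM leq_mul. Qed.

Definition term_growth (t : term) (n : nat) : nat := size (teval (fun=> nseq n true) t).

Lemma size_teval_growth v t n : (forall i, (size (v i) <= n)%N) ->
  (size (teval v t) <= term_growth t n)%N.
Proof. by move=> h; apply: size_teval_mono => i; rewrite size_nseq. Qed.

Lemma polyb_term t : polyb (term_growth t).
Proof.
rewrite /term_growth; elim: t => [i||b|t IH s IH'|t IH s IH'] /=.
- by have [p hp] := polyb_id; exists p => n; rewrite size_nseq; exact: hp.
- exact: polyb_const.
- exact: polyb_const.
- by have [p hp] := polyb_add IH IH'; exists p => n; rewrite size_cat; exact: hp.
- by have [p hp] := polyb_mul IH IH'; exists p => n; rewrite size_times; exact: hp.
Qed.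

(** * Recovering the arguments from the input tracks *)

Definition sym_value (W : Type) (a : symbol W) : bool := if a is Bit b then b else true.
Definition sym_isbit (W : Type) (a : symbol W) : bool := if a is Bit _ then true else false.

Definition lead (x : word) : word := take (find negb x) x.

(** [x] is the track of values and [k] the track that tells bits from separators; each argument is a
    run of ones in [k], and passing to the next one skips the separator too. *)
Fixpoint arg (i : nat) (x k : word) : word :=
  if i is j.+1 then arg j (drop (size ([:: true] ++ lead k)) x) (drop (size ([:: true] ++ lead k)) k)
  else take (size (lead k)) x.

Lemma ex_lead f : EX f -> EX (fun w v => lead (f w v)).
Proof.
move=> hf; apply: (@ex_rec (fun w v x => lead x) f (fun w v => [::]) (fun c w p a v =>
  if c then (if a == p then a ++ [:: true] else a) else a) f) => //.
- exact: ex_const.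
- case; last exact: ex_var.
  apply: ex_if; [|by apply: ex_cat; [exact: ex_var|exact: ex_const]|exact: ex_var].
  by apply: ep_eq; exact: ex_var.
- move=> w v p c; rewrite /lead -cats1 find_cat.
  case: (boolP (has negb p)) => [hp|/hasNfind e].
    have lt := hp; rewrite has_find in lt; rewrite takel_cat; last exact: ltnW.
    case: c => //; case: eqP => // /(congr1 size); rewrite size_take_min => h.
    by move: lt; rewrite -h ltn_min ltnn.
  rewrite e take_size eqxx; case: c => /=; rewrite ?addn1 ?addn0 take_cat.
    by rewrite ltnNge leqnSn /= subSnn.
  by rewrite ltnn subnn take0 cats0.
- by move=> w v p /prefixP[t ->]; rewrite /lead size_take_min size_cat; lia.
Qed.

Lemma ex_arg i f g : EX f -> EX g -> EX (fun w v => arg i (f w v) (g w v)).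
Proof.
elim: i f g => [|i IH] f g hf hg; first by apply: ex_take => //; exact: ex_lead.
have hl : EX (fun w v => [:: true] ++ lead (g w v)).
  by apply: ex_cat; [exact: ex_const|exact: ex_lead].
by apply: IH; exact: ex_drop.
Qed.

Lemma arg_encode W i (xs : seq word) :
  arg i (map (@sym_value W) (encode W xs)) (map (@sym_isbit W) (encode W xs)) = nth [::] xs i.
Proof.
have e1 x : map (@sym_value W) (map Bit x) = x by elim: x => //= b x ->.
have e2 (x : word) : map (@sym_isbit W) (map Bit x) = nseq (size x) true.
  by elim: x => //= b x ->.
have l1 n : lead (nseq n true) = nseq n true.
  by elim: n => //= n IH; rewrite /lead /= -/(lead _) IH.
have l2 n (u : word) : lead (nseq n true ++ false :: u) = nseq n true.
  by elim: n => //= n IH; rewrite /lead /= -/(lead _) IH.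
have nil j : arg j [::] [::] = [::] by elim: j.
elim: xs i => [|x [|y xs] IH] i; first by rewrite nth_nil nil.
  rewrite /= e1 e2; case: i => [|i] /=; first by rewrite l1 size_nseq take_size.
  by rewrite l1 size_nseq !drop_oversize ?size_nseq // nil nth_nil.
rewrite -[encode W _]/(map Bit x ++ Sharp :: encode W (y :: xs)) !map_cat e1 e2.
case: i => [|i]; rewrite /= l2 size_nseq; first by rewrite take_size_cat.
have dr n (u v : word) b : size u = n -> drop n.+1 (u ++ b :: v) = v.
  by move=> <-; rewrite -cat_rcons drop_size_cat // size_rcons.
by rewrite !dr ?size_nseq // IH.
Qed.

Definition input_regs (W : Type) (u : seq (symbol W)) (r : nat) : word :=
  match r with 0 => map (@sym_value W) u | 1 => map (@sym_isbit W) u | _ => [::] end.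

Lemma rds_encode K xs (u := encode (option {ffun 'I_K -> option bool}) xs) :
  map (@rds K) u = cells K (size u) (input_regs u) /\ all (@nonblank K) u.
Proof.
rewrite /u {u}; set W := option {ffun _}; pose io (a : symbol W) := match a with Bit _ | Sharp => true | _ => false end.
have : all io (encode W xs).
  have hx x : all io (map Bit x) by elim: x.
  elim: xs => // x [|y xs] IH; first exact: hx.
  by rewrite -[encode W _]/(map Bit x ++ Sharp :: encode W (y :: xs)) all_cat hx.
elim: (encode W xs) => [|a u' IH] //= /andP[ha hu]; have [-> ->] := IH hu.
split; last by case: a ha.
congr cons; last by apply: cells_ext => -[|[|r]].
by apply/ffunP => r; case: a ha => //= [b|] _; rewrite /cell2 !ffunE /= ?ffunE;
  case: (nat_of_ord r) => [|[|j]].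
Qed.

Section Machine.
Variables (D : term) (e2 eD : expr).
Hypothesis eDE : forall w v, ev w v eD = teval v D.

(** Registers 0 and 1 hold the two input tracks, 2 a word whose length is the number of coins, 3 the
    coins, 4 the result. *)
Let a1 (i : nat) : nat := if i is _.+1 then 1 else 0.
Let a2 (i : nat) : nat := if i is j.+1 then a1 j else 3.
Let p1 : prog := Seq (cexp a1 2 eD) (Prim (Clear 3)).
Let p2 : prog := cexp a2 4 e2.
Let K : nat := maxn 5 (maxn (progregs p1) (progregs p2)).

Let W : finType := option {ffun 'I_K -> option bool}.

Let sampler : prog := Loop 2 (Prim (Coin 3)) (Prim (Coin 3)).

Definition lazy_machine : ptm :=
  mach (cseq (chome K) (cseq (cprim K (Clear 2)) (cseq (compile K p1) (cseq (compile K sampler)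
    (cseq (compile K p2) (cout K 4)))))).

Definition input_env (xs : seq word) (i : nat) : word :=
  if i is _.+1 then map (@sym_isbit W) (encode W xs) else map (@sym_value W) (encode W xs).

(** All that precedes the tossing is deterministic, so the toss times [lab] depend on the input only
    and the coins used are fixed, distinct coordinates. *)
Lemma lazy_machine_run : exists2 B : nat -> nat, polyb B & forall xs,
  exists2 lab : nat -> nat, injective lab & forall c, exists2 k, (k <= B (size (encode W xs)))%N &
  halted (run c k (init lazy_machine xs)) /\
  output (run c k (init lazy_machine xs)) =
    ev no_oracle (econs [seq c (lab j) | j <- iota 0 (size (teval (input_env xs) D))] (input_env xs)) e2.
Proof.
have [T1 hT1] := cexp_exec eD; have [T2 hT2] := cexp_exec e2.
pose T3 := tsubst (fun i => if i is j.+1 then TVar j else D) T2.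
(* [b1], [b2], [b3] count the operations for finding the number of coins, for tossing them (up to
   the final pop) and for evaluating; [n1], [n2], [n3] bound the tape length after each phase. *)
pose b1 n := (term_growth T1 n + 1)%N; pose b2 n := (term_growth D n + term_growth D n)%N.
pose b3 := term_growth T3.
pose n1 n := (n + 1 + b1 n)%N; pose n2 n := (n1 n + b2 n + 1)%N; pose n3 n := (n2 n + b3 n)%N.
pose B n := (2 + (n + n + 4) + b1 n * (n1 n + n1 n + 4) + (b2 n + 1) * (n1 n + b2 n + (n1 n + b2 n) + 8)
  + b3 n * (n3 n + n3 n + 4) + (n3 n + n3 n + 3))%N.
exists B.
  by rewrite /B /n3 /n2 /n1 /b1 /b2 /b3;
    repeat first [exact: polyb_term | exact: polyb_id | exact: polyb_const
      | apply: polyb_add | apply: polyb_mul].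
move=> xs; set n := size (encode W xs).
have [hr hn] := rds_encode K xs; set s0 := input_regs _ in hr.
have K5 : (5 <= K)%N by rewrite leq_maxl.
have Kp1 : (progregs p1 <= K)%N by rewrite /K; lia.
have Kp2 : (progregs p2 <= K)%N by rewrite /K; lia.
have f0 : fits K n s0 by move=> [|[|r]] _ //=; rewrite size_map.
have hC2 : (pregs (Clear 2) <= K)%N by rewrite /=; lia.
pose u1 := upd s0 2 [::].
have f1 : fits K n.+1 u1 by have [_] := pscan false hC2 f0.
have ha1 i : (a1 i < 2)%N by case: i.
have v1 : (fun i => u1 (a1 i)) = input_env xs.
  by apply: funext => -[|i] /=; rewrite /u1 /upd.
have hv i : (size (input_env xs i) <= n)%N by case: i => [|i]; rewrite /= size_map.
have [u2 [t1 [x1 e1 k1 le1]]] := hT1 a1 2 u1 ha1; rewrite v1 eDE in e1 le1.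
have x2 : exec p1 u1 (upd u2 3 [::]) (t1 + 1).
  exact: exec_seq x1 (@exec_prim (Clear 3) _ I).
have [f2 [c1 lc1 [q1 d1]]] := exec_does x2 Kp1 f1.
pose u3 := upd u2 3 [::]; pose N1 := (n.+1 + (t1 + 1))%N.
pose m := size (teval (input_env xs) D).
have u32 : u3 2 = teval (input_env xs) D by rewrite /u3 updN.
pose S0 := (2 + (n.*2 + 4) + c1)%N.
exists (toss S0 N1).
  exact: toss_inj.
move=> c; have K2 : (2 < K)%N by lia.
have K3 : (3 < K)%N by lia.
have [c2 lc2 [u4 [f4 e4 k4 [q2 d2]]]] := coin_loop_does K2 K3 isT c [::] S0 f2.
rewrite -/u3 -/N1 u32 -/m in lc2 f4 e4 d2.
rewrite /u3 updE cat0s in e4.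
have ha2 i : (a2 i < 4)%N by case: i => [|[|i]].
have [u5 [t2 [x5 e5 k5 le5]]] := hT2 a2 4 u4 ha2.
have v2 : (fun i => u4 (a2 i)) = econs [seq c (toss S0 N1 j) | j <- iota 0 m] (input_env xs).
  apply: funext => -[|i]; first by rewrite /= e4.
  have hi := ha1 i; rewrite [a2 _]/= k4; [|by lia|by lia].
  by rewrite /u3 updN ?k1 // -?v1 //; lia.
rewrite v2 in e5 le5.
have [f5 [c3 lc3 [q3 d3]]] := exec_does x5 Kp2 f4.
have K4 : (4 < K)%N by lia.
have [l [r [d4 out]]] := cout_does c (S0 + c2 + c3) [::] K4 f5.
have [tl htl d0] := @chome_does K c 0 (encode W xs).
have dC := @does_psem K (Clear 2) c (0 + 2) [::] _ _ _ _ hC2 f0 hn hr htl.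
rewrite -/n in dC.
have d1' := d1 c (0 + 2 + (n.*2 + 4))%N [::].
have d2' : does (compile K sampler) c (0 + 2 + (n.*2 + 4) + c1) c2 [::] (tape K N1 u3) q2 [::]
    (tape K (N1 + m.*2 + 1) u4) by [].
have d3' := d3 c (0 + 2 + (n.*2 + 4) + c1 + c2)%N [::].
have d4' : does (cout K 4) c (0 + 2 + (n.*2 + 4) + c1 + c2 + c3) ((size (u5 4)).*2 + 3) [::]
  (tape K (N1 + m.*2 + 1 + t2) u5) None l r by [].
have all := does_seq d0 (does_seq dC (does_seq d1' (does_seq d2' (does_seq d3' d4')))).
have := reach_run all; set k := (2 + _)%N => hrun.
exists k; last first.
  have -> : run c k (init lazy_machine xs) = (inr None, l, r) by [].
  by split=> //; rewrite /output /= out e5.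
have g1 : (t1 + 1 <= b1 n)%N.
  by rewrite leq_add2r; apply: leq_trans le1 _; exact: size_teval_growth.
have g2 : (m.*2 <= b2 n)%N.
  by rewrite -addnn leq_add //; exact: size_teval_growth.
have g3 : (t2 <= b3 n)%N.
  apply: leq_trans le5 _; apply: leq_trans (size_teval_growth T3 hv).
  rewrite teval_subst; apply: size_teval_mono => -[|i] //=.
  by rewrite size_map size_iota.
have g4 : (N1 <= n1 n)%N by rewrite /N1 /n1; lia.
have g5 : (N1 + m.*2 + 1 <= n2 n)%N by rewrite /n2; lia.
have g6 : (N1 + m.*2 + 1 + t2 <= n3 n)%N by rewrite /n3; lia.
have g7 : (size (u5 4) <= n3 n)%N by apply: leq_trans g6; exact: f5.
rewrite -/N1 in lc1.
have h1 : (c1 <= b1 n * (n1 n + n1 n + 4))%N.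
  by apply: leq_trans lc1 _; apply: leq_mul => //; lia.
have h2 : (c2 <= (b2 n + 1) * (n1 n + b2 n + (n1 n + b2 n) + 8))%N.
  by apply: leq_trans lc2 _; apply: leq_mul; lia.
have h3 : (c3 <= b3 n * (n3 n + n3 n + 4))%N.
  by apply: leq_trans lc3 _; apply: leq_mul => //; lia.
by rewrite /k /B; lia.
Qed.

End Machine.

Section Representable.
Local Open Scope classical_set_scope.

Theorem representable_RFP (R : realType) (k : nat) (f : random_function R k) :
  representable f -> RFP f.
Proof.
move=> [G [hS hsc hpr hf]]; have [e he] := witnessing hS hpr.
pose vx (xs : seq word) i := nth [::] xs i : word.
have instE w xs y : holds w (fun=> [::]) (instance G xs y) <-> holds w (scons y (vx xs)) G.
  rewrite !holds_std /instance sat_subst; apply: sat_ext => -[|i]; exact: numeral_std.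
(* By soundness in the standard model uniqueness holds for every oracle, so the feasible witness [e]
   is the only solution. *)
have uniq_sol w v y y' : holds w (scons y v) G -> holds w (scons y' v) G -> y = y'.
  have : sat (M := std w) v (ex_unique G).
    have [hM hax] := std_model w.
    have : forall r, sat (M := std w) r (iter k FAll (ex_unique G)).
      by move=> r; apply: (soundness _ hpr) => // A r' hA; exact: hax.
    elim: (k) v => [|k' IH] v h; first exact: h.
    apply: IH => r; have := h (fun i => r i.+1) (r 0).
    by apply: (sat_ext _ _).1; case.
  move=> [z [_ hz]]; have only y0 : holds w (scons y0 v) G -> y0 = z.
    move=> /holds_std h0; have [h|h //] := hz y0; case: h; apply/sat_subst.
    by move: h0; apply: (sat_ext _ _).1; case.
  by move=> /only -> /only ->.
(* The machine starts from two tracks instead of the arguments, so [e1] cuts these out first. *)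
have [e1 e1E] : EX (fun w v => ev w (fun i => arg i (v 0) (v 1)) e).
  have ee : EX (fun w v => ev w v e) by exists e.
  exact: (ex_subst (g := fun i w v => arg i (v 0) (v 1)) ee (fun i => ex_arg i (ex_var 0) (ex_var 1))).
have [L [N [D hb]]] := qt_bound e1.
have [e2 e2E] := ex_lazy e1; have [eD eDE] := ex_term D.
have [B [p hp] hrun] := lazy_machine_run e2 eDE.
exists (lazy_machine e2 eD); split.
  exists p => xs c; have [lab _ h] := hrun xs; have [k' hk [h1 _]] := h c.
  rewrite (run_halted h1) //; exact: leq_trans hk (hp _).
move=> xs y; rewrite hf; have [lab inj h] := hrun xs.
set v := input_env e2 eD xs in h.
pose t := qt v e1; pose n := size (teval v D).
pose F (r : word) := drun (answer (lookup (foldl (sample t) [::] r))) t.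
rewrite (_ : interp _ = [set w | drun w (ded [::] t) = y]); last first.
  have eqv w : ev w v e1 = ev w (vx xs) e.
    by rewrite e1E; apply: ev_ext => i; exact: arg_encode.
  apply/seteqP; split=> w; rewrite /interp /= ded_run // drun_qt eqv instE.
    by move=> hy; exact: uniq_sol (he _ _) hy.
  by move=> <-; exact: he.
rewrite (_ : outputs _ xs y = [set c | drun c (coin_tree lab n 0 [::] F) = y]); last first.
  have hout c : exists2 k', halted (run c k' (init (lazy_machine e2 eD) xs)) &
      output (run c k' (init (lazy_machine e2 eD) xs)) = drun c (coin_tree lab n 0 [::] F).
    have [k' _ [h1 h2]] := h c; exists k' => //.
    by rewrite h2 e2E coin_tree_run.
  apply/seteqP; split=> c /=; have [k' h1 h2] := hout c.
    move=> [j [hj <-]]; rewrite -h2; congr output.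
    by case: (leqP j k') => [/(run_halted hj)|/ltnW/(run_halted h1)].
  by move=> <-; exists k'.
have n_le : dle n (ded [::] t) by have [_ h2] := hb v; exact: ded_le.
rewrite !fair_dtree; last 4 first.
- exact: coin_measure_fair.
- exact: coin_tree_fresh.
- exact: coin_measure_fair.
- exact: (ded_fresh [::] t).
(* What remains is the identity of lazy sampling: the tree without repeated queries against [n]
   coins tossed in advance. *)
rewrite (dfull_weight _ _ (coin_tree_full _ _ _ _ _)); congr EFin.
by have := @fweight_sample R t y n [::] n_le.
Qed.

End Representable.

Theorem theorem3p7 (R : realType) (k : nat) (f : random_function R k) :
  representable f <-> RFP f.
Proof. by split; [exact: representable_RFP|exact: RFP_representable]. Qed.
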